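(* Let $f:[0,\infty)\to[0,\infty)$ be a directly Riemann integrable function on $[0,\infty)$. Assume that the distribution of $\xi$ is nonlattice and that $m:=\mathbb{E}\xi<\infty$. Then, for fixed $j\in\mathbb{N}$, $$\int_{[0,\,t]}f(t-y)\,\mathrm{d}V_j(y)\ \sim\ \Big(\frac1m\int_0^\infty f(y)\,\mathrm{d}y\Big)V_{j-1}(t)\ \sim\ \Big(\int_0^\infty f(y)\,\mathrm{d}y\Big)\frac{t^{j-1}}{(j-1)!\,m^j},\qquad t\to\infty,$$ in the sense that $$\lim_{t\to\infty}\frac{\int_{[0,t]}f(t-y)\,\mathrm{d}V_j(y)}{V_{j-1}(t)}=\frac1m\int_0^\infty f(y)\,\mathrm{d}y\quad\text{and}\quad \lim_{t\to\infty}\frac{\int_{[0,t]}f(t-y)\,\mathrm{d}V_j(y)}{t^{j-1}}=\frac{1}{(j-1)!\,m^j}\int_0^\infty f(y)\,\mathrm{d}y.$$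
   Context: Let $(\xi_i,\eta_i)_{i\in\mathbb{N}}$ be independent copies of a random vector $(\xi,\eta)$ whose components are a.s. positive and arbitrarily dependent. Put $S_0:=0$, $S_i:=\xi_1+\cdots+\xi_i$ and $T_i:=S_{i-1}+\eta_i$ for $i\in\mathbb{N}$; the sequence $T:=(T_i)_{i\in\mathbb{N}}$ is called a perturbed random walk. General branching process generated by $T$: at time $0$ there is one individual, the ancestor, whose children (the first generation) have birth times given by the points of $T$. The individuals of the $(j-1)$th generation produce the $j$th generation: the shifts of the birth times of the children of an individual with respect to that individual's birth time are distributed as a copy of $T$, the copies for different mothers being independent of each other and of the past. Formally, let $T^{(u)}=(T^{(u)}_i)_{i\in\mathbb{N}}$, $u\in\bigcup_{n\ge 0}\mathbb{N}^n$, be independent copies of $T$; the $j$th generation individual $u=(u_1,\ldots,u_j)\in\mathbb{N}^j$ has birth time $\sum_{i=1}^j T^{((u_1,\ldots,u_{i-1}))}_{u_i}$. For $j\in\mathbb{N}$ and $t\ge 0$, $N_j(t)$ denotes the number of $j$th generation individuals with birth times $\le t$, and $V_j(t):=\mathbb{E}N_j(t)$ (with $V_j(t):=0$ for $t<0$). By convention $V_0(t):=1$ for $t\ge 0$. The distribution of a positive random variable is called nonlattice if it is not concentrated on any lattice $(nd)_{n\in\mathbb{N}_0}$, $d>0$, where $\mathbb{N}_0=\mathbb{N}\cup\{0\}$. *)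

(* Defs.v *)
From HB Require Import structures.
From mathcomp Require Export all_boot all_order all_algebra finmap.
From mathcomp Require Export all_classical all_reals all_analysis.

Set Implicit Arguments.
Unset Strict Implicit.
Unset Printing Implicit Defensive.

Export Order.TTheory GRing.Theory Num.Theory.
Export numFieldNormedType.Exports.

Local Open Scope classical_set_scope.
Local Open Scope ring_scope.
Local Open Scope ereal_scope.

(* Objects usually indexed by {1, 2, ...} are indexed here by nat, from 0:
   xi k, eta k and T k stand for xi_(k+1), eta_(k+1) and T_(k+1), and a
   sequence of naturals is an individual with each label lowered by one. *)

Definition cylinders (R : realType) : set (set (nat -> R)) :=
  [set A | exists (i : nat) (B : set R),
    measurable B /\ A = [set x : nat -> R | B (x i)]].

(* R^N with the product sigma-algebra *)
Definition realseq (R : realType) := g_sigma_algebraType (@cylinders R).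

Section copies.
Context d d' (Omega : measurableType d) (E : measurableType d') (R : realType).
Variable P : probability Omega R.

Definition same_law (X Y : Omega -> E) : Prop :=
  forall B : set E, measurable B -> P (X @^-1` B) = P (Y @^-1` B).

Definition mutually_independent (I : choiceType) (X : I -> Omega -> E) : Prop :=
  forall (J : {fset I}) (B : I -> set E), (forall i, measurable (B i)) ->
    P (\bigcap_(i in [set` J]) (X i @^-1` B i)) =
    \prod_(i <- J) P (X i @^-1` B i).

Definition independent_copies (I : choiceType) (X : I -> Omega -> E)
    (Y : Omega -> E) : Prop :=
  (forall i, same_law (X i) Y) /\ mutually_independent X.

End copies.

Section branching.
Context d (Omega : measurableType d) (R : realType).

(* With indices from 0, T_(k+1) = S_k + eta_(k+1) has k summands in S_k. *)
Definition perturbed_walk (xi eta : nat -> Omega -> R) (w : Omega) : realseq R :=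
  fun k : nat => ((\sum_(i < k) xi i w) + eta k w)%R.

Variable P : probability Omega R.

(* T u is the process T^(u) attached to the individual u, where u runs over
   the finite sequences of naturals and [::] is the ancestor. *)
Variable T : seq nat -> Omega -> realseq R.

Definition birth_time (j : nat) (u : j.-tuple nat) (w : Omega) : R :=
  (\sum_(i < j) T (take i u) w (tnth u i))%R.

Definition N_ (j : nat) (t : R) (w : Omega) : \bar R :=
  counting [set u : j.-tuple nat | (birth_time u w <= t)%R].

(* For j = 0 and t >= 0 the only individual is the ancestor, so V_ 0 t = 1;
   see V_0 below. *)
Definition V_ (j : nat) (t : R) : \bar R :=
  if (t < 0)%R then 0 else \int[P]_w N_ j t w.

Lemma V_0 (t : R) : (0 <= t)%R -> V_ 0 t = 1.
Proof.
move=> t0; rewrite /V_ ltNge t0 /=.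
have N01 w : N_ 0 t w = 1.
  rewrite /N_ (_ : [set _ | _] = [set [tuple]]).
    rewrite /counting asboolT; last exact: finite_set1.
    by rewrite fset_set1 cardfs1.
  apply/seteqP; split=> u /= _; first by rewrite tuple0.
  by rewrite /birth_time big_ord0.
under eq_integral do rewrite N01.
by rewrite integral_cst// mul1e; exact: probability_setT.
Qed.

End branching.

(* The first branch applies when V is finite, nondecreasing and
   right-continuous; there dV is the library's measure, see stieltjesE. *)
Definition stieltjes (R : realType) (V : R -> \bar R) :
    set (measurableTypeR R) -> \bar R :=
  if pselect (exists F : cumulative R R, forall t, V t = (F t)%:E) is left h
  then lebesgue_stieltjes_measure (projT1 (cid h)) else mzero.

Lemma stieltjesE (R : realType) (V : R -> \bar R) (F : cumulative R R) :
  (forall t, V t = (F t)%:E) -> stieltjes V = lebesgue_stieltjes_measure F.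
Proof.
move=> VF; rewrite /stieltjes; case: pselect => [h|]; last by case; exists F.
case: (cid h) => G /= VG; rewrite /lebesgue_stieltjes_measure /measure_extension.
suff GF : G = F :> (R -> R) by rewrite /= GF.
by apply/funext => t; apply: EFin_inj; rewrite -VG VF.
Qed.

Definition nonlattice (R : realType) (mu : set R -> \bar R) : Prop :=
  forall h : R, (0 < h)%R -> mu [set (n%:R * h)%R | n in [set: nat]] <> 1.

Definition upper_sum (R : realType) (f : R -> R) (h : R) : \bar R :=
  h%:E * \sum_(0 <= n <oo)
    ereal_sup [set (f y)%:E | y in `[(n%:R * h)%R, (n.+1%:R * h)%R[].

Definition lower_sum (R : realType) (f : R -> R) (h : R) : \bar R :=
  h%:E * \sum_(0 <= n <oo)
    ereal_inf [set (f y)%:E | y in `[(n%:R * h)%R, (n.+1%:R * h)%R[].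

(* Only the values of f on [0, +oo[ matter. *)
Definition directly_Riemann_integrable (R : realType) (f : R -> R) : Prop :=
  (forall h : R, (0 < h)%R -> upper_sum f h < +oo) /\
  (upper_sum f h - lower_sum f h) @[h --> (0 : R)^'+] --> 0.

(* Main.v *)
Require Import Defs.
From HB Require Import structures.
From mathcomp Require Import measurable_realfun lra ring.

(** Let mu and la be the laws of xi and eta, S the random walk with steps xi,
and U = heaviside + mu * heaviside + mu * mu * heaviside + ... its renewal
function, where * is convolution. A child of an individual u is born at the
birth time of u plus an independent point of a perturbed random walk. So V_j is
the distribution function of a measure, the intensity of generation j, and
V_(j+1) is the convolution of that measure with V_1 = la * U (lemmas
V_intensity and V_succ).

Everything then rests on Blackwell's theorem U(t) - U(t - h) -> h / m (lemma
renewal_blackwell). Its proof is analytic. A window of U is smoothed into the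
potential of a trapezoid, which is bounded and uniformly continuous. The
difference of two translates of it is harmonic for mu at late times, so its
limit superior propagates backwards along the additive semigroup generated by
the support of mu. As mu is nonlattice this semigroup is asymptotically dense,
and a positive limit superior would contradict the boundedness of telescoping
sums (harmonic_limsup). Hence windows vary slowly. Their limit is identified by
the fact that, for t >= 0, exactly one point of S is the last one before t: the
potential at t of the function x |-> P(xi > x) on [0, +oo[ is 1 (potential_residual),
and this function, of integral m, is a limit of step functions.

Convolution of a bounded function of limit l at infinity with a measure whose
distribution function is c t^p + o(t^p) gives l c t^p + o(t^p) (asymp_conv).
For p = 0 this carries Blackwell's theorem from U to V_1, and for general p it
shows that the increments of V_(j+1) over the length h are equivalent to
(h / m) V_j. Summation of unit increments turns t^j into t^(j+1) / (j+1), whence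
V_j ~ t^j / (j! m^j) by induction (generation_asymp).

The two limits of the theorem follow from the asymptotics of the increments
alone (key_renewal). The function f is enclosed between its upper and lower
step functions of span h, which turns the integral against dV_j into a series
of increments of V_j. Each increment has known asymptotics, the series is
dominated because the increments before t are uniformly of order t^(j-1), and
the two resulting bounds merge as h -> 0 by direct Riemann integrability. *)

Set Implicit Arguments.
Unset Strict Implicit.
Unset Printing Implicit Defensive.

Local Open Scope classical_set_scope.
Local Open Scope ring_scope.

(** * Additive semigroups of reals and power asymptotics *)

Lemma submonoid_mulrn (R : realType) (D : set R) : D 0 ->
  (forall x y, D x -> D y -> D (x + y)) -> forall x n, D x -> D (x *+ n).
Proof.
move=> D0 DD x n Dx; elim: n => [|n IH]; first by rewrite mulr0n.
by rewrite mulrS; apply: DD.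
Qed.

(** The dichotomy is about the gaps between elements of D. If a and b = a + h
are in D, so are n a, n a + h, ..., n a + n h; once n h >= a these progressions
overlap and form an h-net of a half-line. If gaps are bounded below, the
smallest one is attained, and Euclidean division by it leaves no remainder. *)
Lemma submonoid_discrete_or_dense (R : realType) (D : set R) : D 0 ->
  (forall x y, D x -> D y -> D (x + y)) -> (forall x, D x -> 0 <= x) ->
  (exists2 d, 0 < d & forall x, D x -> exists n : nat, x = n%:R * d) \/
  (forall e, 0 < e -> exists X, forall y, X <= y ->
     exists2 x, D x & `|y - x| <= e).
Proof.
move=> D0 DD Dge0; have Dn := submonoid_mulrn D0 DD.
have [small|] := pselect (forall e, 0 < e ->
    exists a, exists2 b, D a /\ D b & 0 < b - a <= e).
  right=> e /small[a0 [b0 [Da0 Db0]]] /andP[h0 he].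
  (* Adding b0 to both ends keeps the gap and makes the left end positive. *)
  have [a [b [Da Db] [a_gt0 habE]]] :
      exists a, exists2 b, D a /\ D b & 0 < a /\ b - a = b0 - a0.
    exists (a0 + b0), (b0 + b0); first by split; apply: DD.
    have := Dge0 _ Da0; have := Dge0 _ Db0; split; [lra|ring].
  have [h bE] : exists h, b = a + h by exists (b - a); ring.
  have hE : h = b0 - a0 by rewrite -habE bE; ring.
  rewrite -hE in h0 he; rename h0 into h_gt0.
  clear hE habE Da0 Db0 a0 b0.
  (* From this point on, n = floor (y / a) is large enough for n h >= a. *)
  exists (a * (a / h + 1)) => y Xy.
  have ah_gt0 : 0 < a / h by apply: divr_gt0.
  have y_ge0 : 0 <= y by apply: le_trans Xy; apply: mulr_ge0; lra.
  pose n := Num.truncn (y / a).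
  have /andP[n1 n2] : n%:R <= y / a < n.+1%:R.
    by apply: truncn_itv; rewrite divr_ge0// ltW.
  have ny : n%:R * a <= y by rewrite -ler_pdivlMr.
  have yn : y < n.+1%:R * a by rewrite -ltr_pdivrMr.
  pose k := Num.truncn ((y - n%:R * a) / h).
  have /andP[k1 k2] : k%:R <= (y - n%:R * a) / h < k.+1%:R.
    by apply: truncn_itv; apply: divr_ge0; [rewrite subr_ge0 | exact: ltW].
  have k1' : k%:R * h <= y - n%:R * a by rewrite -ler_pdivlMr.
  have k2' : y - n%:R * a < k.+1%:R * h by rewrite -ltr_pdivrMr.
  have nh : a <= n%:R * h.
    rewrite -ler_pdivrMr//.
    have : a / h + 1 <= y / a by rewrite ler_pdivlMr// mulrC.
    by move: n2; rewrite -natr1; lra.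
  have kn : (k <= n)%N.
    rewrite -(ler_nat R) -(ler_pM2r h_gt0); apply: ltW; apply: le_lt_trans k1' _.
    by apply: lt_le_trans nh; move: yn; rewrite -natr1 mulrDl mul1r; lra.
  exists (a *+ (n - k) + b *+ k); first by apply: DD; apply: Dn.
  have -> : a *+ (n - k) + b *+ k = n%:R * a + k%:R * h.
    by rewrite -(mulr_natl a) -(mulr_natl b) natrB// bE; ring.
  rewrite -natr1 mulrDl mul1r in k2'.
  by clear -k1' k2' he; rewrite ler_norml; apply/andP; split; lra.
move=> /existsNP[c] /not_implyP[c0 nsmall]; left.
have gap a b : D a -> D b -> a < b -> c < b - a.
  move=> Da Db ab; rewrite ltNge; apply/negP => bac; apply: nsmall.
  by exists a, b => //; rewrite subr_gt0 ab.
pose S := [set z | exists a, exists2 b, D a /\ D b & a < b /\ z = b - a].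
have [[s Ss]|S0] := pselect (S !=set0); last first.
  exists 1 => // x Dx; exists 0%N; rewrite mul0r; apply/eqP; rewrite eq_le Dge0//.
  rewrite andbT leNgt; apply/negP => x0; apply: S0; exists x; exists 0, x => //.
  by rewrite subr0.
have infS : has_inf S.
  split; first by exists s.
  by exists c => z [a [b [Da Db] [ab ->]]]; apply/ltW/gap.
have Slb z : S z -> inf S <= z by move=> Sz; apply: ge_inf => //; case: infS.
have [g Sg gd] : exists2 g, S g & g < inf S + c by apply: inf_adherent.
(* Two distinct gaps close to the infimum would differ by a gap below c. *)
have dE : g = inf S.
  apply/eqP; rewrite eq_le Slb// andbT leNgt; apply/negP => dg.
  have [g' Sg' gg'] : exists2 g', S g' & g' < inf S + (g - inf S).
    by apply: inf_adherent => //; rewrite subr_gt0.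
  have := Slb _ Sg'.
  case: Sg Sg' gg' => a [b [Da Db] [ab gE]] [a' [b' [Da' Db'] [ab' gE']]] gg'.
  have : c < (b + a') - (a + b') by apply: gap; [exact: DD|exact: DD|lra].
  lra.
case: (Sg) => a [b [Da Db] [ab gE]].
have d0 : 0 < g by rewrite gE subr_gt0.
exists g => // x Dx; exists (Num.truncn (x / g)).
set n := Num.truncn _.
have /andP[n1 n2] : n%:R <= x / g < n.+1%:R.
  by apply: truncn_itv; apply: divr_ge0; [exact: Dge0|exact: ltW].
have n1' : n%:R * g <= x by rewrite -ler_pdivlMr.
have n2' : x < n.+1%:R * g by rewrite -ltr_pdivrMr.
apply/eqP; rewrite eq_le n1' andbT leNgt; apply/negP => nx.
have : S (x - n%:R * g).
  exists (b *+ n), (x + a *+ n); first by split; [exact: Dn|apply: DD => //; exact: Dn].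
  by rewrite -(mulr_natl a) -(mulr_natl b); move: nx; rewrite gE; split; [nra|ring].
by move=> /Slb; rewrite -dE; move: n2'; rewrite -natr1 mulrDl mul1r; lra.
Qed.

(** The expansion V(t) = c t^p + o(t^p) at infinity, where c = 0 is allowed. *)
Definition asymp (R : realType) (p : nat) (V : R -> R) (c : R) :=
  forall e, 0 < e -> exists T, forall t, T <= t ->
    `|V t - c * t ^+ p| <= e * t ^+ p.

Section asymp_theory.
Context {R : realType}.
Implicit Types (V W : R -> R) (p : nat) (a c : R).

Lemma asymp_add V W p c c' : asymp p V c -> asymp p W c' ->
  asymp p (fun t => V t + W t) (c + c').
Proof.
move=> Vc Wc e e0; have e2 : 0 < e / 2 by lra.
have [T HT] := Vc _ e2; have [T' HT'] := Wc _ e2.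
exists (Num.max T T') => t; rewrite ge_max => /andP[/HT h /HT' h'].
have -> : V t + W t - (c + c') * t ^+ p =
  (V t - c * t ^+ p) + (W t - c' * t ^+ p) by ring.
apply: le_trans (ler_normD _ _) _; apply: le_trans (lerD h h') _.
by rewrite -mulrDl -splitr.
Qed.

Lemma asymp_scale V p c a : asymp p V c -> asymp p (fun t => a * V t) (a * c).
Proof.
move=> Vc e e0; have a1 : 0 < `|a| + 1 by have := normr_ge0 a; lra.
have [T HT] := Vc _ (divr_gt0 e0 a1); exists (Num.max T 0) => t.
rewrite ge_max => /andP[/HT h t0].
have -> : a * V t - a * c * t ^+ p = a * (V t - c * t ^+ p) by ring.
have tp : 0 <= t ^+ p by apply: exprn_ge0.
rewrite normrM; apply: le_trans (ler_wpM2l (normr_ge0 _) h) _.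
rewrite mulrA; apply: ler_wpM2r => //; rewrite mulrCA ger_pMr//.
by rewrite ler_pdivrMr// mul1r; lra.
Qed.

Lemma asymp_exp_shift p a : asymp p (fun t => (t + a) ^+ p) 1.
Proof.
elim: p => [|p IH] e e0.
  by exists 0 => t _; rewrite !expr0 !mulr1 subrr normr0 ltW.
have [T HT] := IH _ (divr_gt0 e0 (ltr0Sn R 3)).
exists (Num.max (Num.max T 1) (Num.max `|a| (2 * `|a| / e))) => t.
rewrite !ge_max => /andP[/andP[/HT h t1] /andP[ta te]].
have tp : 0 <= t ^+ p by apply: exprn_ge0; lra.
rewrite !exprS.
have -> : (t + a) * (t + a) ^+ p - 1 * (t * t ^+ p) =
   (t + a) * ((t + a) ^+ p - 1 * t ^+ p) + a * t ^+ p by ring.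
have te' : 2 * `|a| <= e * t by move: te; rewrite ler_pdivrMr// (mulrC t).
apply: le_trans (ler_normD _ _) _; rewrite !normrM (ger0_norm tp).
have h1 : `|t + a| <= 2 * t.
  by apply: le_trans (ler_normD _ _) _; rewrite ger0_norm; lra.
have := ler_pM (normr_ge0 _) (normr_ge0 _) h1 h.
have := ler_wpM2r tp te'; nra.
Qed.

Lemma asymp_shift V p c a : asymp p V c -> asymp p (fun t => V (t - a)) c.
Proof.
move=> Vc e e0; have c1 : 0 < 2 * (`|c| + 1) by have := normr_ge0 c; lra.
have [T HT] := Vc _ (divr_gt0 e0 (ltr0Sn R 3)).
have [T' HT'] := asymp_exp_shift p (- a) (divr_gt0 e0 c1).
have [T'' HT''] := asymp_exp_shift p (- a) (@ltr01 R).
exists (Num.max (Num.max (T + a) 0) (Num.max T' T'')) => t.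
rewrite !ge_max => /andP[/andP[tT t0] /andP[/HT' h' /HT'' h'']].
have {}h := HT (t - a) (ltac:(lra)).
have tp : 0 <= t ^+ p by apply: exprn_ge0.
set P := t ^+ p in h' h'' tp *; set Q := (t - a) ^+ p in h h' h''.
have -> : V (t - a) - c * P = (V (t - a) - c * Q) + c * (Q - 1 * P) by ring.
apply: le_trans (ler_normD _ _) _; rewrite normrM.
have hQ : Q <= 2 * P by move: h''; rewrite ler_norml => /andP[]; lra.
have h2 : `|c| * `|Q - 1 * P| <= e / 2 * P.
  apply: le_trans (ler_wpM2l (normr_ge0 _) h') _.
  rewrite mulrA; apply: ler_wpM2r => //.
  have d0 := divr_gt0 e0 c1.
  have := divfK (lt0r_neq0 c1) e; move: (e / (2 * (`|c| + 1))) d0 => d d0 dE; lra.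
nra.
Qed.

Lemma asymp_diff V p c a : asymp p V c -> asymp p (fun t => V t - V (t - a)) 0.
Proof.
move=> Vc; have := asymp_add Vc (asymp_scale (-1) (asymp_shift a Vc)).
rewrite mulN1r subrr => + e e0 => /(_ e e0)[T HT].
by exists T => t /HT; rewrite mulN1r.
Qed.

(** The mean value theorem for the power p + 1, by induction from the two ways
of splitting the increment of a product. *)
Lemma powerD_bounds (x y : R) p : 0 <= x -> x <= y ->
  p.+1%:R * x ^+ p * (y - x) <= y ^+ p.+1 - x ^+ p.+1 <= p.+1%:R * y ^+ p * (y - x).
Proof.
move=> x0 xy; elim: p => [|p /andP[IH1 IH2]].
  by rewrite !expr0 !expr1 !mul1r !lexx.
have y0 : 0 <= y by lra.
have xp : 0 <= x ^+ p.+1 by exact: exprn_ge0.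
have yp : 0 <= y ^+ p.+1 by exact: exprn_ge0.
have xyp : x ^+ p.+1 <= y ^+ p.+1 by rewrite lerXn2r// nnegrE.
have E : y ^+ p.+2 - x ^+ p.+2 =
  y * (y ^+ p.+1 - x ^+ p.+1) + x ^+ p.+1 * (y - x) by rewrite !(exprS _ p.+1); ring.
have E' : y ^+ p.+2 - x ^+ p.+2 =
  x * (y ^+ p.+1 - x ^+ p.+1) + y ^+ p.+1 * (y - x) by rewrite !(exprS _ p.+1); ring.
apply/andP; split.
  rewrite E' -(natr1 p.+1) !mulrDl mul1r; apply: lerD.
    by have := ler_wpM2l x0 IH1; rewrite (exprS x p); lra.
  by apply: ler_wpM2r => //; lra.
rewrite E -(natr1 p.+1) !mulrDl mul1r; apply: lerD.
  by have := ler_wpM2l y0 IH2; rewrite (exprS y p); lra.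
by apply: ler_wpM2r => //; lra.
Qed.

(** Summation of unit increments, the discrete form of the integration of
c t^p. The comparison functions are C (t + 1)^(p+1) and C' t^(p+1), whose unit
increments are controlled by powerD_bounds; monotonicity of V takes care of the
fractional part of the starting time. *)
Lemma asymp_sum V p c : 0 <= c -> {homo V : x y / x <= y} ->
  asymp p (fun t => V t - V (t - 1)) c -> asymp p.+1 V (c / p.+1%:R).
Proof.
move=> c0 ndV Vc e e0; pose e1 := e / 4; have e10 : 0 < e1 by rewrite /e1; lra.
have [T0 HT0] := Vc _ e10; pose T := Num.max T0 1.
have T1 : 1 <= T by rewrite le_max lexx orbT.
have HT t : T <= t -> `|V t - V (t - 1) - c * t ^+ p| <= e1 * t ^+ p.
  by rewrite ge_max => /andP[/HT0].
pose q : R := p.+1%:R; have q1 : 1 <= q by rewrite ler1n.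
have q0 : 0 < q by lra.
have decomp t : T <= t -> exists n : nat, exists2 s, T <= s < T + 1 & t = s + n%:R.
  move=> Tt; have /andP[n1 n2] : (Num.truncn (t - T))%:R <= t - T < (Num.truncn (t - T)).+1%:R.
    by apply: truncn_itv; rewrite subr_ge0.
  exists (Num.truncn (t - T)), (t - (Num.truncn (t - T))%:R); last by ring.
  by move: n2; rewrite -natr1; lra.
pose K := V (T + 1); pose C := (c + e1) / q.
have C0 : 0 <= C by apply: divr_ge0; lra.
have CqE : C * q = c + e1 by rewrite mulfVK// gt_eqF.
have upper t : T <= t -> V t <= `|K| + C * (t + 1) ^+ p.+1.
  move=> /decomp[n [s /andP[Ts sT] ->]]; elim: n => [|n IH].
    rewrite addr0; apply: ler_wpDr.
      by apply: mulr_ge0 => //; apply: exprn_ge0; lra.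
    by apply: le_trans (ler_norm _); apply: ndV; lra.
  set u := s + n.+1%:R; have uE : u - 1 = s + n%:R by rewrite /u -natr1; ring.
  have n0 : 0 <= n%:R :> R by [].
  have u1 : T <= u by rewrite /u -natr1; lra.
  have up : 0 <= u ^+ p by apply: exprn_ge0; lra.
  have := HT _ u1; rewrite uE ler_norml => /andP[_ h].
  have /andP[+ _] := @powerD_bounds u (u + 1) p (ltac:(lra)) (ltac:(lra)).
  have -> : u + 1 - u = 1 by ring.
  rewrite mulr1 -/q => /(ler_wpM2l C0).
  rewrite mulrA CqE => h2.
  have uE' : s + n%:R + 1 = u by rewrite -uE; ring.
  move: IH; rewrite uE'; lra.
pose c' := Num.max 0 (c - e1); pose C' := c' / q.
have c'0 : 0 <= c' by rewrite le_max lexx.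
have C'0 : 0 <= C' by apply: divr_ge0; lra.
have C'qE : C' * q = c' by rewrite mulfVK// gt_eqF.
have lower t : T <= t -> C' * t ^+ p.+1 - (`|V T| + C' * (T + 1) ^+ p.+1) <= V t.
  move=> /decomp[n [s /andP[Ts sT] ->]]; elim: n => [|n IH].
    rewrite addr0; have := ndV _ _ Ts; have := ler_norm (- V T); rewrite normrN.
    have : s ^+ p.+1 <= (T + 1) ^+ p.+1 by rewrite lerXn2r// ?nnegrE; lra.
    by move=> /(ler_wpM2l C'0); lra.
  set u := s + n.+1%:R; have uE : u - 1 = s + n%:R by rewrite /u -natr1; ring.
  have n0 : 0 <= n%:R :> R by [].
  have u1 : T <= u by rewrite /u -natr1; lra.
  have up : 0 <= u ^+ p by apply: exprn_ge0; lra.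
  have := HT _ u1; rewrite ler_norml => /andP[h _].
  have h1 : c' * u ^+ p <= V u - V (u - 1).
    rewrite /c'; case: (leP 0 (c - e1)) => _; first by lra.
    by rewrite mul0r subr_ge0; apply: ndV; lra.
  have /andP[_] := @powerD_bounds (u - 1) u p (ltac:(lra)) (ltac:(lra)).
  have -> : u - (u - 1) = 1 by ring.
  rewrite mulr1 -/q => /(ler_wpM2l C'0); rewrite mulrA C'qE => h2.
  move: IH; rewrite -uE; lra.
pose K' := `|V T| + C' * (T + 1) ^+ p.+1.
have K'0 : 0 <= K'.
  by apply: addr_ge0 => //; apply: mulr_ge0 => //; apply: exprn_ge0; lra.
pose e2 := e / (4 * (c + e1)); have e20 : 0 < e2 by apply: divr_gt0 => //; lra.
have [S HS] := asymp_exp_shift p.+1 1 e20.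
exists (Num.max (Num.max T S) (Num.max (4 * `|K| / e) (4 * K' / e))) => t.
rewrite !ge_max => /andP[/andP[tT /HS tS] /andP[tK tK']].
have {}tT : T <= t by rewrite ge_max.
have tge1 : 1 <= t by lra.
have tpt : t <= t ^+ p.+1 by rewrite exprS ler_peMr ?exprn_ege1//; lra.
set P := t ^+ p.+1 in tpt tS *.
have hK : `|K| <= e / 4 * P.
  by move: tK; rewrite ler_pdivrMr// => h; have := ler_wpM2r (ltW e0) tpt; lra.
have hK' : K' <= e / 4 * P.
  by move: tK'; rewrite ler_pdivrMr// => h; have := ler_wpM2r (ltW e0) tpt; lra.
have P0 : 0 <= P by lra.
have eP0 : 0 <= e * P by apply: mulr_ge0 => //; apply: ltW.
rewrite ler_norml; apply/andP; split.
  have := lower _ tT; rewrite -/K' -/P -/q.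
  have : (c / q - e1) * P <= C' * P.
    apply: ler_wpM2r => //; rewrite ler_pdivlMr// mulrBl divfK ?gt_eqF//.
    have : c - e1 <= c' by rewrite le_max lexx orbT.
    have : e1 <= e1 * q by rewrite ler_peMr// ltW.
    lra.
  by rewrite /e1; move: (c / q) => r; lra.
have := upper _ tT; rewrite -/q; move: tS; rewrite ler_norml mul1r => /andP[_ tS].
have : C * (t + 1) ^+ p.+1 <= C * ((1 + e2) * P) by apply: ler_wpM2l => //; lra.
have : C * ((1 + e2) * P) <= (c / q + e / 2) * P.
  rewrite mulrA; apply: ler_wpM2r => //.
  have Ce2 : C * e2 <= e / 4.
    have e2E : e2 * (4 * (c + e1)) = e by rewrite divfK// lt0r_neq0//; lra.
    have Cs : C <= c + e1 by rewrite ler_pdivrMr// ler_peMr//; lra.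
    by have := ler_wpM2r (ltW e20) Cs; lra.
  have : e1 / q <= e / 4 by rewrite ler_pdivrMr// /e1 ler_peMr//; lra.
  rewrite mulrDr mulr1; move: (C * e2) Ce2 => z Ce2.
  by rewrite /C mulrDl; move: (c / q) (e1 / q) => r r'; lra.
by move: (c / q) => r; lra.
Qed.

End asymp_theory.

(** The two bounds compare windows of slightly different lengths and miss
the ratio 1 / m by a relative error of order h. Cutting the window of length H
into n windows of length H / n for the lower bound, and into n + 1 windows of
length H / (n + 1) for the upper one, makes this error negligible. *)
Lemma blackwell_of_bounds (R : realType) (U : R -> R) (m H : R) :
  0 < m -> 0 < H ->
  (forall h h' e, 0 < h -> h < h' -> 0 < e -> exists T, forall t, T <= t ->
     h / (h + m) - e <= U t - U (t - h')) ->
  (forall h h' e, 0 < h' -> h' < h -> h < m -> 0 < e ->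
     exists T, forall t, T <= t -> U t - U (t - h') <= h / (m - h) + e) ->
  asymp 0 (fun t => U t - U (t - H)) (H / m).
Proof.
move=> m0 H0 lo up e e0.
have iter (N : nat) (P : R -> Prop) : (exists T, forall t, T <= t -> P t) ->
    forall h, exists T, forall t, T <= t -> forall i : 'I_N, P (t - i%:R * h).
  move=> [T HT] h; exists (T + N%:R * `|h|) => t Tt i; apply: HT.
  have iN : (i%:R : R) <= N%:R by rewrite ler_nat ltnW.
  have := ler_wpM2r (normr_ge0 h) iN.
  have := ler_wpM2l (ler0n R i) (ler_norm h); lra.
have tele (N : nat) t h : \sum_(i < N) (U (t - i%:R * h) - U (t - i%:R * h - h)) =
    U t - U (t - N%:R * h).
  elim: N => [|N IH]; first by rewrite big_ord0 mul0r subr0 subrr.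
  rewrite big_ord_recr /= IH -natr1.
  have -> : t - (N%:R + 1) * h = t - N%:R * h - h by ring.
  by ring.
(* As soon as the denominators H + m (n + 1) and m n - H met below reach M, the
   error on H / m is at most e / 2. *)
pose M := H * (m + H) / (m * (e / 2)).
have M0 : 0 < M by rewrite divr_gt0 ?mulr_gt0//; lra.
have HmE : (M + H) / m = M / m + H / m by rewrite mulrDl.
have Mm0 : 0 < M / m by apply: divr_gt0.
have Hm0 : 0 < H / m by apply: divr_gt0.
have [n n0 nm] : exists2 n : nat, 0 < n%:R :> R & M + H < n%:R * m.
  exists (Num.truncn ((M + H) / m)).+1 => //.
  by rewrite -ltr_pdivrMr//; exact: truncnS_gt.
have ME : M * (m * (e / 2)) = H * (m + H).
  by rewrite /M divfK// lt0r_neq0// mulr_gt0//; lra.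
clearbody M.
have n10 : 0 < n.+1%:R :> R by [].
have n1E : n.+1%:R = n%:R + 1 :> R by rewrite natr1.
have ne : 0 < e / (2 * n.+1%:R) by apply: divr_gt0 => //; rewrite mulr_gt0.
have nne : n.+1%:R * (e / (2 * n.+1%:R)) = e / 2.
  by move: (n.+1%:R) n10 => k k0; field; lra.
have me0 : 0 <= m * (e / 2) by apply: mulr_ge0; lra.
have rm : H / m * m = H by rewrite divfK// lt0r_neq0.

have [T HT] : exists T, forall t, T <= t -> H / m - e <= U t - U (t - H).
  have h0 : 0 < H / n.+1%:R by apply: divr_gt0.
  have hh : H / n.+1%:R < H / n%:R.
    by rewrite ltr_pM2l// ltf_pV2// ?posrE// ltr_nat.
  have [T HT] := iter n _ (lo _ _ _ h0 hh ne) (H / n%:R).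
  exists T => t /HT {}HT.
  have := tele n t (H / n%:R); rewrite mulrCA divff ?gt_eqF// mulr1 => <-.
  have -> : H / m - e = \sum_(i < n) ((H / m - e) / n%:R).
    by rewrite sumr_const card_ord -[RHS]mulr_natl [RHS]mulrC divfK// gt_eqF.
  apply: ler_sum => i _; apply: le_trans (HT i).
  have qn : 0 < H + m * n.+1%:R by apply: addr_gt0 => //; apply: mulr_gt0.
  have -> : H / n.+1%:R / (H / n.+1%:R + m) = H / (H + m * n.+1%:R).
    by move: (n.+1%:R) n10 qn => k k0 qn; field; apply/andP; split; lra.
  have qE := divfK (lt0r_neq0 qn) H.
  have q0 : 0 < H / (H + m * n.+1%:R) by apply: divr_gt0.
  rewrite lerBrDr -(ler_pM2r n0) mulrDl divfK ?gt_eqF//.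
  have ee : e / (2 * n.+1%:R) * n%:R <= e / 2.
    by rewrite -nne mulrC ler_pM2r// ler_nat.
  apply: le_trans (lerD (lexx _) ee) _.
  move: (H / (H + _)) qE q0 => q qE q0.
  rewrite -(ler_pM2r m0) mulrDl mulrBl rm.
  suff : q * (H + m) <= m * (e / 2) by rewrite n1E in qE; lra.
  rewrite -(ler_pM2r qn).
  have -> : q * (H + m) * (H + m * n.+1%:R) = H * (m + H) by rewrite mulrAC qE addrC.
  have hM : M <= H + m * n.+1%:R by rewrite n1E; lra.
  by have := ler_wpM2l me0 hM; rewrite [m * (e / 2) * M]mulrC ME.
have [T' HT'] : exists T, forall t, T <= t -> U t - U (t - H) <= H / m + e.
  have h0 : 0 < H / n.+1%:R by apply: divr_gt0.
  have hh : H / n.+1%:R < H / n%:R.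
    by rewrite ltr_pM2l// ltf_pV2// ?posrE// ltr_nat.
  have hm : H / n%:R < m by rewrite ltr_pdivrMr//; lra.
  have [S HS] := iter n.+1 _ (up _ _ _ h0 hh hm ne) (H / n.+1%:R).
  exists S => t /HS {}HS.
  have := tele n.+1 t (H / n.+1%:R); rewrite mulrCA divff ?gt_eqF// mulr1 => <-.
  have -> : H / m + e = \sum_(i < n.+1) ((H / m + e) / n.+1%:R).
    by rewrite sumr_const card_ord -[RHS]mulr_natl [RHS]mulrC divfK// gt_eqF.
  apply: ler_sum => i _; apply: le_trans (HS i) _.
  have qn : 0 < m * n%:R - H by lra.
  have -> : H / n%:R / (m - H / n%:R) = H / (m * n%:R - H).
    by move: (n%:R) n0 qn => k k0 qn; field; apply/andP; split; lra.
  have qE := divfK (lt0r_neq0 qn) H.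
  have q0 : 0 < H / (m * n%:R - H) by apply: divr_gt0.
  rewrite -(ler_pM2r n10) mulrDl divfK ?gt_eqF// [e / _ * _]mulrC nne.
  move: (H / (_ - H)) qE q0 => q qE q0.
  rewrite -(ler_pM2r m0) [X in _ <= X]mulrDl rm mulrDl.
  suff : q * (H + m) <= m * (e / 2) by rewrite n1E; lra.
  rewrite -(ler_pM2r qn).
  have -> : q * (H + m) * (m * n%:R - H) = H * (m + H) by rewrite mulrAC qE addrC.
  have hM : M <= m * n%:R - H by lra.
  by have := ler_wpM2l me0 hM; rewrite [m * (e / 2) * M]mulrC ME.
exists (Num.max T T') => t; rewrite ge_max => /andP[/HT h /HT' h'].
by rewrite expr0 !mulr1 ler_norml; apply/andP; split; lra.
Qed.

(** Fatou's lemma from above: finitely many terms obey the bound by beta up to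
a small error, and the bound C makes the other ones as small as the tail of the
series of a. *)
Lemma limsup_series (R : realType) (a : nat -> R) (b : R -> nat -> R)
    (beta : R -> R) (C : R) :
  (forall n, 0 <= a n) -> (\sum_(0 <= n <oo) (a n)%:E < +oo)%E ->
  (exists T, forall t, T <= t -> 0 <= beta t /\ forall n, 0 <= b t n <= C) ->
  (forall n e, 0 < e -> exists T, forall t, T <= t -> b t n <= beta t + e) ->
  forall e, 0 < e -> exists T, forall t, T <= t ->
    (\sum_(0 <= n <oo) (a n * b t n)%:E <=
     (beta t)%:E * \sum_(0 <= n <oo) (a n)%:E + e%:E)%E.
Proof.
move=> a0 aoo [T0 HT0] blim e e0.
have a0' n : (0 <= (a n)%:E)%E by rewrite lee_fin.
have C0 : 0 <= C by have [_ /(_ 0%N)/andP[]] := HT0 _ (lexx _); exact: le_trans.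
pose S := fine (\sum_(0 <= n <oo) (a n)%:E)%E.
have SE : (\sum_(0 <= n <oo) (a n)%:E = S%:E)%E.
  by rewrite fineK// ge0_fin_numE//; apply: nneseries_ge0 => n _ _.
have S0 : 0 <= S by rewrite -lee_fin -SE; apply: nneseries_ge0 => n _ _.
have tail : (\sum_(N <= n <oo) (a n)%:E)%E @[N --> \oo] --> 0%E.
  by apply: nneseries_tail_cvg.
have eC : 0 < e / (2 * (C + 1)) by apply: divr_gt0 => //; lra.
have eS : 0 < e / (2 * (S + 1)) by apply: divr_gt0 => //; lra.
have [N _ HN] : \forall N \near \oo, (\sum_(N <= n <oo) (a n)%:E < (e / (2 * (C + 1)))%:E)%E.
  have := tail [set x : \bar R | (x < (e / (2 * (C + 1)))%:E)%E]; apply.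
  by apply: open_nbhs_nbhs; split => //; exact: open_ereal_lt_ereal.
have {}HN := HN N (leqnn N).
have [T HT] : exists T, forall t, T <= t -> forall n, (n < N)%N ->
    b t n <= beta t + e / (2 * (S + 1)).
  elim: (N) => [|k [T HT]]; first by exists 0.
  have [T' HT'] := blim k _ eS; exists (Num.max T T') => t.
  rewrite ge_max => /andP[/HT h /HT' h'] i.
  by rewrite ltnS leq_eqVlt => /predU1P[->//|]; exact: h.
exists (Num.max T T0) => t; rewrite ge_max => /andP[/HT h /HT0[beta0 bC]].
have ab0 n : (0 <= (a n * b t n)%:E)%E.
  by rewrite lee_fin mulr_ge0//; have /andP[] := bC n.
rewrite SE (nneseries_split 0 N); last by move=> *; exact: ab0.
rewrite add0n.
have h1 : (\sum_(0 <= n < N) (a n * b t n)%:E <= (beta t * S + e / 2)%:E)%E.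
  apply: (@le_trans _ _ (\sum_(0 <= n < N) (a n * (beta t + e / (2 * (S + 1))))%:E)%E).
    rewrite !big_mkord; apply: lee_sum => i _.
    by rewrite lee_fin; apply: ler_wpM2l => //; apply: h.
  rewrite sumEFin -mulr_suml lee_fin.
  have aS : \sum_(0 <= i < N) a i <= S.
    rewrite -lee_fin -SE -sumEFin; exact: nneseries_lim_ge.
  have d0 := eS.
  have := ler_wpM2r (addr_ge0 beta0 (ltW d0)) aS.
  have : (e / (2 * (S + 1))) * (2 * (S + 1)) = e by rewrite divfK// lt0r_neq0//; lra.
  by move: (e / (2 * (S + 1))) d0 => d d0; lra.
have h2 : (\sum_(N <= n <oo) (a n * b t n)%:E <= (e / 2)%:E)%E.
  apply: (@le_trans _ _ (\sum_(N <= n <oo) (C%:E * (a n)%:E))%E).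
    apply: lee_nneseries => [n _ _|n _]; first exact: ab0.
    by rewrite -EFinM lee_fin mulrC; apply: ler_wpM2r => //; have /andP[] := bC n.
  rewrite nneseriesZl//.
  apply: (@le_trans _ _ (C%:E * (e / (2 * (C + 1)))%:E)%E).
    by apply: lee_wpmul2l; rewrite ?lee_fin// ltW.
  rewrite -EFinM lee_fin.
  have d0 := eC.
  have : (e / (2 * (C + 1))) * (2 * (C + 1)) = e by rewrite divfK// lt0r_neq0//; lra.
  by move: (e / (2 * (C + 1))) d0 => d d0; lra.
apply: le_trans (leeD h1 h2) _; rewrite -EFinD -EFinM -EFinD lee_fin; lra.
Qed.

(** * Bounded harmonic functions for a nonlattice law *)

Lemma integral_scale_indic d (T : measurableType d) (R : realType)
    (mu : {measure set T -> \bar R}) (k : R) (A : set T) :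
  0 <= k -> measurable A ->
  (\int[mu]_x (k%:E * (\1_A x)%:E) = k%:E * mu A)%E.
Proof.
move=> k0 mA; rewrite ge0_integralZl//.
  by rewrite integral_indic// setIT.
by apply/measurable_EFinP; exact: measurable_indic.
Qed.

Lemma integral_prob_cst d (T : measurableType d) (R : realType)
    (mu : probability T R) (k : R) : (\int[mu]_x k%:E = k%:E)%E.
Proof.
rewrite integral_cst// [X in (_ * X)%E](_ : _ = 1%E) ?mule1//.
exact: probability_setT.
Qed.

Lemma prob_tail (R : realType) (mu : probability R R) e : 0 < e ->
  exists A, (mu `]A, +oo[%classic <= e%:E)%E.
Proof.
move=> e0; pose F (n : nat) := `]n%:R : R, +oo[%classic.
have F0 : \bigcap_n F n = set0.
  rewrite -subset0 => x xF; have := xF (Num.truncn `|x|).+1 I.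
  rewrite /F /= in_itv/= andbT => h.
  by have := truncnS_gt `|x|; have := ler_norm x; lra.
have : (mu \o F) n @[n --> \oo] --> mu (\bigcap_n F n).
  apply: nonincreasing_cvg_mu => //.
  - by rewrite -ge0_fin_numE// fin_num_measure//; exact: measurable_itv.
  - by move=> n; exact: measurable_itv.
  - by rewrite F0.
  - move=> n k nk; apply/subsetPset; apply: subset_itvr.
    by rewrite bnd_simp ler_nat.
rewrite F0 measure0 => h.
have [N _ /(_ N (leqnn N)) HN] : \forall N \near \oo, (mu (F N) < e%:E)%E.
  apply: (h [set x : \bar R | (x < e%:E)%E]).
  by apply: open_nbhs_nbhs; split => //; exact: open_ereal_lt_ereal.
by exists N%:R; exact: ltW.
Qed.

Definition msupport (R : realType) (mu : set R -> \bar R) : set R :=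
  [set x : R | forall r : R, 0 < r -> (0 < mu `](x - r)%R, (x + r)%R[%classic)%E].

(** The complement of the support is covered by the countably many null
intervals with rational endpoints. *)
Lemma msupport_full (R : realType) (mu : {measure set R -> \bar R}) :
  mu.-negligible (~` msupport mu).
Proof.
pose F (n : nat) : set R :=
  if @choice.unpickle (rat * rat)%type n is Some pq then
    if mu `]ratr pq.1, ratr pq.2[%classic == 0%E
    then `]ratr pq.1, ratr pq.2[%classic else set0
  else set0.
have Fneg n : mu.-negligible (F n).
  rewrite /F; case: choice.unpickle => [[p q]|]; last exact: negligible_set0.
  case: eqP => [h|_]; last exact: negligible_set0.
  exact/negligibleP.
apply: negligibleS (negligible_bigcup Fneg) => x /existsNP[r /not_implyP[r0 /negP]].
rewrite -leNgt => mu0.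
have [p xp] : exists q, ratr q \in `]x - r, x[ by apply: rat_in_itvoo; lra.
have [q xq] : exists q, ratr q \in `]x, x + r[ by apply: rat_in_itvoo; lra.
move: xp xq; rewrite !in_itv/= => /andP[p1 p2] /andP[q1 q2].
have [n nE] : exists n, @choice.unpickle (rat * rat)%type n = Some (p, q).
  by exists (choice.pickle (p, q)); exact: choice.pickleK.
exists n; first by [].
rewrite /F nE /=; case: eqP => [_|].
  by rewrite /= in_itv/= p2 q1.
case; apply/eqP; rewrite eq_le measure_ge0 andbT; apply: le_trans mu0.
apply: le_measure; rewrite ?inE//; apply: subset_itv; rewrite bnd_simp; lra.
Qed.

Section harmonic.
Context {R : realType}.
Variables (mu : probability R R) (w : R -> R) (C t0 : R).
Hypothesis mu_ge0 : mu `]-oo, 0%R[%classic = 0%E.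
Hypothesis mu_nonlattice : nonlattice mu.
Hypothesis w_bnd : forall t, 0 <= w t <= C.
Hypothesis w_meas : measurable_fun setT w.
Hypothesis w_ucont : forall e : R, 0 < e -> exists2 r, 0 < r &
  forall s s', `|s - s'| <= r -> `|w s - w s'| <= e.
Hypothesis w_harm : forall t, t0 <= t -> (\int[mu]_y (w (t - y))%:E = (w t)%:E)%E.

Let C0 : 0 <= C. Proof. by have /andP[] := w_bnd 0; exact: le_trans. Qed.

(** Values of w close to eta at a late time t reappear at time t - x. The
level eta will be the limit superior of w. *)
Definition propagates (eta x : R) := forall e : R, 0 < e -> exists2 delta, 0 < delta &
  exists T, forall t, T <= t -> eta - delta <= w t -> eta - e <= w (t - x).

(** The value w t is the mean of the w (t - y), which exceed eta by almost
nothing. When w t is close to eta they cannot be much smaller than eta on a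
neighbourhood of x, which has positive mass; uniform continuity transfers this
to the point t - x. *)
Lemma support_propagates (eta x : R) :
  (forall d, 0 < d -> exists T, forall t, T <= t -> w t <= eta + d) ->
  0 <= eta -> msupport mu x -> propagates eta x.
Proof.
move=> eta_ub eta0 xS e e0.
have [r r0 Hr] := w_ucont (divr_gt0 e0 (ltr0Sn R 1)).
pose B := `]x - r, x + r[%classic.
have mB : measurable B by exact: measurable_itv.
have muBE : mu B = (fine (mu B))%:E by rewrite fineK// fin_num_measure.
have := xS _ r0; rewrite -/B muBE lte_fin; move: (fine _) muBE => p muBE p0.
have C0' : 0 <= C by exact: C0.
(* The comparison of integrals below loses d three times, and 3 d < p e / 2. *)
pose d := p * e / 8; have d0 : 0 < d by rewrite /d divr_gt0// mulr_gt0.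
exists d => //.
have [T1 HT1] := eta_ub _ d0.
have [A HA] : exists A, (mu `]A, +oo[%classic <= (d / (C + 1))%:E)%E.
  by apply: prob_tail; apply: divr_gt0 => //; have := C0; lra.
exists (Num.max t0 (T1 + A)) => t; rewrite ge_max => /andP[tt0 tT] wt.
rewrite leNgt; apply/negP => wtx.
pose E := `]A, +oo[%classic : set R.
have mE : measurable E by exact: measurable_itv.
have mwt : measurable_fun setT (fun y : R => (w (t - y))%:E).
  by apply/measurable_EFinP; apply: measurableT_comp => //; exact: measurable_funB.
have : (\int[mu]_y ((w (t - y))%:E + (e / 2)%:E * (\1_B y)%:E) <=
        \int[mu]_y ((eta + d)%:E + C%:E * (\1_E y)%:E))%E.
  apply: ge0_le_integral => //.
  - move=> y _; rewrite -EFinM -EFinD lee_fin addr_ge0 ?mulr_ge0//; last by lra.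
    by case/andP: (w_bnd (t - y)).
  - apply: emeasurable_funD => //; apply/measurable_EFinP.
    by apply: measurable_funM => //; exact: measurable_indic.
  - apply: emeasurable_funD => //; apply/measurable_EFinP.
    by apply: measurable_funM => //; exact: measurable_indic.
  - move=> y _; rewrite -!EFinM -!EFinD lee_fin !indicE.
    have /andP[w0 wC] := w_bnd (t - y).
    have hB : y \in B -> w (t - y) + e / 2 <= eta.
      rewrite inE /B /= in_itv/= => /andP[y1 y2].
      have : `|w (t - y) - w (t - x)| <= e / 2.
        by apply: Hr; rewrite ler_norml; apply/andP; split; lra.
      by rewrite ler_norml => /andP[_]; lra.
    have hE : y \notin E -> w (t - y) <= eta + d.
      rewrite notin_setE /E /= in_itv/= andbT => /negP; rewrite -leNgt => yA.
      by apply: HT1; lra.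
    case: (boolP (y \in B)) => [/hB yB|_]; case: (boolP (y \in E)) => [_|/hE yE];
      by rewrite /= ?mulr1 ?mulr0; lra.
rewrite ge0_integralD//; last 3 first.
  - by move=> y _; rewrite lee_fin; case/andP: (w_bnd (t - y)).
  - by move=> y _; rewrite -EFinM lee_fin mulr_ge0//; lra.
  - by apply/measurable_EFinP; apply: measurable_funM => //; exact: measurable_indic.
rewrite ge0_integralD//; last 3 first.
  - by move=> y _; rewrite lee_fin; lra.
  - by move=> y _; rewrite -EFinM lee_fin mulr_ge0//; lra.
  - by apply/measurable_EFinP; apply: measurable_funM => //; exact: measurable_indic.
have iB : (\int[mu]_y ((e / 2)%:E * (\1_B y)%:E) = (e / 2)%:E * mu B)%E.
  by apply: integral_scale_indic => //; lra.
have iE : (\int[mu]_y (C%:E * (\1_E y)%:E) = C%:E * mu E)%E.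
  exact: integral_scale_indic.
rewrite iB iE w_harm// integral_prob_cst muBE.
have mEd : (C%:E * mu E <= d%:E)%E.
  apply: (@le_trans _ _ (C%:E * (d / (C + 1))%:E)%E).
    by apply: lee_wpmul2l; rewrite ?lee_fin.
  rewrite -EFinM lee_fin.
  have : (d / (C + 1)) * (C + 1) = d by rewrite divfK// lt0r_neq0//; lra.
  have : 0 < d / (C + 1) by apply: divr_gt0 => //; lra.
  by move: (d / _) => z; lra.
move=> /le_trans /(_ (leeD (lexx _) mEd)).
rewrite -EFinM -EFinD -EFinD lee_fin; move: wt; rewrite /d; nra.
Qed.

(** The nonnegative shifts that propagate form an additive semigroup that
contains the support of mu. A lattice containing it would carry mu, so it is
asymptotically dense. *)
Lemma propagates_dense eta e : 0 < e ->
  (forall d, 0 < d -> exists T, forall t, T <= t -> w t <= eta + d) ->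
  0 <= eta ->
  exists X, forall y, X <= y -> exists2 x, propagates eta x & `|y - x| <= e.
Proof.
move=> e0 eta_ub eta0.
pose D := [set x | 0 <= x /\ propagates eta x].
have D0 : D 0.
  by split => // z z0; exists z => //; exists 0 => t _; rewrite subr0.
have DD x y : D x -> D y -> D (x + y).
  move=> [x0 Dx] [y0 Dy]; split; first by lra.
  move=> z z0; have [dy dy0 [Ty HTy]] := Dy _ z0.
  have [dx dx0 [Tx HTx]] := Dx _ dy0; exists dx => //.
  exists (Num.max Tx (Ty + x)) => t; rewrite ge_max => /andP[tx ty] h.
  by rewrite opprD addrA; apply: HTy; [lra|exact: HTx].
have [[d d0 latt]|dense] := submonoid_discrete_or_dense D0 DD (fun x (h : D x) => h.1).
  exfalso; apply: (mu_nonlattice d0); set L := [set _ | _ in _].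
  have mL : measurable L.
    rewrite (_ : L = \bigcup_n [set n%:R * d]); first by apply: bigcup_measurable.
    by apply/seteqP; split => [x [n _ <-]|x [n _ ->]]; exists n.
  have : mu (~` L) = 0%E.
    apply/negligibleP; first exact: measurableC.
    have N : mu.-negligible (`]-oo, 0[%classic `|` ~` msupport mu).
      by apply: negligibleU; [exact/negligibleP|exact: msupport_full].
    apply: negligibleS N.
    move=> x nLx /=; rewrite in_itv/=; have [x0|x0] := ltP x 0; [by left|right => xS].
    apply: nLx; have [] := latt x; first by split => //; exact: support_propagates.
    by move=> n ->; exists n.
  rewrite probability_setC// => /eqP; rewrite sube_eq ?fin_num_measure//.
  by rewrite add0e => /eqP.
have [X HX] := dense _ e0; exists X => y /HX[x [_ px] yx]; exists x => //.
Qed.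

(** A maximum principle in the manner of Choquet and Deny. The limit superior
eta propagates along asymptotically dense shifts, so w is close to eta on
arbitrarily long arithmetic progressions of any given step. If eta exceeded b,
the sums of w - b along them would be unbounded. *)
Lemma harmonic_limsup a b K : 0 < a ->
  (forall s N, \sum_(k < N) (w (s + k%:R * a) - b) <= K) ->
  forall e, 0 < e -> exists T, forall t, T <= t -> w t <= b + e.
Proof.
move=> a0 sumK e e0; apply: contrapT => /forallNP hT.
have often T : exists2 t, T <= t & b + e < w t.
  have /existsNP[t /not_implyP[Tt /negP]] := hT T.
  by rewrite -ltNge => h; exists t.
pose S := [set x | exists T, forall t, T <= t -> w t <= x].
have SC : S C by exists 0 => t _; case/andP: (w_bnd t).
have Slb x : S x -> b + e <= x.
  by move=> [T HT]; have [t /HT h h'] := often T; lra.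
have Slb0 x : S x -> 0 <= x.
  by move=> [T /(_ T (lexx _)) h]; have /andP[] := w_bnd T; lra.
have infS : has_inf S by split; [exists C|exists (b + e)].
pose eta := inf S.
have eta_ge : b + e <= eta by apply: lb_le_inf; [exists C|exact: Slb].
have eta0 : 0 <= eta by apply: lb_le_inf; [exists C|exact: Slb0].
have eta_ub d : 0 < d -> exists T, forall t, T <= t -> w t <= eta + d.
  move=> d0; have [x [T HT] xd] := inf_adherent d0 infS.
  by exists T => t /HT; rewrite /eta; lra.
have eta_often d T : 0 < d -> exists2 t, T <= t & eta - d <= w t.
  move=> d0; apply: contrapT => h.
  suff : S (eta - d) by move=> /(ge_inf infS.2); rewrite -/eta; lra.
  exists T => t Tt; rewrite leNgt; apply/negP => h'.
  by apply: h; exists t => //; exact: ltW.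
have e4 : 0 < e / 4 by lra.
have [r r0 Hr] := w_ucont e4.
have [X HX] := propagates_dense r0 eta_ub eta0.
(* X is so large that each of the N shifts X + k a is within r of a propagating
   one; a single late time t where w is close enough to eta serves them all. *)
have run (N : nat) : exists2 s, True & forall k, (k < N)%N -> eta - e / 2 <= w (s - k%:R * a).
  have [d d0 [T HT]] : exists2 d, 0 < d & exists T, forall t, T <= t -> eta - d <= w t ->
      forall k, (k < N)%N -> eta - e / 2 <= w (t - X - k%:R * a).
    elim: N => [|N [d d0 [T HT]]]; first by exists 1 => //; exists 0.
    have Na : 0 <= N%:R * a by apply: mulr_ge0 => //; exact: ltW.
    have [x px xX] := HX (X + N%:R * a) (ltac:(lra)).
    have [d' d'0 [T' HT']] := px _ e4.
    exists (Num.min d d'); first by rewrite lt_min d0.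
    exists (Num.max T T') => t; rewrite ge_max => /andP[tT tT'] wt k.
    rewrite ltnS leq_eqVlt => /predU1P[->|kN]; last first.
      by apply: HT => //; apply: le_trans wt; rewrite lerB// ge_min lexx.
    have h1 : eta - e / 4 <= w (t - x).
      by apply: HT' => //; apply: le_trans wt; rewrite lerB// ge_min lexx orbT.
    have : `|w (t - X - N%:R * a) - w (t - x)| <= e / 4.
      by apply: Hr; rewrite distrC; apply: le_trans xX; rewrite le_eqVlt; apply/orP; left; apply/eqP; congr `|_|; ring.
    by rewrite ler_norml => /andP[]; lra.
  by have [t Tt wt] := eta_often d T d0; exists (t - X) => // k kN; apply: HT.
pose N := (Num.truncn (`|K| / (e / 2))).+1.
have [s _ Hs] := run N.
have := sumK (s - N.-1%:R * a) N.
apply/negP; rewrite -ltNge.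
apply: (@lt_le_trans _ _ (\sum_(k < N) (e / 2))).
  rewrite sumr_const card_ord -[X in _ < X]mulr_natl -ltr_pdivrMr; last by lra.
  apply: le_lt_trans (truncnS_gt (`|K| / (e / 2))).
  by rewrite ler_pM2r ?ler_norm// invr_gt0; lra.
apply: ler_sum => k _.
have kN : (N.-1 - k < N)%N by rewrite /N /= ltnS leq_subr.
have := Hs _ kN; rewrite natrB; last by rewrite -ltnS /N /=; exact: ltn_ord.
have -> : s - (N.-1%:R - k%:R) * a = s - N.-1%:R * a + k%:R * a by ring.
lra.
Qed.

End harmonic.

Local Open Scope ereal_scope.

(** * Potentials and the renewal function *)

Definition nnmeas (R : realType) (g : R -> \bar R) :=
  measurable_fun setT g /\ forall x, 0 <= g x.

(** If g is the distribution function of Y and mu the law of an independent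
variable X, this is the distribution function of X + Y. *)
Definition conv (R : realType) (mu : set R -> \bar R) (g : R -> \bar R) (t : R) :=
  \int[mu]_y g (t - y)%R.

(** The expected sum of g over the points t - S_k, where S is the random walk
with step law mu. *)
Definition potential (R : realType) (mu : set R -> \bar R) (g : R -> \bar R) (t : R) :=
  \sum_(0 <= k <oo) iter k (conv mu) g t.

Section nnmeas_theory.
Context {R : realType}.
Implicit Types (g h : R -> \bar R) (A : set R).

Lemma nnmeasD g h : nnmeas g -> nnmeas h -> nnmeas (fun x => g x + h x).
Proof.
by move=> [mg g0] [mh h0]; split => [|x]; [exact: emeasurable_funD|exact: adde_ge0].
Qed.

Lemma nnmeas_cst (c : \bar R) : 0 <= c -> nnmeas (fun _ => c).
Proof. by move=> c0; split. Qed.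

Lemma nnmeasZ (c : R) g : (0 <= c)%R -> nnmeas g -> nnmeas (fun x => c%:E * g x).
Proof.
move=> c0 [mg g0]; split => [|x]; last by rewrite mule_ge0// lee_fin.
by apply: emeasurable_funM => //; exact: measurable_cst.
Qed.

Lemma nnmeas_fin (f : R -> R) : measurable_fun setT f -> (forall x, 0 <= f x)%R ->
  nnmeas (fun x => (f x)%:E).
Proof. by move=> mf f0; split => [|x]; [exact/measurable_EFinP|rewrite lee_fin]. Qed.

Lemma nnmeas_indic A : measurable A -> nnmeas (fun x => (\1_A x)%:E).
Proof. by move=> mA; apply: nnmeas_fin => //; exact: measurable_indic. Qed.

Lemma measurable_subl (t : R) : measurable_fun setT (fun y : R => t - y)%R.
Proof. exact: measurable_funB. Qed.

Lemma nnmeas_subl g t : nnmeas g -> nnmeas (fun y => g (t - y)%R).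
Proof.
by move=> [mg g0]; split => // ; apply: measurableT_comp => //; exact: measurable_subl.
Qed.

Lemma nnmeas_subr g t : nnmeas g -> nnmeas (fun y => g (y - t)%R).
Proof.
by move=> [mg g0]; split => // ; apply: measurableT_comp => //; exact: measurable_funB.
Qed.

Lemma nnmeas_sum (g_ : nat -> R -> \bar R) (n : nat) : (forall k, nnmeas (g_ k)) ->
  nnmeas (fun x => \sum_(0 <= k < n) g_ k x).
Proof.
move=> Hg; elim: n => [|n IH].
  by under eq_fun do rewrite big_geq//; exact: nnmeas_cst.
by under eq_fun do rewrite big_nat_recr//=; exact: nnmeasD.
Qed.

Lemma nnmeas_series (g_ : nat -> R -> \bar R) : (forall k, nnmeas (g_ k)) ->
  nnmeas (fun x => \sum_(0 <= k <oo) g_ k x).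
Proof.
move=> Hg; split => [|x]; last by apply: nneseries_ge0 => k _ _; have [_] := Hg k.
by apply: ge0_emeasurable_sum => [k x _ _|k _]; have [] := Hg k.
Qed.

End nnmeas_theory.

Section conv_theory.
Context {R : realType}.
Variable mu : probability R R.
Implicit Types (g h : R -> \bar R) (t : R).

Lemma nnmeas_conv g : nnmeas g -> nnmeas (conv mu g).
Proof.
move=> [mg g0]; split => [|x]; last exact: integral_ge0.
have := @measurable_fun_fubini_tonelli_F _ _ R R R mu (fun z : R * R => g (z.1 - z.2)%R).
by apply => //; apply: measurableT_comp => //; exact: measurable_funB.
Qed.

Lemma le_conv g h t : nnmeas g -> nnmeas h -> (forall x, g x <= h x) ->
  conv mu g t <= conv mu h t.
Proof.
move=> /(nnmeas_subl t) [mg g0] /(nnmeas_subl t)[mh h0] gh.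
by apply: ge0_le_integral => // x _; exact: gh.
Qed.

Lemma convD g h t : nnmeas g -> nnmeas h ->
  conv mu (fun x => g x + h x) t = conv mu g t + conv mu h t.
Proof.
move=> /(nnmeas_subl t)[mg g0] /(nnmeas_subl t)[mh h0].
by rewrite /conv ge0_integralD.
Qed.

Lemma convZ (c : R) g t : (0 <= c)%R -> nnmeas g ->
  conv mu (fun x => c%:E * g x) t = c%:E * conv mu g t.
Proof.
move=> c0 /(nnmeas_subl t)[mg g0].
by rewrite /conv ge0_integralZl_EFin.
Qed.

Lemma conv_shift g c t : conv mu (fun x => g (x - c)%R) t = conv mu g (t - c)%R.
Proof. by apply: eq_integral => y _; rewrite addrAC. Qed.

Lemma conv_cst (c : R) t : conv mu (fun _ => c%:E) t = c%:E.
Proof. exact: integral_prob_cst. Qed.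

Lemma conv_sum (g_ : nat -> R -> \bar R) n t : (forall k, nnmeas (g_ k)) ->
  conv mu (fun x => \sum_(0 <= k < n) g_ k x) t =
  \sum_(0 <= k < n) conv mu (g_ k) t.
Proof.
move=> Hg; elim: n => [|n IH].
  rewrite big_geq// /conv; under eq_integral do rewrite big_geq//.
  exact: integral0.
rewrite big_nat_recr//= -IH -convD//; last exact: nnmeas_sum.
by apply: eq_integral => y _; rewrite big_nat_recr.
Qed.

Lemma conv_series (g_ : nat -> R -> \bar R) t : (forall k, nnmeas (g_ k)) ->
  conv mu (fun x => \sum_(0 <= k <oo) g_ k x) t =
  \sum_(0 <= k <oo) conv mu (g_ k) t.
Proof.
move=> Hg; rewrite /conv integral_nneseries//.
  by move=> k; have [] := nnmeas_subl t (Hg k).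
by move=> k x _; have [_] := nnmeas_subl t (Hg k).
Qed.

Lemma nnmeas_convn k g : nnmeas g -> nnmeas (iter k (conv mu) g).
Proof. by move=> Hg; elim: k => //= k; exact: nnmeas_conv. Qed.

Lemma le_convn k g h t : nnmeas g -> nnmeas h -> (forall x, g x <= h x) ->
  iter k (conv mu) g t <= iter k (conv mu) h t.
Proof.
move=> Hg Hh gh; elim: k t => //= k IH t.
by apply: le_conv => //; exact: nnmeas_convn.
Qed.

Lemma convnD k g h t : nnmeas g -> nnmeas h ->
  iter k (conv mu) (fun x => g x + h x) t =
  iter k (conv mu) g t + iter k (conv mu) h t.
Proof.
move=> Hg Hh; elim: k t => //= k IH t.
by rewrite -convD; [congr (conv mu _ t); apply/funext|exact: nnmeas_convn..].
Qed.

Lemma convnZ k (c : R) g t : (0 <= c)%R -> nnmeas g ->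
  iter k (conv mu) (fun x => c%:E * g x) t = c%:E * iter k (conv mu) g t.
Proof.
move=> c0 Hg; elim: k t => //= k IH t.
by rewrite -convZ//; [congr (conv mu _ t); apply/funext|exact: nnmeas_convn].
Qed.

Lemma convn_shift k g c t :
  iter k (conv mu) (fun x => g (x - c)%R) t = iter k (conv mu) g (t - c)%R.
Proof.
elim: k t => //= k IH t.
by rewrite -conv_shift; congr (conv mu _ t); apply/funext.
Qed.

Lemma nnmeas_potential g : nnmeas g -> nnmeas (potential mu g).
Proof. by move=> Hg; apply: nnmeas_series => k; exact: nnmeas_convn. Qed.

Lemma potential_ge0 g t : nnmeas g -> 0 <= potential mu g t.
Proof. by move=> /nnmeas_potential[]. Qed.

Lemma le_potential g h t : nnmeas g -> nnmeas h -> (forall x, g x <= h x) ->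
  potential mu g t <= potential mu h t.
Proof.
move=> Hg Hh gh; apply: lee_nneseries => [k _ _|k _]; last exact: le_convn.
by have [_] := nnmeas_convn k Hg.
Qed.

Lemma potD g h t : nnmeas g -> nnmeas h ->
  potential mu (fun x => g x + h x) t = potential mu g t + potential mu h t.
Proof.
move=> Hg Hh; rewrite /potential -nneseriesD.
- by apply: eq_eseriesr => k _; exact: convnD.
- by move=> k _ _; have [_] := nnmeas_convn k Hg.
- by move=> k _ _; have [_] := nnmeas_convn k Hh.
Qed.

Lemma potZ (c : R) g t : (0 <= c)%R -> nnmeas g ->
  potential mu (fun x => c%:E * g x) t = c%:E * potential mu g t.
Proof.
move=> c0 Hg; rewrite /potential -nneseriesZl.
- by apply: eq_eseriesr => k _; exact: convnZ.
- by move=> k _; have [_] := nnmeas_convn k Hg.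
Qed.

Lemma potential_shift g c t : potential mu (fun x => g (x - c)%R) t = potential mu g (t - c)%R.
Proof. by apply: eq_eseriesr => k _; exact: convn_shift. Qed.

Lemma potential_sum (g_ : nat -> R -> \bar R) n t : (forall k, nnmeas (g_ k)) ->
  potential mu (fun x => \sum_(0 <= k < n) g_ k x) t =
  \sum_(0 <= k < n) potential mu (g_ k) t.
Proof.
move=> Hg; elim: n => [|n IH].
  rewrite big_geq//; apply: eseries0 => k _ _.
  rewrite (_ : (fun _ => _) = (fun _ => 0%:E * 0%:E)); last first.
    by apply/funext => x; rewrite big_geq// mule0.
  rewrite convnZ ?mul0e//; exact: nnmeas_cst.
rewrite big_nat_recr//= -IH -potD//; last exact: nnmeas_sum.
by congr (potential mu _ t); apply/funext => y; rewrite big_nat_recr.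
Qed.

Lemma potential_conv g t : nnmeas g -> potential mu (conv mu g) t = conv mu (potential mu g) t.
Proof.
move=> Hg; rewrite /potential conv_series => [|k]; last exact: nnmeas_convn.
by apply: eq_eseriesr => k _; rewrite -iterSr.
Qed.

(** The renewal equation: the term k = 0 is split off, and one convolution is
taken out of the others. *)
Lemma potential_renewal g t : nnmeas g -> potential mu g t = g t + conv mu (potential mu g) t.
Proof.
move=> Hg; rewrite -potential_conv// /potential nneseries_recl//=; last first.
  by move=> k _; have [_] := nnmeas_convn k Hg.
congr (_ + _).
rewrite -[in LHS](addn0 1%N) -nneseries_addn.
  by apply: eq_eseriesr => k _; rewrite addn1 -iterSr.
by move=> k; have [_] := nnmeas_convn k Hg.
Qed.

Lemma potential_partial_renewal n g t : nnmeas g ->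
  \sum_(0 <= k < n.+1) iter k (conv mu) g t =
  g t + conv mu (fun x => \sum_(0 <= k < n) iter k (conv mu) g x) t.
Proof.
move=> Hg; rewrite big_nat_recl//= conv_sum// => k; exact: nnmeas_convn.
Qed.

Lemma potential_le_partial g t M : nnmeas g ->
  (forall n, \sum_(0 <= k < n) iter k (conv mu) g t <= M) -> potential mu g t <= M.
Proof.
move=> Hg HM; apply: lime_le; last by apply: nearW => n; exact: HM.
by apply: is_cvg_nneseries => k _ _; have [_] := nnmeas_convn k Hg.
Qed.

Lemma partial_le_potential n g t : nnmeas g ->
  \sum_(0 <= k < n) iter k (conv mu) g t <= potential mu g t.
Proof.
by move=> Hg; apply: nneseries_lim_ge => k _ _; have [_] := nnmeas_convn k Hg.
Qed.

(** By induction, the partial sums of the potential stay below every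
supersolution of the renewal equation. *)
Lemma potential_min g Z t : nnmeas g -> nnmeas Z ->
  (forall x, g x + conv mu Z x <= Z x) -> potential mu g t <= Z t.
Proof.
move=> Hg HZ gZ; apply: potential_le_partial => // n.
elim: n t => [|n IH] t; first by rewrite big_geq//; case: HZ.
rewrite potential_partial_renewal//; apply: le_trans (gZ t); rewrite leeD2l//.
by apply: le_conv => //; apply: nnmeas_sum => k; exact: nnmeas_convn.
Qed.

End conv_theory.

Definition heaviside (R : realType) : R -> \bar R :=
  fun x => (\1_(`[0%R, +oo[%classic) x)%:E.

Section renewal.
Context {R : realType}.
Variable mu : probability R R.
Hypothesis mu_pos : mu `]-oo, 0%R]%classic = 0.
Implicit Types (g h : R -> \bar R) (t : R).

Let H := @heaviside R.
Let Rpos := `]0%R, +oo[%classic : set R.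

Lemma mu_RposE : mu Rpos = 1.
Proof.
have -> : Rpos = ~` `]-oo, 0%R]%classic by rewrite setCitvl.
by rewrite probability_setC// mu_pos sube0.
Qed.

Lemma heaviside_nnmeas : nnmeas H.
Proof. by apply: nnmeas_indic; exact: measurable_itv. Qed.

Lemma integral_Rpos g : nnmeas g -> \int[mu]_y g y = \int[mu]_(y in Rpos) g y.
Proof.
move=> [mg g0].
rewrite (@ge0_negligible_integral _ _ _ mu setT `]-oo, 0%R]%classic)//.
by congr (integral mu _ g); rewrite setTD setCitvl.
Qed.

Lemma integral_Rpos_gt0 (f : R -> R) : measurable_fun Rpos f ->
  (forall y, 0 < y -> 0 < f y)%R -> 0 < \int[mu]_(y in Rpos) (f y)%:E.
Proof.
move=> mf f0.
have mR : measurable Rpos by exact: measurable_itv.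
have fR y : Rpos y -> (0 < f y)%R by rewrite /Rpos /= in_itv/= andbT; exact: f0.
rewrite lt0e; apply/andP; split; last first.
  by apply: integral_ge0 => y /fR; rewrite lee_fin => /ltW.
apply/eqP => k0.
have : \int[mu]_(y in Rpos) `|(f y)%:E| = 0.
  by rewrite -k0; apply: eq_integral => y /[!inE] /fR /ltW h; rewrite gee0_abs.
have mf' : measurable_fun Rpos (fun y => (f y)%:E) by exact/measurable_EFinP.
move/(ae_eq_integral_abs mu mR mf') => [N [mN N0 subN]].
have : mu Rpos <= mu N.
  apply: le_measure; rewrite ?inE// => y Ry; apply: subN => /= /(_ Ry) [].
  by have := fR _ Ry; lra.
by rewrite N0 mu_RposE lee_fin ler10.
Qed.

Lemma conv_eq0 g t : nnmeas g -> (forall x, (x < t)%R -> g x = 0) -> conv mu g t = 0.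
Proof.
move=> Hg g0; rewrite /conv integral_Rpos; last exact: nnmeas_subl.
rewrite integral0_eq// => y; rewrite /Rpos /= in_itv/= andbT => y0.
by rewrite g0//; lra.
Qed.

Lemma convn_eq0 k g (c t : R) : nnmeas g -> (forall x, (x < c)%R -> g x = 0) ->
  (t < c)%R -> iter k (conv mu) g t = 0.
Proof.
move=> Hg g0; elim: k t => [|k IH] t tc /=; first exact: g0.
apply: conv_eq0; first exact: nnmeas_convn.
by move=> x xt; apply: IH; lra.
Qed.

Lemma potential_eq0 g (c t : R) : nnmeas g -> (forall x, (x < c)%R -> g x = 0) ->
  (t < c)%R -> potential mu g t = 0.
Proof. by move=> Hg g0 tc; apply: eseries0 => k _ _; exact: convn_eq0 tc. Qed.

Lemma heaviside_lt0 x : (x < 0)%R -> H x = 0.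
Proof. by move=> x0; rewrite /H /heaviside indicE mem_setE in_itv/= andbT leNgt x0. Qed.

(** The function c e^x is a finite supersolution: as the Laplace transform
rho = E e^(-xi) is smaller than 1, the constant c = 1 / (1 - rho) works. *)
Lemma renewal_fin t : potential mu H t < +oo.
Proof.
pose rho := \int[mu]_(y in Rpos) (expR (- y))%:E.
(* That rho < 1 is obtained from the positivity of kap = 1 - rho. *)
pose kap := \int[mu]_(y in Rpos) (1 - expR (- y))%:E.
have mR : measurable Rpos by exact: measurable_itv.
have mE (D : set R) : measurable_fun D (fun y : R => expR (- y)).
  by apply: measurableT_comp => //; exact: measurable_funN.
have rho0 : 0 <= rho by apply: integral_ge0 => y _; rewrite lee_fin expR_ge0.
have Rposlt y : Rpos y -> (expR (- y) < 1)%R.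
  by rewrite /Rpos /= in_itv/= andbT => y0; rewrite expR_lt1 oppr_lt0.
have rk : rho + kap = 1.
  rewrite -mu_RposE -[RHS]mul1e -integral_cst// -ge0_integralD//.
  - by apply: eq_integral => y _; rewrite -EFinD; congr EFin; ring.
  - exact/measurable_EFinP.
  - by move=> y /Rposlt; rewrite lee_fin; lra.
  - by apply/measurable_EFinP; exact: measurable_funB.
have kap0 : 0 < kap.
  apply: (@integral_Rpos_gt0 (fun y => 1 - expR (- y))%R).
    exact: measurable_funB.
  by move=> y; rewrite -subr_gt0 => y0; have := @Rposlt y; rewrite /Rpos /= in_itv/= andbT; lra.
have rho_fin : rho \is a fin_num.
  rewrite ge0_fin_numE//; apply: (@le_lt_trans _ _ 1); last exact: ltry.
  by rewrite -rk leeDl// ltW.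
have rhoE : rho = (fine rho)%:E by rewrite fineK.
have r0 : (0 <= fine rho)%R by exact: fine_ge0.
have r1 : (fine rho < 1)%R.
  have kapE : kap = (1 - fine rho)%:E.
    by apply/eqP; rewrite -(@eqe _) ; apply/eqP; rewrite EFinB -rhoE -rk addeAC subee// add0e.
  by move: kap0; rewrite kapE lte_fin; lra.
pose c := ((1 - fine rho)^-1)%R.
have c0 : (0 <= c)%R by rewrite invr_ge0; lra.
have mexp : measurable_fun setT (@expR R) by exact: measurable_expR.
have HZ : nnmeas (fun x => (c * expR x)%:E).
  apply: nnmeas_fin; first exact: measurable_funM.
  by move=> x; rewrite mulr_ge0// expR_ge0.
apply: le_lt_trans (ltry (c * expR t)%R).
apply: (potential_min _ heaviside_nnmeas HZ) => x.
have -> : conv mu (fun x => (c * expR x)%:E) x = (c * expR x * fine rho)%:E.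
  rewrite /conv integral_Rpos; last exact: (nnmeas_subl x HZ).
  transitivity (\int[mu]_(y in Rpos) ((c * expR x)%:E * (expR (- y))%:E)).
    by apply: eq_integral => y _; rewrite -EFinM -mulrA -expRD.
  rewrite ge0_integralZl_EFin//; first by rewrite -/rho rhoE.
    exact/measurable_EFinP.
  by rewrite mulr_ge0// expR_ge0.
rewrite -EFinD lee_fin.
have r1' := r1; move: (fine rho : R) r1' @c c0 HZ => r r1' c c0 HZ.
have cE : (c * (1 - r) = 1 :> R)%R by rewrite mulVf// lt0r_neq0// subr_gt0.
have h1 : ((\1_(`[0%R, +oo[%classic) x : R) <= expR x)%R.
  rewrite indicE mem_setE in_itv/= andbT; case: (leP 0%R x) => x0; last by rewrite /= expR_ge0.
  by have := expR_ge1Dx x; rewrite /=; lra.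
have : (c * expR x = c * expR x * r + expR x)%R.
  by rewrite -[X in (_ + X)%R]mul1r -cE; ring.
lra.
Qed.

(** The expected number of points of the walk in [0, t]. *)
Definition renewal t := fine (potential mu H t).

Lemma renewalE t : potential mu H t = (renewal t)%:E.
Proof.
rewrite fineK// ge0_fin_numE ?renewal_fin//.
by apply: potential_ge0; exact: heaviside_nnmeas.
Qed.

Lemma heaviside_homo x y : (x <= y)%R -> H x <= H y.
Proof.
move=> xy; rewrite /H /heaviside lee_fin !indicE ler_nat.
rewrite !mem_setE !in_itv/= !andbT.
by case: (leP 0%R x) => // x0; rewrite (le_trans x0).
Qed.

Lemma renewal_homo : {homo renewal : x y / (x <= y)%R}.
Proof.
move=> x y xy; rewrite -lee_fin -!renewalE.
have -> : x = (y - (y - x))%R by ring.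
rewrite -potential_shift; apply: le_potential => [||z].
- exact/nnmeas_subr/heaviside_nnmeas.
- exact: heaviside_nnmeas.
- by apply: heaviside_homo; lra.
Qed.

Lemma renewal_lt0 t : (t < 0)%R -> renewal t = 0%R.
Proof.
move=> t0; rewrite /renewal (@potential_eq0 H 0%R)//; first exact: heaviside_nnmeas.
exact: heaviside_lt0.
Qed.

Lemma renewal_ge0 t : (0 <= renewal t)%R.
Proof. by apply: fine_ge0; apply: potential_ge0; exact: heaviside_nnmeas. Qed.

(** Outside the interval, the expected number of visits is the mean of its
values after one step; inside, it is at most the expected number of points of
the walk within distance L. The induction runs over the partial sums. *)
Lemma potential_window c L t : (0 <= L)%R ->
  potential mu (fun x => (\1_(`[c, (c + L)%R]%classic) x)%:E) t <= (renewal L)%:E.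
Proof.
move=> L0; set g := fun x => _.
have Hg : nnmeas g by apply: nnmeas_indic; exact: measurable_itv.
have Hn n : nnmeas (fun x => \sum_(0 <= k < n) iter k (conv mu) g x).
  by apply: nnmeas_sum => k; exact: nnmeas_convn.
apply: potential_le_partial => // n; elim: n t => [|n IH] t.
  by rewrite big_geq// lee_fin renewal_ge0.
have [tI|tI] := boolP (t \in (`[c, (c + L)%R]%classic : set R)).
  apply: le_trans (partial_le_potential mu n.+1 t Hg) _.
  move: tI; rewrite inE /= in_itv/= => /andP[ct tL].
  apply: (@le_trans _ _ (renewal (t - c))%:E); last first.
    by rewrite lee_fin; apply: renewal_homo; lra.
  rewrite -renewalE -potential_shift; apply: le_potential => // [|x].
    exact/nnmeas_subr/heaviside_nnmeas.
  rewrite /g /H /heaviside lee_fin !indicE ler_nat.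
  rewrite !mem_setE !in_itv/= andbT subr_ge0.
  by case: (c <= x)%R => //=; exact: leq_b1.
rewrite potential_partial_renewal// {1}/g indicE (negbTE tI) add0e.
rewrite -[leRHS](conv_cst mu _ t); apply: le_conv => //.
by apply: nnmeas_cst; rewrite lee_fin renewal_ge0.
Qed.

(** The expected number of points of the walk in ]t - h, t]. *)
Definition window (h t : R) := potential mu (fun x => (\1_(`[0%R, h[%classic) x)%:E) t.

Lemma window_nnmeas (c h : R) : nnmeas (fun x : R => (\1_(`[c, h[%classic) x)%:E).
Proof. by apply: nnmeas_indic; exact: measurable_itv. Qed.

Lemma windowE (h t : R) : (0 <= h)%R -> window h t = (renewal t - renewal (t - h))%:E.
Proof.
move=> h0.
have : potential mu H t = window h t + potential mu (fun x => H (x - h)%R) t.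
  rewrite -potD; [|exact: window_nnmeas|exact/nnmeas_subr/heaviside_nnmeas].
  congr (potential mu _ t); apply/funext => x; rewrite /H /heaviside -EFinD; congr EFin.
  rewrite !indicE.
  rewrite !mem_setE !in_itv/= !andbT subr_ge0.
  by case: (leP 0%R x) => x0; case: (ltP x h) => xh //=; rewrite ?addr0 ?add0r//; lra.
rewrite potential_shift !renewalE => E; rewrite EFinB E addeK//.
Qed.

(** Subadditivity of the renewal function. *)
Lemma renewal_incr (h t : R) : (0 <= h)%R -> (renewal t - renewal (t - h) <= renewal h)%R.
Proof.
move=> h0; rewrite -lee_fin -windowE//; apply: le_trans (potential_window 0%R t h0).
apply: le_potential => [||x]; first exact: window_nnmeas.
  by apply: nnmeas_indic; exact: measurable_itv.
rewrite lee_fin !indicE ler_nat add0r.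
rewrite !mem_setE !in_itv/=; case: (0 <= x)%R => //=.
by case: (ltP x h) => // /ltW ->.
Qed.

End renewal.

Local Close Scope ereal_scope.

(** * Slow variation of smoothed renewal windows *)

(** The function that is 1 on [0, h], vanishes outside ]- r, h + r[ and is
affine in between. *)
Definition trapezoid (R : realType) (r h x : R) : R :=
  Num.max 0 (Num.min 1 (Num.min (1 + x / r) (1 + (h - x) / r))).

Section trapezoid_theory.
Context {R : realType}.
Variables (r h : R).
Hypotheses (r0 : 0 < r) (h0 : 0 <= h).

Lemma trapezoid_itv x : 0 <= trapezoid r h x <= 1.
Proof. by rewrite /trapezoid le_max lexx/= ge_max ler01 ge_min lexx. Qed.

Lemma measurable_trapezoid : measurable_fun setT (trapezoid r h).
Proof.
apply: measurable_maxr; first exact: measurable_cst.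
apply: measurable_minr; first exact: measurable_cst.
apply: measurable_minr.
  by apply: measurable_funD => //; exact: measurable_funM.
by apply: measurable_funD => //; apply: measurable_funM => //; exact: measurable_funB.
Qed.

Lemma trapezoid1 x : 0 <= x <= h -> trapezoid r h x = 1.
Proof.
move=> /andP[x0 xh].
have h1 : 0 <= x / r by apply: divr_ge0 => //; exact: ltW.
have h2 : 0 <= (h - x) / r by apply: divr_ge0; [rewrite subr_ge0|exact: ltW].
rewrite /trapezoid min_l ?max_r//.
by rewrite le_min; apply/andP; split; lra.
Qed.

Lemma trapezoid0 x : (x <= - r) || (h + r <= x) -> trapezoid r h x = 0.
Proof.
move=> hx; rewrite /trapezoid max_l// !ge_min; apply/orP; right.
apply/orP; case/orP: hx => hx; [left|right].
  have : x / r <= -1 by rewrite ler_pdivrMr//; lra.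
  lra.
have : (h - x) / r <= -1 by rewrite ler_pdivrMr//; lra.
lra.
Qed.

Lemma clip_lip (a b a' b' d : R) : 0 <= d -> a <= a' + d -> b <= b' + d ->
  Num.max 0 (Num.min 1 (Num.min a b)) <= Num.max 0 (Num.min 1 (Num.min a' b')) + d.
Proof.
move=> d0 aa bb.
have h1 : Num.min a b <= Num.min a' b' + d.
  by case: (leP a b) => ?; case: (leP a' b') => ?; lra.
move: (Num.min a b) (Num.min a' b') h1 => m m' h1.
by case: (leP 1 m) => ?; case: (leP 1 m') => ?; rewrite ?(max_r ler01);
  try case: (leP 0 m) => ?; try case: (leP 0 m') => ?; lra.
Qed.

Lemma trapezoid_lip x s : trapezoid r h (x + s) <= trapezoid r h x + `|s| / r.
Proof.
have rV : 0 < r^-1 by rewrite invr_gt0.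
have d1 : s / r <= `|s| / r by rewrite ler_pM2r// ler_norm.
have d2 : - (s / r) <= `|s| / r by rewrite -mulNr ler_pM2r// -normrN ler_norm.
apply: clip_lip.
- by apply: divr_ge0 => //; exact: ltW.
- by rewrite mulrDl; lra.
- have -> : (h - (x + s)) / r = (h - x) / r - s / r by ring.
  lra.
Qed.

End trapezoid_theory.

Section smoothed_renewal.
Context {R : realType}.
Variable mu : probability R R.
Hypothesis mu_pos : (mu `]-oo, 0%R]%classic = 0)%E.
Variables (r h : R).
Hypotheses (r0 : 0 < r) (h0 : 0 <= h).

Let C := renewal mu (h + 4 * r).
Let g (x : R) := (trapezoid r h x)%:E.
Let J : set R := `[(- (2 * r))%R, (- (2 * r) + (h + 4 * r))%R]%classic.

Let Hg : nnmeas g.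
Proof.
apply: nnmeas_fin; first exact: measurable_trapezoid.
by move=> x; case/andP: (trapezoid_itv r h x).
Qed.

Let HJ : nnmeas (fun x => (\1_J x)%:E).
Proof. by apply: nnmeas_indic; exact: measurable_itv. Qed.

Let JC t : (potential mu (fun x => (\1_J x)%:E) t <= C%:E)%E.
Proof. by apply: potential_window => //; have := r0; have := h0; lra. Qed.

Let trapezoid_le_J x : trapezoid r h x <= \1_J x.
Proof.
rewrite indicE mem_setE in_itv/=.
case: (boolP (_ && _)) => [_|]; first by case/andP: (trapezoid_itv r h x).
rewrite negb_and -!ltNge => hx; rewrite trapezoid0//.
by have := r0; case/orP: hx => hx ?; apply/orP; [left|right]; lra.
Qed.

(** A continuous substitute for the expected number of points of the walk in
]t - h, t]. *)
Definition smooth t := fine (potential mu g t).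

Lemma smoothE t : potential mu g t = (smooth t)%:E.
Proof.
rewrite fineK// ge0_fin_numE; last exact: potential_ge0.
apply: le_lt_trans (ltry C); apply: le_trans (JC t).
by apply: le_potential => // x; rewrite lee_fin.
Qed.

Lemma smooth_itv t : 0 <= smooth t <= C.
Proof.
apply/andP; split; first by apply: fine_ge0; exact: potential_ge0.
rewrite -lee_fin -smoothE; apply: le_trans (JC t).
by apply: le_potential => // x; rewrite lee_fin.
Qed.

Lemma measurable_smooth : measurable_fun setT smooth.
Proof.
apply/measurable_EFinP; rewrite (_ : _ \o _ = potential mu g).
  by have [] := nnmeas_potential mu Hg.
by apply/funext => t; rewrite smoothE.
Qed.

(** Two translates of the trapezoid differ by at most |s| / r, and only on an
interval whose potential is bounded by potential_window. *)
Lemma smooth_step t s : `|s| <= r -> smooth (t + s) <= smooth t + `|s| / r * C.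
Proof.
move=> sr; have d0 : 0 <= `|s| / r by apply: divr_ge0 => //; exact: ltW.
have HdJ : nnmeas (fun x => (`|s| / r)%:E * (\1_J x)%:E)%E by exact: nnmeasZ.
rewrite -lee_fin EFinD EFinM -!smoothE.
apply: (@le_trans _ _ (potential mu g t + (`|s| / r)%:E * potential mu (fun x => (\1_J x)%:E) t))%E;
  last by rewrite leeD2l// lee_wpmul2l// ?lee_fin.
rewrite -potZ// -potD//.
have -> : t + s = t - - s by rewrite opprK.
rewrite -potential_shift; apply: le_potential => [||x].
- exact: nnmeas_subr.
- exact: nnmeasD.
rewrite /g opprK -EFinM -EFinD lee_fin indicE mem_setE in_itv/=.
case: (boolP (_ && _)) => [_|]; first by rewrite mulr1; exact: trapezoid_lip.
rewrite negb_and -!ltNge => hx; rewrite /= mulr0 addr0 trapezoid0//.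
  by case/andP: (trapezoid_itv r h x).
move: sr; rewrite ler_norml => /andP[s1 s2].
by apply/orP; case/orP: hx => hx; [left|right]; have := r0; lra.
Qed.

Lemma smooth_ucont e : 0 < e -> exists2 d, 0 < d &
  forall t t', `|t - t'| <= d -> `|smooth t - smooth t'| <= e.
Proof.
move=> e0; have C0 : 0 <= C by exact: renewal_ge0.
have C1 : 0 < C + 1 by lra.
have d0 : 0 < e / (C + 1) by apply: divr_gt0.
exists (Num.min r (r * (e / (C + 1)))); first by rewrite lt_min r0 mulr_gt0.
move=> t t'; rewrite le_min => /andP[tr te].
have key s s' : `|s - s'| = `|t - t'| -> smooth s <= smooth s' + e.
  move=> E; have := @smooth_step s' (s - s'); rewrite E => /(_ tr).
  rewrite addrC subrK => h1; apply: le_trans h1 _; rewrite lerD2l.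
  have h2 : `|t - t'| / r <= e / (C + 1) by rewrite ler_pdivrMr// mulrC.
  have := ler_wpM2r C0 h2.
  have := divfK (lt0r_neq0 C1) e; move: (e / _) d0 => d d0; nra.
rewrite ler_norml; apply/andP; split.
  by have := key t' t (distrC _ _); lra.
by have := key t t' erefl; lra.
Qed.

(** Beyond the support of the trapezoid the renewal equation has no source
term. *)
Lemma smooth_renewal t : h + r <= t ->
  (\int[mu]_y (smooth (t - y))%:E = (smooth t)%:E)%E.
Proof.
move=> ht; rewrite -smoothE potential_renewal// /g trapezoid0 ?ht ?orbT// add0e.
by apply: eq_integral => y _; rewrite smoothE.
Qed.

Hypothesis mu_nonlattice : nonlattice mu.

(** The difference of the two translates is harmonic at late times. Adding C
makes it nonnegative, and harmonic_limsup applies with b = C. *)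
Lemma smooth_diff_limsup (p q a : R) : 0 < a -> 0 <= p -> 0 <= q ->
  (forall s N, \sum_(k < N) (smooth (s + k%:R * a + p) - smooth (s + k%:R * a + q)) <= C) ->
  forall e, 0 < e -> exists T, forall t, T <= t -> smooth (t + p) <= smooth (t + q) + e.
Proof.
move=> a0 p0 q0 sumC e e0.
pose w t := smooth (t + p) + (C - smooth (t + q)).
have mu_ge0 : (mu `]-oo, 0%R[%classic = 0)%E.
  apply/eqP; rewrite eq_le measure_ge0 andbT -mu_pos.
  apply: le_measure; rewrite ?inE; [exact: measurable_itv|exact: measurable_itv|].
  by apply: subset_itvl; rewrite bnd_simp.
have ms (c : R) : measurable_fun setT (fun t : R => smooth (t + c)).
  by apply: measurableT_comp; [exact: measurable_smooth|exact: measurable_funD].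
have w_bnd t : 0 <= w t <= 2 * C.
  by have /andP[? ?] := smooth_itv (t + p); have /andP[? ?] := smooth_itv (t + q); rewrite /w; lra.
have w_meas : measurable_fun setT w.
  by apply: measurable_funD => //; exact: measurable_funB.
have w_ucont e' : 0 < e' -> exists2 d, 0 < d &
    forall s s', `|s - s'| <= d -> `|w s - w s'| <= e'.
  move=> e'0; have [d d0 Hd] := @smooth_ucont (e' / 2) (ltac:(lra)).
  exists d => // s s' ss'.
  have hp : `|smooth (s + p) - smooth (s' + p)| <= e' / 2.
    by apply: Hd; rewrite (_ : _ - _ = s - s')//; ring.
  have hq : `|smooth (s' + q) - smooth (s + q)| <= e' / 2.
    by apply: Hd; rewrite distrC (_ : _ - _ = s - s')//; ring.
  rewrite /w (_ : _ - _ = (smooth (s + p) - smooth (s' + p)) +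
     (smooth (s' + q) - smooth (s + q))); last by ring.
  by apply: le_trans (ler_normD _ _) _; lra.
have nn c : nnmeas (fun t => (smooth (t + c))%:E).
  by apply: nnmeas_fin => // t; case/andP: (smooth_itv (t + c)).
have nnC c : nnmeas (fun t => (C - smooth (t + c))%:E).
  by apply: nnmeas_fin => [|t]; [exact: measurable_funB|have /andP[] := smooth_itv (t + c); lra].
have harm c t : 0 <= c -> h + r <= t ->
    (conv mu (fun t => (smooth (t + c))%:E) t = (smooth (t + c))%:E)%E.
  move=> c0 ht; rewrite -smooth_renewal; last by lra.
  by apply: eq_integral => y _; rewrite addrAC.
have w_harm t : h + r <= t -> (\int[mu]_y (w (t - y))%:E = (w t)%:E)%E.
  move=> ht; rewrite EFinD -(harm p)//.
  have -> : ((C - smooth (t + q))%:E = conv mu (fun t => (C - smooth (t + q))%:E) t)%E.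
    have : (conv mu (fun t => (C - smooth (t + q))%:E) t +
            conv mu (fun t => (smooth (t + q))%:E) t = C%:E)%E.
      rewrite -convD// -[RHS](conv_cst mu C t); apply: eq_integral => y _.
      by rewrite -EFinD subrK.
    rewrite harm// => E; rewrite EFinB -E addeK//.
  by rewrite -convD//; apply: eq_integral => y _; rewrite -EFinD.
have := @harmonic_limsup R mu w (2 * C) (h + r) mu_ge0 mu_nonlattice w_bnd w_meas
  w_ucont w_harm a C C a0.
case/(_ _ _ e0) => [s N|T HT]; last first.
  by exists T => t /HT; rewrite /w; lra.
by apply: le_trans (sumC s N); apply: ler_sum => k _; rewrite /w; lra.
Qed.

(** The base point is chosen according to the sign of a, so that both shifts
are nonnegative; the sums along the step |a| then telescope and stay bounded. *)
Lemma smooth_slow a e : 0 < e ->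
  exists T, forall t, T <= t -> smooth (t + a) <= smooth t + e.
Proof.
move=> e0.
have tele s b N : \sum_(k < N) (smooth (s + k%:R * b + b) - smooth (s + k%:R * b)) =
    smooth (s + N%:R * b) - smooth s.
  elim: N => [|N IH]; first by rewrite big_ord0 mul0r addr0 subrr.
  rewrite big_ord_recr /= IH.
  have -> : s + N.+1%:R * b = s + N%:R * b + b by rewrite -natr1; ring.
  by ring.
have [a0|a0|->] := ltgtP a 0; last by exists 0 => t _; rewrite addr0; lra.
- have na0 : 0 < - a by rewrite oppr_gt0.
  have [s N|T HT] := @smooth_diff_limsup 0 (- a) (- a) na0 (lexx _) (ltW na0) _ e e0.
    rewrite (eq_bigr (fun k : 'I_N => - (smooth (s + k%:R * (- a) + - a) - smooth (s + k%:R * (- a))))); last by move=> k _; rewrite addr0 opprB.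
    rewrite sumrN tele; have /andP[? ?] := smooth_itv (s + N%:R * - a).
    by have /andP[? ?] := smooth_itv s; lra.
  exists (T - a) => t Tt; have := HT (t + a) (ltac:(lra)).
  by rewrite addr0 addrK.
- have [s N|T HT] := @smooth_diff_limsup a 0 a a0 (ltW a0) (lexx _) _ e e0.
    rewrite (eq_bigr (fun k : 'I_N => (smooth (s + k%:R * a + a) - smooth (s + k%:R * a)))); last by move=> k _; rewrite addr0.
    rewrite tele; have /andP[? ?] := smooth_itv (s + N%:R * a).
    by have /andP[? ?] := smooth_itv s; lra.
  by exists T => t /HT; rewrite addr0.
Qed.

(** The trapezoid lies between the indicators of [0, h[ and [- r, h' - r[. *)
Lemma window_le_smooth h' t : h' = h + 3 * r ->
  renewal mu t - renewal mu (t - h) <= smooth t <=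
  renewal mu (t + r) - renewal mu (t + r - h').
Proof.
move=> h'E; apply/andP; split; rewrite -lee_fin -smoothE.
  rewrite -windowE//; apply: le_potential => // [|x]; first exact: window_nnmeas.
  rewrite lee_fin indicE mem_setE in_itv/=.
  case: (boolP (_ && _)) => [/andP[x0 xh]|_]; last by case/andP: (trapezoid_itv r h x).
  by rewrite trapezoid1// x0 ltW.
rewrite -windowE//; last by have := r0; have := h0; lra.
have -> : t + r = t - - r by rewrite opprK.
rewrite /window -(potential_shift mu (fun x => (\1_(`[0%R, h'[%classic) x)%:E)).
apply: le_potential => // [|x]; first exact: (nnmeas_subr (- r) (window_nnmeas 0%R h')).
rewrite lee_fin indicE mem_setE in_itv/= opprK.
case: (boolP (_ && _)) => [_|]; first by case/andP: (trapezoid_itv r h x).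
rewrite negb_and -ltNge -leNgt => hx; rewrite trapezoid0//.
by apply/orP; case/orP: hx => hx; [left|right]; have := r0; lra.
Qed.

End smoothed_renewal.

(** * Blackwell's theorem *)

Definition cell (R : realType) (h : R) (n : nat) (x : R) : R :=
  \1_(`[0, h[%classic) (x - n%:R * h).

Lemma cellE (R : realType) (h : R) n x :
  cell h n x = ((n%:R * h <= x < n.+1%:R * h)%R)%:R.
Proof.
rewrite /cell indicE mem_setE in_itv/= subr_ge0 ltrBlDr -natr1 mulrDl mul1r.
by rewrite [h + _]addrC.
Qed.

Lemma cell_ge0 (R : realType) (h : R) n x : 0 <= cell h n x.
Proof. by rewrite cellE. Qed.

(** Only the cell of x contributes. Asking for z <= a n on all the cells that
start before x is the form in which a nonincreasing function satisfies it. *)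
Lemma upper_steps (R : realType) (h x z : R) (a : nat -> R) N : 0 < h ->
  (forall n, 0 <= a n) -> (forall n, n%:R * h <= x -> z <= a n) ->
  0 <= x < N%:R * h -> z <= \sum_(0 <= n < N) a n * cell h n x.
Proof.
move=> h0 a0 za; elim: N => [|N IH] /andP[x0 xN]; first by move: xN; rewrite mul0r; lra.
rewrite big_nat_recr//=.
have t0 n : 0 <= a n * cell h n x by rewrite mulr_ge0// cell_ge0.
have [xN'|Nx] := ltP x (N%:R * h).
  by have := IH (ltac:(by rewrite x0)); have := t0 N; lra.
rewrite cellE Nx xN /= mulr1; have := za _ Nx.
have : 0 <= \sum_(0 <= n < N) a n * cell h n x by apply: sumr_ge0 => n _.
lra.
Qed.

Lemma lower_steps (R : realType) (h x z : R) (a : nat -> R) N : 0 < h ->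
  0 <= z -> (forall n, n%:R * h <= x < n.+1%:R * h -> a n <= z) ->
  \sum_(0 <= n < N) a n * cell h n x <= z.
Proof.
move=> h0 z0 az.
suff [] : \sum_(0 <= n < N) a n * cell h n x <= z /\
    (N%:R * h <= x -> \sum_(0 <= n < N) a n * cell h n x = 0) by [].
elim: N => [|N [IH1 IH2]]; first by rewrite big_geq.
have NN : N%:R * h <= N.+1%:R * h by rewrite ler_pM2r// ler_nat.
rewrite big_nat_recr//= cellE.
case: (boolP (_ && _)) => [xN|_]; last first.
  by rewrite mulr0 addr0; split => // Nx; apply: IH2; exact: le_trans Nx.
have az' := az _ xN; move: xN => /andP[/IH2 -> xN]; rewrite add0r mulr1.
by split => //; rewrite leNgt xN.
Qed.

Section blackwell.
Context {R : realType}.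
Variable mu : probability R R.
Hypothesis mu_pos : (mu `]-oo, 0%R]%classic = 0)%E.
Hypothesis mu_nonlattice : nonlattice mu.
Variable m : R.
Hypothesis mu_mean : (\int[mu]_(y in `]0%R, +oo[) y%:E = m%:E)%E.

Let Rpos := `]0%R, +oo[%classic : set R.
Let H := @heaviside R.
Let U := renewal mu.

Definition tail (x : R) : R := fine (mu `]x, +oo[%classic).

Lemma tailE x : mu `]x, +oo[%classic = (tail x)%:E.
Proof. by rewrite fineK// fin_num_measure//; exact: measurable_itv. Qed.

Lemma tail_ge0 x : 0 <= tail x.
Proof. by apply: fine_ge0. Qed.

Lemma tail_le1 x : tail x <= 1.
Proof. by rewrite -lee_fin -tailE probability_le1//; exact: measurable_itv. Qed.

Lemma tail_anti x y : x <= y -> tail y <= tail x.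
Proof.
move=> xy; rewrite -lee_fin -!tailE; apply: le_measure; rewrite ?inE;
  [exact: measurable_itv|exact: measurable_itv|].
by apply: subset_itvr; rewrite bnd_simp.
Qed.

Lemma mean_gt0 : 0 < m.
Proof. by rewrite -lte_fin -mu_mean; exact: (integral_Rpos_gt0 mu_pos). Qed.

(** The series is h times the number of n such that n h < y. *)
Lemma stair_bounds (h y : R) : 0 < h -> 0 < y ->
  (y%:E <= \sum_(0 <= n <oo) (h * \1_(`](n%:R * h)%R, +oo[%classic) y)%:E <= (y + h)%:E)%E.
Proof.
move=> h0 y0.
have indE n : \1_(`](n%:R * h)%R, +oo[%classic) y = (n%:R * h < y)%R%:R :> R.
  by rewrite indicE mem_setE in_itv/= andbT.
have t0 n : (0 <= (h * \1_(`](n%:R * h)%R, +oo[%classic) y)%:E)%E.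
  by rewrite lee_fin indE mulr_ge0// ltW.
apply/andP; split.
  have [N NE] : exists N : nat, y <= N%:R * h /\ forall n, (n < N)%N -> n%:R * h < y.
    have ex : exists N : nat, y <= N%:R * h.
      exists (Num.truncn (y / h)).+1; apply: ltW; rewrite -ltr_pdivrMr//.
      exact: truncnS_gt.
    exists (ex_minn ex); case: ex_minnP => N yN Nmin; split => // n nN.
    by rewrite ltNge; apply/negP => /Nmin; rewrite leqNgt nN.
  case: NE => yN Hn.
  apply: (@le_trans _ _ (\sum_(0 <= n < N) (h * \1_(`](n%:R * h)%R, +oo[%classic) y)%:E)%E).
    rewrite sumEFin lee_fin; apply: le_trans yN _.
    rewrite big_mkord (eq_bigr (fun=> h)).
      by rewrite sumr_const card_ord mulr_natl.
    by move=> [n nN] _; rewrite indE Hn//= mulr1.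
  by apply: nneseries_lim_ge.
apply: lime_le; first by apply: is_cvg_nneseries.
apply: nearW => N; rewrite sumEFin lee_fin.
suff : \sum_(0 <= n < N) h * \1_(`](n%:R * h)%R, +oo[%classic) y <= y + h /\
    \sum_(0 <= n < N) h * \1_(`](n%:R * h)%R, +oo[%classic) y <= N%:R * h by case.
elim: N => [|N [IH1 IH2]]; first by rewrite big_geq// mul0r; split; lra.
rewrite big_nat_recr//= indE -natr1 mulrDl mul1r.
by case: ltP => hN /=; rewrite ?mulr1 ?mulr0 ?addr0; split; lra.
Qed.

(** Integration of stair_bounds against mu turns y into m, and the staircase
into h times the series of the tails. *)
Lemma tail_series (h : R) : 0 < h -> exists2 S : R,
  (\sum_(0 <= n <oo) (tail (n%:R * h))%:E = S%:E)%E & m <= h * S <= m + h.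
Proof.
move=> h0.
have mR : measurable Rpos by exact: measurable_itv.
pose f (n : nat) (y : R) := (h * \1_(`](n%:R * h)%R, +oo[%classic) y)%:E.
have mf n (D : set R) : measurable D -> measurable_fun D (f n).
  by move=> mD; apply/measurable_EFinP; apply: measurable_funM.
have f0 n y : (0 <= f n y)%E by rewrite lee_fin mulr_ge0// ltW.
have fE n : (\int[mu]_(y in Rpos) f n y = h%:E * (tail (n%:R * h))%:E)%E.
  rewrite /f; under eq_integral do rewrite EFinM.
  rewrite ge0_integralZl_EFin//; last 2 first.
  - by apply/measurable_EFinP; exact: measurable_indic.
  - exact: ltW.
  rewrite integral_indic//.
  congr (_ * _)%E; rewrite -tailE; congr (mu _); apply/setIidPl => y /=.
  rewrite /Rpos /= !in_itv/= !andbT; apply: le_lt_trans.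
  by rewrite mulr_ge0// ltW.
have SE : (\int[mu]_(y in Rpos) \sum_(0 <= n <oo) f n y =
    h%:E * \sum_(0 <= n <oo) (tail (n%:R * h))%:E)%E.
  rewrite integral_nneseries//; last by move=> n; exact: mf.
  rewrite -nneseriesZl; last by move=> n _; rewrite lee_fin tail_ge0.
  by apply: eq_eseriesr => n _; exact: fE.
have mS : measurable_fun Rpos (fun y => \sum_(0 <= n <oo) f n y)%E.
  by apply: ge0_emeasurable_sum => // n _; exact: mf.
have Rposlt y : Rpos y -> 0 < y by rewrite /Rpos /= in_itv/= andbT.
have lo : (m%:E <= h%:E * \sum_(0 <= n <oo) (tail (n%:R * h))%:E)%E.
  rewrite -SE -mu_mean; apply: ge0_le_integral => //.
  - by move=> y /Rposlt y0; rewrite lee_fin ltW.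
  - by move=> y /Rposlt y0; case/andP: (stair_bounds h0 y0).
have up : (h%:E * \sum_(0 <= n <oo) (tail (n%:R * h))%:E <= (m + h)%:E)%E.
  rewrite -SE; apply: (@le_trans _ _ (\int[mu]_(y in Rpos) (y%:E + h%:E))%E).
    apply: ge0_le_integral => //.
    - by move=> y _; apply: nneseries_ge0.
    - by apply: emeasurable_funD => //; apply/measurable_EFinP.
    - by move=> y /Rposlt y0; case/andP: (stair_bounds h0 y0).
  rewrite ge0_integralD//; last 2 first.
  - by move=> y /Rposlt y0; rewrite lee_fin ltW.
  - by move=> y _; rewrite lee_fin ltW.
  rewrite mu_mean integral_cst// EFinD leeD2l// -[leRHS]mule1.
  by apply: lee_wpmul2l; [rewrite lee_fin ltW|exact: probability_le1].
have S0 : (0 <= \sum_(0 <= n <oo) (tail (n%:R * h))%:E)%E.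
  by apply: nneseries_ge0 => n _ _; rewrite lee_fin tail_ge0.
move: lo up S0; case: (\sum_(0 <= n <oo) _)%E => [S| |]//.
  by rewrite -!EFinM !lee_fin => lo up _; exists S => //; rewrite lo.
by rewrite gt0_muley ?lte_fin// leye_eq.
Qed.

(** The probability that a walk standing at distance x before a level crosses
the level at its next step. *)
Definition residual (x : R) : R := \1_(`[0, +oo[%classic) x * tail x.

Lemma residual_itv x : 0 <= residual x <= 1.
Proof.
rewrite /residual indicE; case: (_ \in _); rewrite ?mul1r ?mul0r ?lexx ?ler01//.
by rewrite tail_ge0 tail_le1.
Qed.

(** The two terms correspond to a first step that crosses the level and to one
that does not. *)
Lemma residualE x : (H x = (residual x)%:E + conv mu H x)%E.
Proof.
have -> : (conv mu H x = (1 - tail x)%:E)%E.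
  transitivity (mu `]-oo, x]%classic).
    transitivity (\int[mu]_y (\1_(`]-oo, x]%classic) y)%:E)%E.
      apply: eq_integral => y _.
      by rewrite /H /heaviside !indicE !mem_setE !in_itv/= andbT subr_ge0.
    by rewrite integral_indic// setIT.
  have -> : `]-oo, x]%classic = ~` `]x, +oo[%classic :> set R by rewrite setCitvr.
  by rewrite probability_setC ?tailE//; exact: measurable_itv.
rewrite -EFinD /H /heaviside /residual; congr EFin.
rewrite indicE mem_setE in_itv/= andbT; case: leP => x0 /=; first by ring.
suff -> : tail x = 1 by ring.
apply/eqP; rewrite eq_le tail_le1/= -lee_fin -tailE -(mu_RposE mu_pos).
apply: le_measure; rewrite ?inE; [exact: measurable_itv|exact: measurable_itv|].
by apply: subset_itvr; rewrite bnd_simp ltW.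
Qed.

Lemma residual_nnmeas : nnmeas (fun x => (residual x)%:E).
Proof.
have [mH H0] := @heaviside_nnmeas R; have [mc c0] := nnmeas_conv mu (@heaviside_nnmeas R).
apply: nnmeas_fin => [|x]; last by case/andP: (residual_itv x).
apply/measurable_EFinP; rewrite (_ : _ \o _ = fun x => (H x - conv mu H x)%E).
  exact: emeasurable_funB.
apply/funext => x; rewrite residualE addeK//.
rewrite ge0_fin_numE//; apply: (@le_lt_trans _ _ (H x)); last by rewrite ltry.
by rewrite residualE leeDr// lee_fin; case/andP: (residual_itv x).
Qed.

(** For t >= 0 the events S_k <= t < S_(k+1) form a partition. Analytically,
residual is heaviside - mu * heaviside, and the potential of this difference
telescopes because the potential of heaviside is finite. *)
Lemma potential_residual t : potential mu (fun x => (residual x)%:E) t = H t.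
Proof.
have HH := @heaviside_nnmeas R; have Hc := nnmeas_conv mu HH.
have E1 : (potential mu H t = potential mu (fun x => (residual x)%:E) t + conv mu (potential mu H) t)%E.
  rewrite -potential_conv// -potD//; last exact: residual_nnmeas.
  by congr (potential mu _ t); apply/funext => x; exact: residualE.
have fin : conv mu (potential mu H) t \is a fin_num.
  have [_ c0] := nnmeas_conv mu (nnmeas_potential mu HH).
  rewrite ge0_fin_numE//; apply: le_lt_trans (renewal_fin mu_pos t).
  by rewrite E1 leeDr// potential_ge0//; exact: residual_nnmeas.
move: E1; rewrite potential_renewal// => /(congr1 (fun z => z - conv mu (potential mu H) t)%E).
by rewrite !addeK.
Qed.

Lemma cell_nnmeas (h : R) n : nnmeas (fun x => (cell h n x)%:E).
Proof. exact: (nnmeas_subr (n%:R * h) (window_nnmeas 0%R h)). Qed.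

Lemma potential_steps (a : nat -> R) (h : R) N t : 0 < h -> (forall n, 0 <= a n) ->
  potential mu (fun x => (\sum_(0 <= n < N) a n * cell h n x)%:E) t =
  (\sum_(0 <= n < N) a n * (U (t - n%:R * h) - U (t - n%:R * h - h)))%:E.
Proof.
move=> h0 a0.
rewrite (_ : (fun _ => _) = fun x => (\sum_(0 <= n < N) (a n)%:E * (cell h n x)%:E)%E); last first.
  by apply/funext => x; rewrite -sumEFin; apply: eq_bigr => n _; rewrite EFinM.
rewrite potential_sum; last by move=> n; apply: nnmeasZ => //; exact: cell_nnmeas.
rewrite -sumEFin; apply: eq_bigr => n _; rewrite potZ//; last exact: cell_nnmeas.
rewrite EFinM; congr (_ * _)%E; rewrite -windowE//; last exact: ltW.
exact: (potential_shift mu (fun x => (\1_(`[0%R, h[%classic) x)%:E)).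
Qed.

(** The residual is below the step function of its values at left endpoints.
The part beyond the last cell that is used has zero potential at t. *)
Lemma renewal_steps_ge1 (h t : R) : 0 < h -> 0 <= t ->
  (1 <= \sum_(0 <= n <oo) (tail (n%:R * h) * (U (t - n%:R * h) - U (t - n%:R * h - h)))%:E)%E.
Proof.
move=> h0 t0.
have [N tN] : exists N : nat, t < N%:R * h.
  by exists (Num.truncn (t / h)).+1; rewrite -ltr_pdivrMr//; exact: truncnS_gt.
have Hs : nnmeas (fun x => (\sum_(0 <= n < N) tail (n%:R * h) * cell h n x)%:E).
  have := @nnmeas_sum R (fun n x => (tail (n%:R * h))%:E * (cell h n x)%:E)%E N.
  rewrite (_ : (fun x => _) = (fun x => (\sum_(0 <= n < N) tail (n%:R * h) * cell h n x)%:E)).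
    by apply => n; apply: nnmeasZ; [exact: tail_ge0|exact: cell_nnmeas].
  by apply/funext => x; rewrite -sumEFin; apply: eq_bigr => n _; rewrite EFinM.
have HN : nnmeas (fun x => H (x - N%:R * h)) by apply: nnmeas_subr; exact: heaviside_nnmeas.
have : (potential mu (fun x => (residual x)%:E) t <= potential mu (fun x =>
    (\sum_(0 <= n < N) tail (n%:R * h) * cell h n x)%:E + H (x - N%:R * h)%R) t)%E.
  apply: le_potential; [exact: residual_nnmeas|exact: nnmeasD|move=> x].
  rewrite /H /heaviside -EFinD lee_fin indicE mem_setE in_itv/= andbT subr_ge0.
  have s0 : 0 <= \sum_(0 <= n < N) tail (n%:R * h) * cell h n x.
    by apply: sumr_ge0 => n _; rewrite mulr_ge0// ?tail_ge0 ?cell_ge0.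
  have [xN|Nx] := leP (N%:R * h) x.
    by have /andP[_] := residual_itv x; rewrite /=; lra.
  rewrite /= addr0 /residual indicE mem_setE in_itv/= andbT.
  case: (leP 0 x) => x0; last by rewrite mul0r.
  rewrite mul1r; apply: upper_steps => // [n|n nx|]; first exact: tail_ge0.
    exact: tail_anti.
  by rewrite x0.
rewrite potential_residual potD// potential_steps//; last by move=> n; exact: tail_ge0.
rewrite potential_shift renewalE// renewal_lt0//; last by rewrite subr_lt0.
rewrite adde0 /H /heaviside indicE mem_setE in_itv/= andbT t0 /= => /le_trans; apply.
rewrite -sumEFin; apply: nneseries_lim_ge => n _ _.
rewrite lee_fin mulr_ge0// ?tail_ge0// subr_ge0; apply: renewal_homo => //.
by rewrite gerBl ltW.
Qed.

(** The residual is above the step function of its values at right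
endpoints. *)
Lemma renewal_steps_le1 (h t : R) N : 0 < h ->
  \sum_(0 <= n < N) tail (n.+1%:R * h) * (U (t - n%:R * h) - U (t - n%:R * h - h)) <= 1.
Proof.
move=> h0; rewrite -lee_fin -(@potential_steps (fun n => tail (n.+1%:R * h)))//; last first.
  by move=> n; exact: tail_ge0.
apply: (@le_trans _ _ (H t)); last by rewrite /H /heaviside lee_fin indicE lern1 leq_b1.
rewrite -potential_residual; apply: le_potential; [|exact: residual_nnmeas|move=> x].
  have := @nnmeas_sum R (fun n x => (tail (n.+1%:R * h))%:E * (cell h n x)%:E)%E N.
  rewrite (_ : (fun x => _) = (fun x => (\sum_(0 <= n < N) tail (n.+1%:R * h) * cell h n x)%:E)).
    by apply => n; apply: nnmeasZ; [exact: tail_ge0|exact: cell_nnmeas].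
  by apply/funext => y; rewrite -sumEFin; apply: eq_bigr => n _; rewrite EFinM.
rewrite lee_fin; apply: lower_steps => // [|n /andP[nx xn]].
  by case/andP: (residual_itv x).
have x0 : 0 <= x by apply: le_trans nx; rewrite mulr_ge0// ltW.
rewrite /residual indicE mem_setE in_itv/= andbT x0 mul1r.
by apply: tail_anti; exact: ltW.
Qed.

(** By slow variation, each window of length h before t is at most the longer
window at t, up to a small error. So renewal_steps_ge1 bounds the latter below
by about the inverse of the series of tails, which is at most (m + h) / h. *)
Lemma renewal_window_ge (h h' e : R) : 0 < h -> h < h' -> 0 < e -> exists T, forall t,
  T <= t -> h / (h + m) - e <= U t - U (t - h').
Proof.
move=> h0 hh' e0; pose r := (h' - h) / 3.
have r0 : 0 < r by rewrite /r; lra.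
have h'E : h' = h + 3 * r by rewrite /r; field.
have h0' := ltW h0; have m0 := mean_gt0.
have [S SE /andP[S1 S2]] := tail_series h0.
have sandwich := fun t => window_le_smooth mu_pos r0 h0' t h'E.
pose b t (n : nat) := U (t - n%:R * h) - U (t - n%:R * h - h).
pose beta t := U (t + r) - U (t + r - h').
have beta0 t : 0 <= beta t by rewrite subr_ge0; apply: renewal_homo => //; lra.
have e20 : 0 < e * (h + m) / h by apply: divr_gt0 => //; apply: mulr_gt0 => //; lra.
have [||||T HT] := @limsup_series R (fun n => tail (n%:R * h)) b beta (U h) _ _ _ _ _ e20.
- by move=> n; exact: tail_ge0.
- by rewrite SE ltry.
- exists 0 => t _; split => // n; apply/andP; split.
    by rewrite subr_ge0; apply: renewal_homo => //; lra.
  exact: renewal_incr.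
- move=> n d d0; have [T HT] := smooth_slow mu_pos r0 h0' mu_nonlattice (- (n%:R * h)) d0.
  exists T => t /HT ht; have /andP[+ _] := sandwich (t - n%:R * h).
  have /andP[_ +] := sandwich t; rewrite /b /beta /U; lra.
exists (Num.max (T + r) r) => t; rewrite ge_max => /andP[tT tr].
have := HT (t - r) (ltac:(lra)).
have /le_trans := @renewal_steps_ge1 h (t - r) h0 (ltac:(lra)).
move=> /[apply]; rewrite SE -EFinM -EFinD lee_fin => h1.
have : beta (t - r) = U t - U (t - h') by rewrite /beta subrK.
have := beta0 (t - r); move: (beta _) h1 => B h1 B0 <-.
have hm : 0 < h + m by lra.
rewrite lerBlDr ler_pdivrMr//.
have : e * (h + m) / h * h = e * (h + m) by rewrite divfK// gt_eqF.
move: (e * (h + m) / h) h1 => e2 h1 e2E.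
have h2 := ler_wpM2l B0 S2.
have := ler_wpM2r h0' h1; lra.
Qed.

(** By slow variation, the shorter window at t is at most each window of length
h before t, up to a small error, so renewal_steps_le1 bounds it above by about
the inverse of a partial sum of the tails. This sum omits the tail at 0, which
is at most 1, whence m - h instead of m. *)
Lemma renewal_window_le (h h' e : R) : 0 < h' -> h' < h -> h < m -> 0 < e ->
  exists T, forall t, T <= t -> U t - U (t - h') <= h / (m - h) + e.
Proof.
move=> h'0 hh' hm e0; pose r := (h - h') / 3.
have r0 : 0 < r by rewrite /r; lra.
have hE : h = h' + 3 * r by rewrite /r; field.
have h0 : 0 < h by lra.
have h0' := ltW h'0; have m0 := mean_gt0.
have [S SE /andP[S1 S2]] := tail_series h0.
have sandwich := fun t => window_le_smooth mu_pos r0 h0' t hE.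
have C0 : 0 <= U h' by exact: renewal_ge0.
pose d := e * (m - h) / (2 * (U h' + 1)).
have d0 : 0 < d by apply: divr_gt0; [apply: mulr_gt0 => //; lra|lra].
have dE : d * (2 * (U h' + 1)) = e * (m - h) by rewrite divfK// lt0r_neq0//; lra.
(* The error e is shared between d, which measures the tails left out by the
   partial sum, and e1, the error in the comparison of windows. *)
pose e1 := e * (m - h) / (2 * (m + h)).
have e10 : 0 < e1 by apply: divr_gt0; [apply: mulr_gt0 => //; lra|lra].
have e1E : e1 * (2 * (m + h)) = e * (m - h) by rewrite divfK// lt0r_neq0//; lra.
have [N HN] : exists N, S - d / h < \sum_(0 <= n < N) tail (n%:R * h).
  apply: contrapT => /forallNP hN.
  have : (S%:E <= (S - d / h)%:E)%E.
    rewrite -SE; apply: lime_le.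
      by apply: is_cvg_nneseries => n _ _; rewrite lee_fin tail_ge0.
    by apply: nearW => N; rewrite sumEFin lee_fin leNgt; apply/negP; exact: hN.
  by rewrite lee_fin; have := divr_gt0 d0 h0; lra.
pose s := \sum_(0 <= n < N) tail (n.+1%:R * h).
have s_shift : s = \sum_(0 <= n < N) tail (n%:R * h) + tail (N%:R * h) - tail 0.
  rewrite /s; elim: (N) => [|k IH]; first by rewrite !big_geq// mul0r; ring.
  by rewrite !big_nat_recr//= IH; ring.
have hs1 : m - h - d <= h * s.
  have h1 : S - d / h - 1 <= s.
    by rewrite s_shift; have := tail_le1 0; have := tail_ge0 (N%:R * h); lra.
  have := ler_wpM2l (ltW h0) h1.
  have -> : h * (S - d / h - 1) = h * S - h - d by field; lra.
  lra.
have hs2 : h * s <= m + h.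
  apply: le_trans S2; rewrite ler_pM2l// -lee_fin -SE.
  apply: (@le_trans _ _ (\sum_(0 <= n < N) (tail (n%:R * h))%:E)%E).
    rewrite sumEFin lee_fin; apply: ler_sum => n _; apply: tail_anti.
    by rewrite ler_pM2r// ler_nat.
  by apply: nneseries_lim_ge => n _ _; rewrite lee_fin tail_ge0.
have s0 : 0 <= s by apply: sumr_ge0 => n _; exact: tail_ge0.
have [T HT] : exists T, forall t, T <= t -> forall n, (n < N)%N ->
    U t - U (t - h') <= U (t - n%:R * h) - U (t - n%:R * h - h) + e1.
  elim: (N) => [|k [T HT]]; first by exists 0.
  have [T' HT'] := smooth_slow mu_pos r0 h0' mu_nonlattice (r + k%:R * h) e10.
  exists (Num.max T (T' + (r + k%:R * h))) => t; rewrite ge_max => /andP[/HT h1 tT'] n.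
  rewrite ltnS leq_eqVlt => /predU1P[->|]; last exact: h1.
  have := HT' (t - (r + k%:R * h)) (ltac:(lra)); rewrite subrK.
  have /andP[+ _] := sandwich t; have /andP[_ +] := sandwich (t - (r + k%:R * h)).
  have -> : t - (r + k%:R * h) + r = t - k%:R * h by ring.
  rewrite /U; lra.
exists T => t /HT {}HT.
have W0 : 0 <= U t - U (t - h') by rewrite subr_ge0; apply: renewal_homo => //; lra.
have WC : U t - U (t - h') <= U h' by exact: renewal_incr.
have key : s * (U t - U (t - h') - e1) <= 1.
  apply: le_trans (renewal_steps_le1 t N h0); rewrite /s mulr_suml !big_mkord.
  apply: ler_sum => n _; apply: ler_wpM2l; first exact: tail_ge0.
  by have := HT n (ltn_ord n); lra.
move: (U t - U (t - h')) W0 WC key => W W0 WC key.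
have mh : 0 < m - h by lra.
rewrite -lerBlDr ler_pdivlMr//.
have k1 := ler_wpM2l (ltW h0) key.
have k2 := ler_wpM2r W0 hs1.
have k3 := ler_wpM2r (ltW e10) hs2.
have k4 := ler_wpM2l (ltW d0) WC.
clear - k1 k2 k3 k4 dE e1E d0; nra.
Qed.

(** Blackwell's renewal theorem. *)
Theorem renewal_blackwell (L : R) : 0 < L -> asymp 0 (fun t => U t - U (t - L)) (L / m).
Proof.
move=> L0; apply: blackwell_of_bounds => //; first exact: mean_gt0.
- exact: renewal_window_ge.
- exact: renewal_window_le.
Qed.

End blackwell.

(** * Asymptotics of the generations *)

Section conv_asymptotics.
Context {R : realType}.
Variable nu : {measure set R -> \bar R}.
Variable V : R -> R.
Hypothesis nuV : forall t, (nu `]-oo, t]%classic = (V t)%:E)%E.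
Variables (phi : R -> R) (C l : R).
Hypothesis mphi : measurable_fun setT phi.
Hypothesis phi_bnd : forall s, 0 <= phi s <= C.
Hypothesis phi_lt0 : forall s, s < 0 -> phi s = 0.

Let mphi_sub t : measurable_fun setT (fun y : R => (phi (t - y))%:E).
Proof.
by apply/measurable_EFinP; apply: measurableT_comp => //; exact: measurable_subl.
Qed.

Lemma cdf_homo : {homo V : x y / x <= y}.
Proof.
move=> x y xy; rewrite -lee_fin -!nuV; apply: le_measure; rewrite ?inE;
  [exact: measurable_itv|exact: measurable_itv|].
by apply: subset_itvl; rewrite bnd_simp.
Qed.

Lemma cdf_diff s t : s <= t -> (nu `]s, t]%classic = (V t - V s)%:E)%E.
Proof.
move=> st; have : (nu `]-oo, t]%classic = nu `]-oo, s]%classic + nu `]s, t]%classic)%E.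
  rewrite -measureU; [|exact: measurable_itv|exact: measurable_itv|].
    congr (nu _); apply/seteqP; split => x /=; rewrite !in_itv/=.
      by move=> xt; case: (leP x s) => xs; [left|right; rewrite xt].
    by case=> [xs|/andP[_ //]]; exact: le_trans st.
  apply/seteqP; split => // x [] /=; rewrite !in_itv/= => xs /andP[sx _].
  by move: (le_lt_trans xs sx); rewrite ltxx.
by rewrite !nuV => E; rewrite EFinB E addeAC subee// add0e.
Qed.

Lemma conv_le_bound t : (conv nu (fun s => (phi s)%:E) t <= (C * V t)%:E)%E.
Proof.
have C0 : 0 <= C by have /andP[] := phi_bnd 0; exact: le_trans.
rewrite EFinM -nuV -(integral_scale_indic nu C0); last exact: measurable_itv.
apply: ge0_le_integral => //.
- by move=> y _; rewrite lee_fin; case/andP: (phi_bnd (t - y)).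
- apply/measurable_EFinP; apply: measurable_funM => //; exact: measurable_indic.
- move=> y _; rewrite -EFinM lee_fin indicE mem_setE in_itv/=.
  case: (leP y t) => ty; first by rewrite mulr1; case/andP: (phi_bnd (t - y)).
  by rewrite mulr0 phi_lt0// subr_lt0.
Qed.

Definition convr t := fine (conv nu (fun s => (phi s)%:E) t).

Lemma convrE t : conv nu (fun s => (phi s)%:E) t = (convr t)%:E.
Proof.
rewrite fineK// ge0_fin_numE; first exact: le_lt_trans (conv_le_bound t) (ltry _).
by apply: integral_ge0 => y _; rewrite lee_fin; case/andP: (phi_bnd (t - y)).
Qed.

Hypothesis phi_lim : asymp 0 phi l.
Hypothesis l0 : 0 <= l.

(** phi (t - y) is within e of l except when y belongs to the last stretch
]t - A, t]; there it is between 0 and C, and the mass of the stretch enters as an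
error term. *)
Lemma convr_bounds e : 0 < e -> exists2 A, 0 <= A & forall t,
  l * V t - e * V t - l * (V t - V (t - A)) <= convr t <=
  l * V t + e * V t + C * (V t - V (t - A)).
Proof.
move=> e0; have l0' := l0.
have C0 : 0 <= C by have /andP[] := phi_bnd 0; exact: le_trans.
have [A0 HA0] := phi_lim e0; pose A := Num.max A0 0.
have A_ge0 : 0 <= A by rewrite le_max lexx orbT.
have HA s : A <= s -> l - e <= phi s <= l + e.
  rewrite ge_max => /andP[/HA0 + _]; rewrite expr0 !mulr1 ler_norml => /andP[? ?].
  by apply/andP; split; lra.
exists A => // t.
have tA : t - A <= t by lra.
pose I1 := `]-oo, t]%classic : set R; pose I2 := `](t - A), t]%classic : set R.
have mI1 : measurable I1 by exact: measurable_itv.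
have mI2 : measurable I2 by exact: measurable_itv.
have scal (k : R) (D : set R) : 0 <= k -> measurable D ->
    nnmeas (fun y : R => (k%:E * (\1_D y)%:E)%E).
  by move=> k0 mD; apply: nnmeasZ => //; exact: nnmeas_indic.
have Nphi : nnmeas (fun y : R => (phi (t - y))%:E).
  by split => // y; rewrite lee_fin; case/andP: (phi_bnd (t - y)).
have int1 k : 0 <= k -> (\int[nu]_y (k%:E * (\1_I1 y)%:E) = (k * V t)%:E)%E.
  by move=> k0; rewrite integral_scale_indic// nuV EFinM.
have int2 k : 0 <= k -> (\int[nu]_y (k%:E * (\1_I2 y)%:E) = (k * (V t - V (t - A)))%:E)%E.
  by move=> k0; rewrite integral_scale_indic// cdf_diff// EFinM.
have intD f g : nnmeas f -> nnmeas g ->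
    (\int[nu]_y (f y + g y) = \int[nu]_y f y + \int[nu]_y g y)%E.
  by move=> [mf f0] [mg g0]; rewrite ge0_integralD.
have intle f g : nnmeas f -> nnmeas g -> (forall y, f y <= g y)%E ->
    (\int[nu]_y f y <= \int[nu]_y g y)%E.
  by move=> [mf f0] [mg g0] fg; apply: ge0_le_integral.
have i1E y : \1_I1 y = (y <= t)%R%:R :> R by rewrite indicE mem_setE in_itv.
have i2E y : \1_I2 y = (t - A < y <= t)%R%:R :> R by rewrite indicE mem_setE in_itv.
have le0 : 0 <= l + e by lra.
apply/andP; split.
  have : (\int[nu]_y (l%:E * (\1_I1 y)%:E) <=
      \int[nu]_y ((phi (t - y))%:E + (e%:E * (\1_I1 y)%:E + l%:E * (\1_I2 y)%:E)))%E.
    apply: intle; [exact: scal|by apply: nnmeasD => //; apply: nnmeasD; apply: scal => //; exact: ltW|move=> y].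
    rewrite -!EFinM -!EFinD lee_fin i1E i2E.
    have /andP[p0 pC] := phi_bnd (t - y).
    case: (leP y t) => yt /=; last by rewrite andbF /= !mulr0; lra.
    rewrite andbT; case: (ltP (t - A) y) => yA /=; rewrite ?mulr1 ?mulr0; first by lra.
    by have /andP[] := HA (t - y) (ltac:(lra)); lra.
  rewrite intD//; last by apply: nnmeasD; apply: scal => //; exact: ltW.
  rewrite intD; [|by apply: scal => //; exact: ltW|exact: scal].
  rewrite !int1 ?int2 ?(ltW e0)//.
  have -> : (\int[nu]_y (phi (t - y))%:E = (convr t)%:E)%E by exact: convrE.
  by rewrite -!EFinD lee_fin; lra.
have : (\int[nu]_y (phi (t - y))%:E <=
    \int[nu]_y ((l + e)%:E * (\1_I1 y)%:E + C%:E * (\1_I2 y)%:E))%E.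
  apply: intle => //; [by apply: nnmeasD; apply: scal|move=> y].
  rewrite -!EFinM -!EFinD lee_fin i1E i2E.
  have /andP[p0 pC] := phi_bnd (t - y).
  case: (leP y t) => yt /=; last by rewrite andbF /= !mulr0 phi_lt0; lra.
  rewrite andbT; case: (ltP (t - A) y) => yA /=; rewrite ?mulr1 ?mulr0; first by lra.
  by have /andP[] := HA (t - y) (ltac:(lra)); lra.
rewrite intD; [|exact: scal|exact: scal].
rewrite int1// int2//.
have -> : (\int[nu]_y (phi (t - y))%:E = (convr t)%:E)%E by exact: convrE.
by rewrite -!EFinD lee_fin; lra.
Qed.

(** In convr_bounds the mass of the last stretch is o(t^p) by asymp_diff. *)
Lemma asymp_conv p c : 0 <= c -> asymp p V c -> asymp p convr (l * c).
Proof.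
move=> c0 Vc e e0; have l0' := l0.
pose e1 := e / (2 * (c + 1)).
have C0 : 0 <= C by have /andP[] := phi_bnd 0; exact: le_trans.
have e10 : 0 < e1 by apply: divr_gt0 => //; lra.
have e20' : 0 < e / (4 * (l + 1 + C + l + e1)) by apply: divr_gt0 => //; lra.
have d0 := e20'.
have dE : (e / (4 * (l + 1 + C + l + e1))) * (4 * (l + 1 + C + l + e1)) = e.
  by rewrite divfK// lt0r_neq0//; lra.
have e1E : e1 * (2 * (c + 1)) = e by rewrite divfK// lt0r_neq0//; lra.
move: (e / (4 * (l + 1 + C + l + e1))) d0 dE => d d0 dE; clear e20'.
have [A A0 HA] := convr_bounds e10.
have [T1 HT1] := Vc _ d0.
have [T2 HT2] := asymp_diff A Vc d0.
exists (Num.max 0 (Num.max T1 T2)) => t; rewrite !ge_max => /and3P[t0 /HT1 h1 /HT2 h2].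
have P0 : 0 <= t ^+ p by exact: exprn_ge0.
move: (t ^+ p) h1 h2 P0 => Q h1 h2 Q0.
have /andP[lo up] := HA t.
have VA : 0 <= V t - V (t - A) by rewrite subr_ge0; apply: cdf_homo; lra.
move: h2; rewrite mul0r subr0 ger0_norm// => h2.
move: h1; rewrite ler_norml => /andP[h1 h1'].
move: (V t - V (t - A)) lo up VA h2 => D lo up VA h2.
have k1 : l * V t <= l * (c * Q + d * Q) by apply: ler_wpM2l => //; lra.
have k2 : l * (c * Q - d * Q) <= l * V t by apply: ler_wpM2l => //; lra.
have k3 : e1 * V t <= e1 * (c * Q + d * Q) by apply: ler_wpM2l; lra.
have k4 : C * D <= C * (d * Q) by apply: ler_wpM2l.
have k5 : l * D <= l * (d * Q) by apply: ler_wpM2l.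
have q1 : e1 * (2 * (c + 1)) * Q = e * Q by rewrite e1E.
have q2 : d * (4 * (l + 1 + C + l + e1)) * Q = e * Q by rewrite dE.
have n1 : 0 <= e1 * Q by apply: mulr_ge0 => //; lra.
have n2 : 0 <= d * Q by apply: mulr_ge0 => //; lra.
have n3 : 0 <= l * (d * Q) by apply: mulr_ge0.
have n4 : 0 <= C * (d * Q) by apply: mulr_ge0.
have n5 : 0 <= e1 * (d * Q) by apply: mulr_ge0 => //; lra.
have n6 : 0 <= c * (e1 * Q) by apply: mulr_ge0.
rewrite ler_norml; apply/andP; split; lra.
Qed.

End conv_asymptotics.

Section renewal_of_perturbed.
Context {R : realType}.
Variables mu la : probability R R.
Hypothesis mu_pos : (mu `]-oo, 0%R]%classic = 0)%E.
Hypothesis la_pos : (la `]-oo, 0%R]%classic = 0)%E.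
Hypothesis mu_nonlattice : nonlattice mu.
Variable m : R.
Hypothesis mu_mean : (\int[mu]_(y in `]0%R, +oo[) y%:E = m%:E)%E.

Let U := renewal mu.
Let H := @heaviside R.

Lemma delayed_le t : (conv la (potential mu H) t <= (U t)%:E)%E.
Proof.
have HU : nnmeas (potential mu H) by apply: nnmeas_potential; exact: heaviside_nnmeas.
rewrite /conv (integral_Rpos la_pos); last exact: nnmeas_subl.
have -> : ((U t)%:E = \int[la]_(y in `]0%R, +oo[) (U t)%:E)%E.
  rewrite integral_cst//.
  by rewrite [X in (_ * X)%E](_ : _ = 1%E) ?mule1//; exact: (mu_RposE la_pos).
have [mU U0] := nnmeas_subl t HU.
apply: ge0_le_integral => //.
- by apply: measurable_funTS.
- move=> y /=; rewrite in_itv/= andbT => y0; rewrite renewalE// lee_fin.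
  by apply: renewal_homo => //; lra.
Qed.

(** The renewal function of the walk started from a random point of law la. *)
Definition delayed t := fine (conv la (potential mu H) t).

Lemma delayedE t : conv la (potential mu H) t = (delayed t)%:E.
Proof.
rewrite fineK// ge0_fin_numE; first exact: le_lt_trans (delayed_le t) (ltry _).
by have [_] := nnmeas_conv la (nnmeas_potential mu (@heaviside_nnmeas R)).
Qed.

Lemma delayed_ge0 t : 0 <= delayed t.
Proof. 
by rewrite -lee_fin -delayedE; have [_] := nnmeas_conv la (nnmeas_potential mu (@heaviside_nnmeas R)).
Qed.

Lemma delayed_lt0 t : t < 0 -> delayed t = 0.
Proof.
move=> t0; apply/eqP; rewrite eq_le delayed_ge0 andbT -lee_fin -delayedE.
by rewrite -(renewal_lt0 mu_pos t0); exact: delayed_le.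
Qed.

Definition increment (h t : R) := delayed t - delayed (t - h).

Lemma incrementE h t : 0 <= h ->
  conv la (fun s => (U s - U (s - h))%:E) t = (increment h t)%:E.
Proof.
move=> h0; have HU : nnmeas (potential mu H) by apply: nnmeas_potential; exact: heaviside_nnmeas.
have HW : nnmeas (fun s => (U s - U (s - h))%:E).
  have [mW W0] := nnmeas_potential mu (window_nnmeas 0%R h).
  split; last by move=> s; rewrite lee_fin subr_ge0; apply: renewal_homo => //; lra.
  rewrite (_ : (fun s => _) = potential mu (fun x => (\1_(`[0%R, h[%classic) x)%:E))//.
  by apply/funext => s; rewrite -windowE.
have : (conv la (potential mu H) t = conv la (fun s => (U s - U (s - h))%:E) t +
    conv la (potential mu H) (t - h))%E.
  rewrite -conv_shift -convD//; last exact: nnmeas_subr.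
  by apply: eq_integral => y _; rewrite !renewalE// -EFinD; congr EFin; rewrite /U; ring.
by rewrite !delayedE => E; rewrite EFinB E addeK.
Qed.

Lemma increment_itv h t : 0 <= h -> 0 <= increment h t <= U h.
Proof.
move=> h0; have W0 s : 0 <= U s - U (s - h).
  by rewrite subr_ge0; apply: renewal_homo => //; lra.
apply/andP; split; rewrite -lee_fin -incrementE//.
  by apply: integral_ge0 => y _; rewrite lee_fin.
rewrite -[leRHS](conv_cst la (U h) t).
have [mW _] := nnmeas_potential mu (window_nnmeas 0%R h).
have HW : nnmeas (fun s => (U s - U (s - h))%:E).
  split; last by move=> s; rewrite lee_fin.
  rewrite (_ : (fun s => _) = potential mu (fun x => (\1_(`[0%R, h[%classic) x)%:E))//.
  by apply/funext => s; rewrite -windowE.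
apply: le_conv => //.
  by apply: nnmeas_cst; rewrite lee_fin; exact: renewal_ge0.
by move=> x; rewrite lee_fin; exact: renewal_incr.
Qed.

Lemma increment_lt0 h t : 0 <= h -> t < 0 -> increment h t = 0.
Proof. by move=> h0 t0; rewrite /increment !delayed_lt0 ?subrr//; lra. Qed.

Lemma measurable_delayed : measurable_fun setT delayed.
Proof.
apply/measurable_EFinP; rewrite (_ : _ \o _ = conv la (potential mu H)).
  by have [] := nnmeas_conv la (nnmeas_potential mu (@heaviside_nnmeas R)).
by apply/funext => t; rewrite delayedE.
Qed.

Lemma measurable_increment h : measurable_fun setT (increment h).
Proof.
apply: measurable_funB; first exact: measurable_delayed.
by apply: measurableT_comp; [exact: measurable_delayed|exact: measurable_funB].
Qed.

(** Given the starting point this is Blackwell's theorem; the case p = 0 of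
asymp_conv, for the distribution function of la, is the required dominated
convergence. *)
Lemma increment_blackwell h : 0 < h -> asymp 0 (increment h) (h / m).
Proof.
move=> h0; have m0 := mean_gt0 mu_pos mu_mean.
have W0 s : 0 <= U s - U (s - h) <= U h.
  by rewrite subr_ge0 renewal_incr ?(ltW h0)// renewal_homo//; lra.
pose Vla t := fine (la `]-oo, t]%classic).
have VE t : (la `]-oo, t]%classic = (Vla t)%:E)%E.
  by rewrite fineK// fin_num_measure//; exact: measurable_itv.
have mU : measurable_fun setT (fun s : R => U s - U (s - h)).
  have mUU : measurable_fun setT U by apply: nondecreasing_measurable => // x y; exact: renewal_homo.
  apply: measurable_funB => //.
  by apply: measurableT_comp => //; exact: measurable_funB.
have Wlt0 s : s < 0 -> U s - U (s - h) = 0.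
  by move=> s0; rewrite /U !renewal_lt0 ?subrr//; lra.
have Vla1 : asymp 0 Vla 1.
  move=> e e0; have [A HA] := prob_tail la e0; exists A => t At.
  rewrite expr0 !mulr1 ler_norml; apply/andP; split; last first.
    suff : Vla t <= 1 by lra.
    by rewrite -lee_fin -VE probability_le1//; exact: measurable_itv.
  have : (la `]A, +oo[%classic + la `]-oo, A]%classic = 1)%E.
    have -> : `]-oo, A]%classic = ~` `]A, +oo[%classic :> set R by rewrite setCitvr.
    rewrite probability_setC; last exact: measurable_itv.
    by rewrite addeC subeK// fin_num_measure//; exact: measurable_itv.
  rewrite VE => E; have : (1 <= e%:E + (Vla A)%:E)%E by rewrite -E leeD2r.
  rewrite -EFinD lee_fin.
  have : Vla A <= Vla t by exact: (cdf_homo VE).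
  lra.
have := asymp_conv VE mU W0 Wlt0 (renewal_blackwell mu_pos mu_nonlattice mu_mean h0)
  (divr_ge0 (ltW h0) (ltW m0)) ler01 Vla1.
rewrite mulr1; congr (asymp 0 _ _); apply/funext => t; apply: EFin_inj.
by rewrite -incrementE ?(ltW h0)// (convrE VE mU W0 Wlt0).
Qed.

End renewal_of_perturbed.

Section generations.
Context {R : realType}.
Variables mu la : probability R R.
Hypothesis mu_pos : (mu `]-oo, 0%R]%classic = 0)%E.
Hypothesis la_pos : (la `]-oo, 0%R]%classic = 0)%E.
Hypothesis mu_nonlattice : nonlattice mu.
Variable m : R.
Hypothesis mu_mean : (\int[mu]_(y in `]0%R, +oo[) y%:E = m%:E)%E.
Variable nu : nat -> {measure set R -> \bar R}.
Hypothesis nu0 : forall t, (nu 0%N `]-oo, t]%classic = heaviside t)%E.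
Hypothesis nu_lt0 : forall j, (nu j `]-oo, 0%R[%classic = 0)%E.
Hypothesis nuS : forall j t,
  (nu j.+1 `]-oo, t]%classic = conv (nu j) (conv la (potential mu (@heaviside R))) t)%E.

Let D := delayed mu la.

Lemma delayed_homo : {homo D : x y / x <= y}.
Proof.
move=> x y xy; rewrite -subr_ge0.
have xy0 : 0 <= y - x by rewrite subr_ge0.
have /andP[+ _] := increment_itv mu_pos la_pos y xy0.
by rewrite /increment (_ : y - (y - x) = x); last by ring.
Qed.

Lemma conv_delayed j t :
  conv (nu j) (conv la (potential mu (@heaviside R))) t = conv (nu j) (fun s => (D s)%:E) t.
Proof. by apply: eq_integral => y _; rewrite (delayedE mu_pos la_pos). Qed.

Lemma generation_fin j t : (nu j `]-oo, t]%classic < +oo)%E.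
Proof.
elim: j t => [|j IH] t; first by rewrite nu0 ltry.
rewrite nuS conv_delayed.
have mD : measurable_fun setT (fun y : R => (D (t - y))%:E).
  apply/measurable_EFinP; apply: measurableT_comp; last exact: measurable_subl.
  exact: (measurable_delayed mu_pos la_pos).
have D0 s : 0 <= D s by exact: (delayed_ge0 mu_pos la_pos).
rewrite /conv (@ge0_negligible_integral _ _ _ (nu j) setT `]-oo, 0%R[%classic)//; last first.
  by move=> y _; rewrite lee_fin.
have -> : setT `\` `]-oo, 0%R[%classic = `[0%R, +oo[%classic :> set R.
  by rewrite setTD setCitvl.
apply: (@le_lt_trans _ _ ((D t)%:E * nu j `]-oo, t]%classic)%E); last first.
  by rewrite lte_mul_pinfty ?lee_fin ?ltry//; exact: IH.
rewrite -(integral_scale_indic (nu j) (D0 t)); last exact: measurable_itv.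
have mI : measurable_fun setT (fun y : R => ((D t)%:E * (\1_(`]-oo, t]%classic) y)%:E)%E).
  by apply/measurable_EFinP; apply: measurable_funM => //; exact: measurable_indic.
apply: (@le_trans _ _ (\int[nu j]_(y in `[0%R, +oo[) ((D t)%:E * (\1_(`]-oo, t]%classic) y)%:E))%E).
  apply: ge0_le_integral => //.
  - by move=> y _; rewrite lee_fin.
  - by apply: measurable_funTS.
  - by apply: measurable_funTS.
  - move=> y /=; rewrite in_itv/= andbT => y0.
    rewrite -EFinM lee_fin indicE mem_setE in_itv/=.
    case: (leP y t) => yt; last by rewrite mulr0 /D (delayed_lt0 mu_pos la_pos)// subr_lt0.
    by rewrite mulr1; apply: delayed_homo; lra.
apply: ge0_subset_integral => //; last by move=> y _; rewrite -EFinM lee_fin mulr_ge0.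
Qed.

Definition generation j t := fine (nu j `]-oo, t]%classic).

Lemma generationE j t : (nu j `]-oo, t]%classic = (generation j t)%:E)%E.
Proof. by rewrite fineK// ge0_fin_numE// generation_fin. Qed.

Lemma generation_incr j h t : 0 <= h ->
  conv (nu j) (fun s => (increment mu la h s)%:E) t =
  (generation j.+1 t - generation j.+1 (t - h))%:E.
Proof.
move=> h0.
have mD c : measurable_fun setT (fun y : R => (D (t - y - c))%:E).
  apply/measurable_EFinP.
  rewrite (_ : (fun y => _) = D \o (fun y => t - c - y)).
    by apply: measurableT_comp (measurable_subl _); exact: (measurable_delayed mu_pos la_pos).
  by apply/funext => y /=; rewrite addrAC.
have : (conv (nu j) (fun s => (D s)%:E) t =
    conv (nu j) (fun s => (increment mu la h s)%:E) t + conv (nu j) (fun s => (D s)%:E) (t - h))%E.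
  have -> : conv (nu j) (fun s => (D s)%:E) (t - h) = (\int[nu j]_y (D (t - y - h))%:E)%E.
    by apply: eq_integral => y _; rewrite addrAC.
  rewrite /conv -ge0_integralD//.
  - by apply: eq_integral => y _; rewrite -EFinD; congr EFin; rewrite /increment /D; ring.
  - by move=> y _; rewrite lee_fin; case/andP: (increment_itv mu_pos la_pos (t - y) h0).
  - apply/measurable_EFinP; apply: measurableT_comp; last exact: measurable_subl.
    exact: (measurable_increment mu_pos la_pos).
  - by move=> y _; rewrite lee_fin (delayed_ge0 mu_pos la_pos).
by rewrite -!conv_delayed -!nuS !generationE => E; rewrite EFinB E addeK.
Qed.

Definition rate j : R := (j`!%:R * m ^+ j)^-1.

Lemma rate_ge0 j : 0 <= rate j.
Proof.
have m0 := mean_gt0 mu_pos mu_mean.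
by rewrite invr_ge0 mulr_ge0// exprn_ge0// ltW.
Qed.

(** The increments of generation j + 1 are those of generation 1, of limit
h / m, convolved with the measure of generation j. *)
Lemma generation_conv_asymp j h : 0 < h -> asymp j (generation j) (rate j) ->
  asymp j (fun t => generation j.+1 t - generation j.+1 (t - h)) (h * rate j / m).
Proof.
move=> h0 Vj; have m0 := mean_gt0 mu_pos mu_mean.
have hb s := increment_itv mu_pos la_pos s (ltW h0).
have hl s := increment_lt0 mu_pos la_pos (ltW h0) (t := s).
have mi := measurable_increment mu_pos la_pos h.
have := asymp_conv (generationE j) mi hb hl
  (increment_blackwell mu_pos la_pos mu_nonlattice mu_mean h0)
  (divr_ge0 (ltW h0) (ltW m0)) (rate_ge0 j) Vj.
rewrite mulrAC; congr (asymp j _ _); apply/funext => t; apply: EFin_inj.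
by rewrite -generation_incr ?(ltW h0)// (convrE (generationE j) mi hb hl).
Qed.

(** The unit increments of generation j + 1 are of order rate j / m * t ^ j, and
summation divides by j + 1. *)
Theorem generation_asymp j : asymp j (generation j) (rate j).
Proof.
have m0 := mean_gt0 mu_pos mu_mean.
elim: j => [|j IH].
  move=> e e0; exists 0 => t t0; rewrite /generation nu0 /heaviside.
  rewrite indicE mem_setE in_itv/= andbT t0 /= /rate fact0 !expr0 !mulr1 invr1 subrr normr0.
  exact: ltW.
have := asymp_sum _ _ (generation_conv_asymp ltr01 IH).
have -> : 1 * rate j / m / j.+1%:R = rate j.+1.
  rewrite /rate factS natrM exprS mul1r !invfM.
  by move: (j`!%:R^-1) (m ^- j) => a b; ring.
apply; last exact: (cdf_homo (generationE j.+1)).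
by rewrite mul1r divr_ge0 ?rate_ge0// ltW.
Qed.

Theorem generation_blackwell j h : 0 < h ->
  asymp j (fun t => generation j.+1 t - generation j.+1 (t - h)) (h * rate j / m).
Proof. by move=> h0; apply: generation_conv_asymp => //; exact: generation_asymp. Qed.

(** The increments of generation 1 are bounded, so those of generation j + 1
are at most a multiple of generation j at the later time t. The uniformity in s
dominates the series in the key renewal theorem. *)
Lemma generation_incr_bound j h : 0 < h -> exists C T, forall t s, T <= t -> s <= t ->
  generation j.+1 s - generation j.+1 (s - h) <= C * t ^+ j.
Proof.
move=> h0; have U0 : 0 <= renewal mu h by exact: renewal_ge0.
have [T HT] := generation_asymp j (@ltr01 R).
exists (renewal mu h * (rate j + 1)), T => t s /HT; rewrite ler_norml => /andP[_ Vt] st.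
have hb x := increment_itv mu_pos la_pos x (ltW h0).
have hl x := increment_lt0 mu_pos la_pos (ltW h0) (t := x).
have mi := measurable_increment mu_pos la_pos h.
have := conv_le_bound (generationE j) mi hb hl s.
rewrite generation_incr ?(ltW h0)// lee_fin => /le_trans; apply.
rewrite -mulrA; apply: ler_wpM2l => //.
have : generation j s <= generation j t by exact: (cdf_homo (generationE j)).
lra.
Qed.

End generations.

(** * The key renewal theorem *)

(** The integral of a nonnegative function is a supremum over the simple
functions below it, so that it is monotone even without measurability. A
directly Riemann integrable function need not be Borel measurable. *)
Lemma le_lower_integral d (T : measurableType d) (R : realType)
    (mu : {measure set T -> \bar R}) (D : set T) (f g : T -> \bar R) :
  (forall x, D x -> 0 <= f x <= g x)%E ->
  (\int[mu]_(x in D) f x <= \int[mu]_(x in D) g x)%E.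
Proof.
move=> fg.
rewrite !ge0_integralE; last 2 first.
- by move=> x /fg/andP[f0 fg']; exact: le_trans f0 fg'.
- by move=> x /fg/andP[].
apply: le_ereal_sup => _ [h /= hf <-]; exists h => // x; apply: le_trans (hf x) _.
by rewrite !patchE; case: ifPn => // /set_mem/fg/andP[].
Qed.

Section step_integrals.
Context d (T : measurableType d) (R : realType) (mu : {measure set T -> \bar R}).
Variables (f : R -> R) (h : R) (s : T -> R) (D : set T) (a : nat -> R).
Hypothesis h0 : 0 < h.
Hypothesis f_ge0 : forall x, 0 <= x -> 0 <= f x.
Hypothesis ms : measurable_fun setT s.
Hypothesis mD : measurable D.
Hypothesis sD : forall y, D y -> 0 <= s y.
Hypothesis a_ge0 : forall n, 0 <= a n.

Let c n := [set y | n%:R * h <= s y < n.+1%:R * h].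

Let mc n : measurable (c n).
Proof.
have -> : c n = setT `&` s @^-1` `[(n%:R * h), (n.+1%:R * h)[%classic.
  by rewrite setTI; apply/seteqP; split => w; rewrite /c /= in_itv.
by apply: ms => //; exact: measurable_itv.
Qed.

Let cellc n y : cell h n (s y) = \1_(c n) y.
Proof. by rewrite cellE indicE mem_setE. Qed.

Lemma integral_le_steps :
  (forall n x, n%:R * h <= x < n.+1%:R * h -> f x <= a n) ->
  (\int[mu]_(y in D) (f (s y))%:E <= \sum_(0 <= n <oo) (a n)%:E * mu (c n))%E.
Proof.
move=> fa.
have t0 n y : (0 <= (a n)%:E * (\1_(c n) y)%:E)%E by rewrite -EFinM lee_fin mulr_ge0.
have mt n : measurable_fun setT (fun y : T => (a n)%:E * (\1_(c n) y)%:E)%E.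
  by apply/measurable_EFinP; apply: measurable_funM.
have -> : (\sum_(0 <= n <oo) (a n)%:E * mu (c n) =
    \int[mu]_y (\sum_(0 <= n <oo) (a n)%:E * (\1_(c n) y)%:E))%E.
  rewrite integral_nneseries//; apply: eq_eseriesr => n _.
  by rewrite integral_scale_indic.
apply: (@le_trans _ _ (\int[mu]_(y in D) (\sum_(0 <= n <oo) (a n)%:E * (\1_(c n) y)%:E))%E).
  apply: le_lower_integral => y Dy; rewrite lee_fin f_ge0 ?sD//=.
  pose N := (Num.truncn (s y / h)).
  have cN : N%:R * h <= s y < N.+1%:R * h.
    rewrite -ler_pdivlMr// -ltr_pdivrMr//; apply: truncn_itv.
    by rewrite divr_ge0 ?sD// ltW.
  apply: le_trans (nneseries_lim_ge N.+1 _) => //; rewrite big_nat_recr//=.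
  apply: (@le_trans _ _ ((a N)%:E * (\1_(c N) y)%:E)%E).
    by rewrite indicE mem_set// mule1 lee_fin fa.
  by rewrite leeDr// sume_ge0.
apply: ge0_subset_integral => //.
- by apply: ge0_emeasurable_sum => // n y _.
- by move=> y _; apply: nneseries_ge0.
Qed.

Lemma steps_le_integral N :
  (forall n x, n%:R * h <= x < n.+1%:R * h -> a n <= f x) ->
  (forall n, (n < N)%N -> c n `<=` D) ->
  (\sum_(0 <= n < N) (a n)%:E * mu (c n) <= \int[mu]_(y in D) (f (s y))%:E)%E.
Proof.
move=> af cD.
have t0 n y : (0 <= (a n)%:E * (\1_(c n) y)%:E)%E by rewrite -EFinM lee_fin mulr_ge0.
have mt n : measurable_fun setT (fun y : T => (a n)%:E * (\1_(c n) y)%:E)%E.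
  by apply/measurable_EFinP; apply: measurable_funM.
have -> : (\sum_(0 <= n < N) (a n)%:E * mu (c n) =
    \int[mu]_(y in D) (\sum_(0 <= n < N) (a n)%:E * (\1_(c n) y)%:E))%E.
  rewrite ge0_integral_sum//; last by move=> n; apply: measurable_funTS.
  rewrite !big_nat; apply: eq_bigr => n /andP[_ nN].
  rewrite ge0_integralZl_EFin//; last by apply/measurable_EFinP; exact: measurable_indic.
  by rewrite integral_indic// (setIidl (cD _ nN)).
apply: le_lower_integral => y Dy; apply/andP; split; first by apply: sume_ge0.
have -> : (\sum_(0 <= n < N) (a n)%:E * (\1_(c n) y)%:E =
    (\sum_(0 <= n < N) a n * cell h n (s y))%:E)%E.
  by rewrite -sumEFin; apply: eq_bigr => n _; rewrite cellc EFinM.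
rewrite lee_fin; apply: lower_steps => //; first by apply: f_ge0; exact: sD.
by move=> n; exact: af.
Qed.

End step_integrals.

Section approximation.
Context {R : realType}.
Variable f : R -> R.
Hypothesis f_ge0 : forall x, 0 <= x -> 0 <= f x.
Hypothesis f_dRi : directly_Riemann_integrable f.

Let J := (\int[lebesgue_measure]_(y in `[0%R, +oo[) (f y)%:E)%E.

Let top (n : nat) (h : R) := ereal_sup [set (f y)%:E | y in `[(n%:R * h)%R, (n.+1%:R * h)%R[].
Let bot (n : nat) (h : R) := ereal_inf [set (f y)%:E | y in `[(n%:R * h)%R, (n.+1%:R * h)%R[].

Let cell_left n (h : R) : 0 < h -> n%:R * h <= n%:R * h < n.+1%:R * h.
Proof. by move=> h0; rewrite lexx ltr_pM2r// ltr_nat ltnSn. Qed.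

Let bot_ge0 n h : 0 < h -> (0 <= bot n h)%E.
Proof.
move=> h0; apply: le_ereal_inf_tmp => _ [y /= + <-]; rewrite in_itv/= => /andP[ny _].
by rewrite lee_fin f_ge0//; apply: le_trans ny; rewrite mulr_ge0// ltW.
Qed.

Let bot_le n h x : n%:R * h <= x < n.+1%:R * h -> (bot n h <= (f x)%:E)%E.
Proof. by move=> nx; apply: ge_ereal_inf; exists (f x)%:E => //; exists x => //=; rewrite in_itv. Qed.

Let top_ge n h x : n%:R * h <= x < n.+1%:R * h -> ((f x)%:E <= top n h)%E.
Proof. by move=> nx; apply: ereal_sup_ubound; exists x => //=; rewrite in_itv. Qed.

Let bot_le_top n h : 0 < h -> (bot n h <= top n h)%E.
Proof.
move=> h0; have nh := cell_left n h0.
exact: le_trans (bot_le nh) (top_ge nh).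
Qed.

Let top_ge0 n h : 0 < h -> (0 <= top n h)%E.
Proof. by move=> h0; exact: le_trans (bot_ge0 n h0) (bot_le_top n h0). Qed.

(** Finiteness of the upper sum makes all suprema and infima over the cells
finite. *)
Lemma dRi_steps h : 0 < h -> exists a b : nat -> R, exists A B : R,
  [/\ forall n, 0 <= a n /\ 0 <= b n,
      forall n x, n%:R * h <= x < n.+1%:R * h -> b n <= f x <= a n,
      (\sum_(0 <= n <oo) (a n)%:E = A%:E)%E, (\sum_(0 <= n <oo) (b n)%:E = B%:E)%E &
      upper_sum f h = (h * A)%:E /\ lower_sum f h = (h * B)%:E].
Proof.
move=> h0; have [uoo _] := f_dRi.
have Soo : (\sum_(0 <= n <oo) top n h < +oo)%E.
  rewrite ltNge leye_eq; apply/negP => /eqP E.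
  by have := uoo _ h0; rewrite /upper_sum -/(top _ _) E gt0_muley ?lte_fin// ltxx.
have topoo n : (top n h < +oo)%E.
  apply: le_lt_trans Soo.
  apply: le_trans (nneseries_lim_ge n.+1 _); last by move=> *; exact: top_ge0.
  by rewrite big_nat_recr//= leeDr// sume_ge0// => *; exact: top_ge0.
have topE n : top n h = (fine (top n h))%:E by rewrite fineK// ge0_fin_numE// top_ge0.
have botE n : bot n h = (fine (bot n h))%:E.
  by rewrite fineK// ge0_fin_numE// ?bot_ge0//; exact: le_lt_trans (bot_le_top n h0) (topoo n).
have SaE : (\sum_(0 <= n <oo) top n h = (fine (\sum_(0 <= n <oo) top n h))%:E)%E.
  by rewrite fineK// ge0_fin_numE// nneseries_ge0// => *; exact: top_ge0.
have SbE : (\sum_(0 <= n <oo) bot n h = (fine (\sum_(0 <= n <oo) bot n h))%:E)%E.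
  rewrite fineK// ge0_fin_numE//; last by rewrite nneseries_ge0// => *; exact: bot_ge0.
  apply: le_lt_trans Soo; apply: lee_nneseries => n _; first by move=> _; exact: bot_ge0.
  exact: bot_le_top.
exists (fun n => fine (top n h)), (fun n => fine (bot n h)).
exists (fine (\sum_(0 <= n <oo) top n h)), (fine (\sum_(0 <= n <oo) bot n h)).
split.
- by move=> n; rewrite !fine_ge0 ?top_ge0 ?bot_ge0.
- move=> n x nx; rewrite -!lee_fin -topE -botE; apply/andP; split; [exact: bot_le|exact: top_ge].
- by rewrite -SaE; apply: eq_eseriesr => n _.
- by rewrite -SbE; apply: eq_eseriesr => n _.
- by rewrite !EFinM -SaE -SbE.
Qed.

(** The lower and upper sums enclose the integral, and their difference
vanishes with the span. *)
Lemma dRi_approximation : exists2 I : R, J = I%:E & 0 <= I /\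
  forall e, 0 < e -> exists2 h, 0 < h & exists a b : nat -> R, exists A B : R,
  [/\ forall n, 0 <= a n /\ 0 <= b n,
      forall n x, n%:R * h <= x < n.+1%:R * h -> b n <= f x <= a n,
      (\sum_(0 <= n <oo) (a n)%:E = A%:E)%E, (\sum_(0 <= n <oo) (b n)%:E = B%:E)%E &
      h * A <= I + e /\ I - e <= h * B].
Proof.
have sandwich h a b A B : 0 < h -> (forall n, 0 <= a n /\ 0 <= b n) ->
    (forall n x, n%:R * h <= x < n.+1%:R * h -> b n <= f x <= a n) ->
    (\sum_(0 <= n <oo) (a n)%:E = A%:E)%E -> (\sum_(0 <= n <oo) (b n)%:E = B%:E)%E ->
    ((h * B)%:E <= J <= (h * A)%:E)%E.
  move=> h0 ab0 fab AE BE.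
  pose cl (n : nat) := [set y : R | n%:R * h <= y < n.+1%:R * h].
  have cellm n : lebesgue_measure (cl n) = h%:E.
    rewrite (_ : cl n = `[(n%:R * h), (n.+1%:R * h)[%classic); last first.
      by apply/seteqP; split => y /=; rewrite in_itv.
    rewrite lebesgue_measure_itv/= lte_fin ltr_pM2r// ltr_nat ltnSn -EFinD.
    by congr EFin; rewrite -natr1; ring.
  have mD : measurable (`[0%R, +oo[%classic : set R) by exact: measurable_itv.
  have sD (y : R) : `[0%R, +oo[%classic y -> 0 <= y by rewrite /= in_itv/= andbT.
  have sumZ (c : nat -> R) (C : R) : (forall n, 0 <= c n) -> (\sum_(0 <= n <oo) (c n)%:E = C%:E)%E ->
      (\sum_(0 <= n <oo) ((c n)%:E * lebesgue_measure (cl n)) = (h * C)%:E)%E.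
    move=> c0 CE; rewrite EFinM -CE -nneseriesZl//.
      by apply: eq_eseriesr => n _; rewrite cellm muleC.
    by move=> n _; rewrite lee_fin.
  apply/andP; split; last first.
    rewrite -(sumZ a)//; last by move=> n; case: (ab0 n).
    apply: (@integral_le_steps _ _ _ lebesgue_measure f h idfun _ a) => //.
    - exact: measurable_id.
    - by move=> n; case: (ab0 n).
    - by move=> n x /fab/andP[].
  rewrite -(sumZ b)//; last by move=> n; case: (ab0 n).
  have b0 n : 0 <= b n by case: (ab0 n).
  apply: lime_le.
    by apply: is_cvg_nneseries => n _ _; rewrite cellm -EFinM lee_fin mulr_ge0// ltW.
  apply: nearW => N; apply: (@steps_le_integral _ _ _ lebesgue_measure f h idfun _ b) => //.
  - exact: measurable_id.
  - by move=> n x /fab/andP[].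
  - move=> n _ y /= /andP[ny _]; rewrite in_itv/= andbT; apply: le_trans ny.
    by rewrite mulr_ge0// ltW.
have JE : J = (fine J)%:E.
  have [a [b [A [B [ab0 fab AE BE _]]]]] := dRi_steps ltr01.
  have /andP[_ J1] := sandwich _ _ _ _ _ ltr01 ab0 fab AE BE.
  rewrite fineK// ge0_fin_numE; first exact: le_lt_trans J1 (ltry _).
  by apply: integral_ge0 => y /=; rewrite in_itv/= andbT lee_fin; exact: f_ge0.
exists (fine J) => //; split.
  apply: fine_ge0; apply: integral_ge0 => y /=; rewrite in_itv/= andbT lee_fin; exact: f_ge0.
move=> e e0; have [_ f0] := f_dRi.
have [h h0 he] : exists2 h, 0 < h & (upper_sum f h - lower_sum f h < e%:E)%E.
  have close : \forall h \near (0 : R)^'+, (upper_sum f h - lower_sum f h < e%:E)%E.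
    apply: (f0 [set x : \bar R | (x < e%:E)%E]).
    by apply: open_nbhs_nbhs; split => //; exact: open_ereal_lt_ereal.
  by have [h [h0 he]] := filter_ex (filterI (nbhs_right_gt 0) close); exists h.
exists h => //; have [a [b [A [B [ab0 fab AE BE [UE LE]]]]]] := dRi_steps h0.
exists a, b, A, B; split => //.
have := sandwich _ _ _ _ _ h0 ab0 fab AE BE; rewrite JE !lee_fin => /andP[h1 h2].
by move: he; rewrite UE LE -EFinB lte_fin => he; split; lra.
Qed.

End approximation.

Section key_renewal.
Context {R : realType}.
Variables (F : cumulative R R) (p : nat) (kappa : R).
Hypothesis kappa_ge0 : 0 <= kappa.
Hypothesis F_blackwell : forall h, 0 < h ->
  asymp p (fun t => F t - F (t - h)) (h * kappa).
Hypothesis F_bound : forall h, 0 < h -> exists C T, forall t s, T <= t -> s <= t ->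
  F s - F (s - h) <= C * t ^+ p.
Variable f : R -> R.
Hypothesis f_ge0 : forall x, 0 <= x -> 0 <= f x.
Hypothesis f_dRi : directly_Riemann_integrable f.

Let mu := lebesgue_stieltjes_measure F.
Let I t := (\int[mu]_(y in `[0%R, t]) (f (t - y))%:E)%E.

Lemma stieltjes_itv a b : a <= b -> mu `]a, b]%classic = (F b - F a)%:E.
Proof.
move=> ab; rewrite /mu /lebesgue_stieltjes_measure /measure_extension/=.
by rewrite measurable_mu_extE/= ?wlength_itv_bnd//; exact: is_ocitv.
Qed.

Let cellE (h t : R) (n : nat) : 0 < h ->
  mu [set y | n%:R * h <= t - y < n.+1%:R * h] = (F (t - n%:R * h) - F (t - n%:R * h - h))%:E.
Proof.
move=> h0; rewrite -stieltjes_itv; last by lra.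
congr (mu _); apply/seteqP; split => y /=; rewrite in_itv/= -natr1 mulrDl mul1r;
  by move=> /andP[? ?]; apply/andP; split; lra.
Qed.

Let mD t : measurable (`[0%R, t]%classic : set (measurableTypeR R)).
Proof. exact: measurable_itv. Qed.

Let ms t : measurable_fun setT (fun y : measurableTypeR R => t - y).
Proof. exact: (measurable_subl t). Qed.

Let sD t (y : R) : `[0%R, t]%classic y -> 0 <= t - y.
Proof. by rewrite /= in_itv/= => /andP[_]; rewrite subr_ge0. Qed.

Let incr_ge0 h s : 0 < h -> 0 <= F s - F (s - h).
Proof.
move=> h0; rewrite subr_ge0; apply: cumulative_is_nondecreasing; lra.
Qed.

(** For step functions of span h the integral is a sum of the increments of F
over ]t - (n + 1) h, t - n h], and each of them is h kappa t^p + o(t^p). From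
above, F_bound dominates the infinitely many terms; from below, a partial sum is
enough. *)
Theorem key_renewal : exists2 J : R,
  (\int[lebesgue_measure]_(y in `[0%R, +oo[) (f y)%:E)%E = J%:E & 0 <= J /\
  exists2 g : R -> R, (exists T, forall t, T <= t -> I t = (g t)%:E) & asymp p g (kappa * J).
Proof.
have k0 := kappa_ge0.
have [J JE [J0 approx]] := dRi_approximation f_ge0 f_dRi.
exists J => //; split => //.
have upper e : 0 < e -> exists T, forall t, T <= t -> (I t <= ((kappa * J + e) * t ^+ p)%:E)%E.
  move=> e0.
  have e10 : 0 < e / (2 * (kappa + 1)) by apply: divr_gt0 => //; lra.
  have e1E : e / (2 * (kappa + 1)) * (2 * (kappa + 1)) = e by rewrite divfK// lt0r_neq0//; lra.
  have [h h0 [a [b [A [B [ab0 fab AE _ [hA _]]]]]]] := approx _ e10.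
  have a0 n : 0 <= a n by case: (ab0 n).
  have [C [T0 HT0]] := F_bound h0.
  pose bb t n := (F (t - n%:R * h) - F (t - n%:R * h - h)) / t ^+ p.
  have aoo : (\sum_(0 <= n <oo) (a n)%:E < +oo)%E by rewrite AE ltry.
  have P0 (t : R) : 1 <= t -> 0 < t ^+ p by move=> t1; rewrite exprn_gt0//; lra.
  have c1 : exists T, forall t, T <= t -> 0 <= kappa * h /\ forall n, 0 <= bb t n <= C.
    exists (Num.max T0 1) => t; rewrite ge_max => /andP[tT t1]; split.
      by rewrite mulr_ge0// ltW.
    move=> n; rewrite /bb divr_ge0 ?incr_ge0 ?(ltW (P0 _ t1))//= ler_pdivrMr ?P0//.
    have nh : 0 <= n%:R * h by rewrite mulr_ge0// ltW.
    by apply: HT0 => //; lra.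
  have c2 n e' : 0 < e' -> exists T, forall t, T <= t -> bb t n <= kappa * h + e'.
    move=> e'0; have [T HT] := asymp_shift (n%:R * h) (F_blackwell h0) e'0.
    exists (Num.max T 1) => t; rewrite ge_max => /andP[/HT + t1].
    rewrite ler_norml => /andP[_ +]; rewrite /bb ler_pdivrMr ?P0//.
    by rewrite addrAC; lra.
  have [T HT] := limsup_series a0 aoo c1 c2 (divr_gt0 e0 (ltr0Sn R 1)).
  exists (Num.max T 1) => t; rewrite ge_max => /andP[/HT + t1].
  rewrite AE -EFinM -EFinD => ub.
  have : (I t <= \sum_(0 <= n <oo) ((a n)%:E * mu [set y | (n%:R * h <= t - y < n.+1%:R * h)%R]))%E.
    apply: (@integral_le_steps _ _ _ mu f h (fun y => t - y) _ a) => //.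
    - exact: sD.
    - by move=> n x /fab/andP[].
  move/le_trans; apply.
  have -> : (\sum_(0 <= n <oo) ((a n)%:E * mu [set y | (n%:R * h <= t - y < n.+1%:R * h)%R]) =
      (t ^+ p)%:E * \sum_(0 <= n <oo) (a n * bb t n)%:E)%E.
    rewrite -nneseriesZl; last first.
      move=> n _; rewrite lee_fin mulr_ge0// divr_ge0 ?incr_ge0//.
      by apply: ltW; exact: P0.
    apply: eq_eseriesr => n _; rewrite cellE// -!EFinM; congr EFin.
    by rewrite /bb mulrCA mulrC [t ^+ p * _]mulrC divfK ?lt0r_neq0 ?P0// mulrC.
  apply: le_trans (lee_wpmul2l _ ub) _; first by rewrite lee_fin ltW ?P0.
  rewrite -EFinM lee_fin mulrC; apply: ler_wpM2r; first exact: ltW (P0 _ t1).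
  have : kappa * (h * A) <= kappa * (J + e / (2 * (kappa + 1))) by apply: ler_wpM2l.
  move: (e / _) e1E e10 => e1 e1E e10.
  lra.
have lower e : 0 < e -> exists T, forall t, T <= t -> (((kappa * J - e) * t ^+ p)%:E <= I t)%E.
  move=> e0.
  have e10 : 0 < e / (4 * (kappa + 1)) by apply: divr_gt0 => //; lra.
  have e1E : e / (4 * (kappa + 1)) * (4 * (kappa + 1)) = e by rewrite divfK// lt0r_neq0//; lra.
  move: (e / _) e1E e10 => e1 e1E e10.
  have [h h0 [a [b [A [B [ab0 fab _ BE [_ hB]]]]]]] := approx _ e10.
  have b0 n : 0 <= b n by case: (ab0 n).
  have [N HN] : exists N, B - e1 / h <= \sum_(0 <= n < N) b n.
    have bc : (fun N => \sum_(0 <= n < N) (b n)%:E)%E @ \oo --> B%:E.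
      have : cvgn (fun N => \sum_(0 <= n < N) (b n)%:E)%E.
        by apply: is_cvg_nneseries => n _ _; rewrite lee_fin.
      by rewrite -BE.
    have eh : 0 < e1 / h by exact: divr_gt0.
    have near1 : \forall N \near \oo, ((B - e1 / h)%:E < \sum_(0 <= n < N) (b n)%:E)%E.
      apply: (bc [set x : \bar R | ((B - e1 / h)%:E < x)%E]).
      apply: open_nbhs_nbhs; split; first exact: open_ereal_gt_ereal.
      by rewrite /= lte_fin; lra.
    have [N] := filter_ex near1; rewrite sumEFin lte_fin => /ltW HN.
    by exists N.
  pose L t := \sum_(0 <= n < N) b n * (F (t - n%:R * h) - F (t - n%:R * h - h)).
  have HL : asymp p L ((\sum_(0 <= n < N) b n) * (h * kappa)).
    rewrite /L; elim: (N) => [|k IH].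
      move=> e' e'0; exists 0 => t t0; rewrite !big_geq// !mul0r subrr normr0.
      by apply: mulr_ge0; [exact: ltW|exact: exprn_ge0].
    rewrite big_nat_recr//= mulrDl.
    have := asymp_add IH (asymp_scale (b k) (asymp_shift (k%:R * h) (F_blackwell h0))).
    by congr (asymp _ _ _); apply/funext => t; rewrite big_nat_recr//=.
  have [T HT] := HL _ (divr_gt0 e0 (ltr0Sn R 1)).
  exists (Num.max T (Num.max 0 (N%:R * h))) => t; rewrite !ge_max => /and3P[/HT + t0 tN].
  rewrite ler_norml => /andP[lb _].
  have : (\sum_(0 <= n < N) ((b n)%:E * mu [set y | (n%:R * h <= t - y < n.+1%:R * h)%R]) <= I t)%E.
    apply: (@steps_le_integral _ _ _ mu f h (fun y => t - y) _ b) => //.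
    - exact: sD.
    - by move=> n x /fab/andP[].
    - move=> n nN y /= /andP[y1 y2]; rewrite in_itv/=.
      have : 0 <= n%:R * h by rewrite mulr_ge0// ltW.
      have : n.+1%:R * h <= N%:R * h by rewrite ler_pM2r// ler_nat.
      by move=> ? ?; apply/andP; split; lra.
  apply: le_trans.
  rewrite (eq_bigr (fun n => (b n * (F (t - n%:R * h) - F (t - n%:R * h - h)))%:E)); last first.
    by move=> n _; rewrite cellE.
  rewrite sumEFin lee_fin -/(L t).
  apply: le_trans (_ : ((\sum_(0 <= n < N) b n) * (h * kappa) - e / 2) * t ^+ p <= _); last first.
    by rewrite mulrBl; lra.
  apply: ler_wpM2r; first exact: exprn_ge0.
  have hk : 0 <= h * kappa by rewrite mulr_ge0// ltW.
  have := ler_wpM2r hk HN.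
  have -> : (B - e1 / h) * (h * kappa) = kappa * (h * B) - kappa * e1.
    by field; rewrite lt0r_neq0.
  have := ler_wpM2l k0 hB.
  by lra.
have [T1 HT1] := upper 1 ltr01.
have fin t : Num.max T1 0 <= t -> I t = (fine (I t))%:E.
  rewrite ge_max => /andP[/HT1 It _]; rewrite fineK// ge0_fin_numE.
    exact: le_lt_trans It (ltry _).
  by apply: integral_ge0 => y yt; rewrite lee_fin; apply: f_ge0; exact: sD.
exists (fun t => fine (I t)); first by exists (Num.max T1 0).
move=> e e0; have [T2 HT2] := upper e e0; have [T3 HT3] := lower e e0.
exists (Num.max (Num.max T1 0) (Num.max T2 T3)) => t.
rewrite ge_max => /andP[/fin tE]; rewrite ge_max => /andP[/HT2 + /HT3].
by rewrite tE !lee_fin ler_norml => ? ?; apply/andP; split; lra.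
Qed.

End key_renewal.

Local Open Scope ereal_scope.

(** * Independence *)

Lemma measurable_preim d d' (T : measurableType d) (T' : measurableType d')
  (f : T -> T') (B : set T') : measurable_fun setT f -> measurable B -> measurable (f @^-1` B).
Proof. by move=> mf mB; rewrite -[X in measurable X]setTI; exact: mf. Qed.

Section independence.
Context d (Omega : measurableType d) (R : realType).
Variable P : probability Omega R.

Section two_variables.
Context d1 d2 (E1 : measurableType d1) (E2 : measurableType d2).

Definition indep2 (X : Omega -> E1) (Y : Omega -> E2) :=
  forall A B, measurable A -> measurable B ->
    P (X @^-1` A `&` Y @^-1` B) = P (X @^-1` A) * P (Y @^-1` B).

(** In C, both sides are finite measures, and they agree on rectangles. *)
Lemma indep_event_prod (X : {mfun Omega >-> E1}) (Y : {mfun Omega >-> E2}) (E : set Omega) :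
  measurable E ->
  (forall A B, measurable A -> measurable B ->
    P ((X @^-1` A `&` Y @^-1` B) `&` E) = P (X @^-1` A `&` Y @^-1` B) * P E) ->
  forall C : set (E1 * E2), measurable C ->
    P ((fun w => (X w, Y w)) @^-1` C `&` E) = P ((fun w => (X w, Y w)) @^-1` C) * P E.
Proof.
move=> mE rect C mC; pose Z := fun w => (X w, Y w).
have mZ : measurable_fun setT Z by exact: measurable_fun_pair.

pose Z' : {mfun Omega >-> (E1 * E2)%type} := mfun_Sub (mem_set mZ).
pose m0 : {measure set (E1 * E2)%type -> \bar R} := pushforward (mrestr P mE) Z.
pose m1 : {measure set (E1 * E2)%type -> \bar R} := m0 mZ.
have PE0 : (0 <= fine (P E))%R by exact: fine_ge0.
pose m2 : {measure set (E1 * E2)%type -> \bar R} := mscale (NngNum PE0) (distribution P Z').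
have PEE : P E = (fine (P E))%:E by rewrite fineK// fin_num_measure.
suff : m1 C = m2 C.
  by rewrite /m1 /m0 /m2 /= /pushforward /mrestr /mscale /= -PEE muleC.
pose G : set (set (E1 * E2)) :=
  [set C | exists A, measurable A /\ exists B, measurable B /\ C = A `*` B].
apply: (measure_unique G (fun n => setT)) => //.
- rewrite measurable_prod_measurableType //; congr (<<s _ >>).
  rewrite predeqE; split => [[A mA [B mB <-]]|[A [mA [B [mB ->]]]]].
    by exists A; split => //; exists B.
  by exists A => //; exists B.
- move=> /= _ _ [X1 [mX1 [X2 [mX2 ->]]]] [Y1 [mY1 [Y2 [mY2 ->]]]].
  rewrite -setXI; exists (X1 `&` Y1); split; first exact: measurableI.
  by exists (X2 `&` Y2); split => //; exact: measurableI.
- move=> n; exists setT; split => //; exists setT; split => //; exact/esym/setXTT.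
- by apply/seteqP; split => // x _; exists 0%N.
- move=> _ [A [mA [B [mB ->]]]].
  rewrite /m1 /m0 /m2 /= /pushforward /mrestr /mscale /= -PEE muleC -rect//.
- move=> n; rewrite /m1 /m0 /= /pushforward /mrestr /= preimage_setT setTI.
  by rewrite -ge0_fin_numE// fin_num_measure.
Qed.

Lemma indep2_joint (X : {mfun Omega >-> E1}) (Y : {mfun Omega >-> E2}) :
  indep2 X Y -> forall C : set (E1 * E2), measurable C ->
  P ((fun w => (X w, Y w)) @^-1` C) = (distribution P X \x distribution P Y) C.
Proof.
move=> XY C mC.
have mZ : measurable_fun setT (fun w => (X w, Y w)) by exact: measurable_fun_pair.
pose Z' : {mfun Omega >-> (E1 * E2)%type} := mfun_Sub (mem_set mZ).
by apply/esym/(product_measure_unique (m' := distribution P Z')).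
Qed.

End two_variables.

Definition cdfm (mu : set R -> \bar R) (t : R) := mu `]-oo, t]%classic.

(** Fubini's theorem for the joint law, which is the product of the laws. *)
Lemma cdfm_sum (X Y : {mfun Omega >-> R}) t : indep2 X Y ->
  P [set w | (X w + Y w <= t)%R] = conv (distribution P X) (cdfm (distribution P Y)) t.
Proof.
move=> XY; pose C : set (R * R) := [set z | (z.1 + z.2 <= t)%R].
have mC : measurable C.
  have m : measurable_fun setT (fun z : R * R => (z.1 + z.2)%R) by exact: measurable_funD.
  have -> : C = (fun z : R * R => (z.1 + z.2)%R) @^-1` `]-oo, t]%classic.
    by apply/seteqP; split => z /=; rewrite in_itv.
  exact: (measurable_preim m (measurable_itv _)).
rewrite (_ : [set _ | _] = (fun w => (X w, Y w)) @^-1` C)// indep2_joint//.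
rewrite /product_measure1 /=; apply: eq_integral => x _.
congr (distribution P Y _); apply/seteqP; split => y; rewrite /xsection /=.
  by rewrite inE /C /= in_itv/=; lra.
by rewrite in_itv/= inE /C /=; lra.
Qed.

End independence.

Section mutual_independence.
Context d (Omega : measurableType d) (R : realType).
Variable P : probability Omega R.

Lemma mutually_independent_comp d1 d2 (E : measurableType d1) (E' : measurableType d2)
    (I : choiceType) (Z : I -> Omega -> E) (g : I -> E -> E') :
  (forall i, measurable_fun setT (g i)) -> mutually_independent P Z ->
  mutually_independent P (fun i w => g i (Z i w)).
Proof.
move=> mg indZ J B mB.
exact: (indZ J (fun i => g i @^-1` B i) (fun i => measurable_preim (mg i) (mB i))).
Qed.

(** The terms join the sum one at a time. Carrying along an event on the other
variables is what makes the induction work: for the new term it provides the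
product rule on rectangles that indep_event_prod asks for. *)
Lemma indep_sum_event (I : choiceType) (X : I -> {mfun Omega >-> R}) (s : seq I) :
  mutually_independent P (fun i => X i : Omega -> R) -> uniq s ->
  forall (J : {fset I}) (A : set R) (B : I -> set R),
  {in s, forall i, i \notin J} -> measurable A -> (forall i, measurable (B i)) ->
  P ([set w | A (\sum_(i <- s) X i w)%R] `&` \bigcap_(i in [set` J]) (X i @^-1` B i)) =
  P [set w | A (\sum_(i <- s) X i w)%R] * P (\bigcap_(i in [set` J]) (X i @^-1` B i)).
Proof.
move=> indX; elim: s => [_|i s IH /= /andP[is_ us]] J A B sJ mA mB.
  have [A0|nA0] := pselect (A 0%R).
    have -> : [set w | A (\sum_(i <- [::]) X i w)%R] = setT.
      by apply/seteqP; split => // w _ /=; rewrite big_nil.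
    by rewrite setTI [X in X * _]probability_setT mul1e.
  have -> : [set w | A (\sum_(i <- [::]) X i w)%R] = set0.
    by apply/seteqP; split => // w /=; rewrite big_nil.
  by rewrite set0I measure0 mul0e.
set E := \bigcap_(i in _) _.
have mE : measurable E.
  by apply: fin_bigcap_measurable => // k _; apply: measurable_preim.
have mS : measurable_fun setT (fun w => \sum_(k <- s) X k w)%R.
  by apply: measurable_sum => k; exact: measurable_funPT.
pose S : {mfun Omega >-> R} := mfun_Sub (mem_set mS).
have iJ : i \notin J by apply: sJ; rewrite mem_head.
have sJ' k : k \in s -> k \notin J by move=> ks; apply: sJ; rewrite in_cons ks orbT.
have IHS (A' : set R) (J' : {fset I}) (B' : I -> set R) : {in s, forall k, k \notin J'} -> measurable A' ->
    (forall k, measurable (B' k)) ->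
    P (S @^-1` A' `&` \bigcap_(k in [set` J']) (X k @^-1` B' k)) =
    P (S @^-1` A') * P (\bigcap_(k in [set` J']) (X k @^-1` B' k)).
  move=> sJ1 mA' mB'; have := IH us J' A' B' sJ1 mA' mB'.
  by [].
pose B1 (A1 : set R) k := if k == i then A1 else B k.
have mB1 A1 : measurable A1 -> forall k, measurable (B1 A1 k).
  by move=> mA1 k; rewrite /B1; case: ifP.
have cap1 A1 : \bigcap_(k in [set` (i |` J)%fset]) (X k @^-1` B1 A1 k) = X i @^-1` A1 `&` E.
  apply/seteqP; split => w /=.
    move=> H; split.
      by have := H i; rewrite /B1 /= eqxx; apply; rewrite !inE eqxx.
    move=> k /= kJ; have := H k; rewrite /B1 /=; case: eqP => [ki|_]; last first.
      by apply; rewrite !inE kJ orbT.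
    by move: iJ; rewrite -ki kJ.
  move=> [Hi HE] k /=; rewrite !inE /B1 => /orP[/eqP->|kJ]; first by rewrite eqxx.
  case: eqP => [ki|_]; last exact: HE.
  by move: iJ; rewrite -ki kJ.
have sJ1 : {in s, forall k, k \notin (i |` J)%fset}.
  move=> k ks; rewrite !inE negb_or sJ'// andbT; apply/eqP => ki.
  by move: is_; rewrite -ki ks.
have PXE A1 : measurable A1 -> P (X i @^-1` A1 `&` E) = P (X i @^-1` A1) * P E.
  move=> mA1; rewrite -cap1 (indX _ _ (mB1 _ mA1)) big_fsetU1//= /B1 eqxx.
  congr (_ * _); rewrite (indX _ _ mB); apply: eq_big_seq => k kJ.
  by case: eqP => // ki; move: iJ; rewrite -ki kJ.
have PXS A1 A2 : measurable A1 -> measurable A2 ->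
    P (X i @^-1` A1 `&` S @^-1` A2) = P (X i @^-1` A1) * P (S @^-1` A2).
  move=> mA1 mA2; rewrite setIC muleC.
  have := IHS A2 [fset i]%fset (fun=> A1) _ mA2 (fun=> mA1).
  rewrite (_ : \bigcap_(k in _) _ = X i @^-1` A1); last first.
    apply/seteqP; split => w /=; first by apply => /=; rewrite inE.
    by move=> h k /=; rewrite inE => /eqP ->.
  by apply => k ks; rewrite inE; apply/eqP => ki; move: is_; rewrite -ki ks.
have rect A1 A2 : measurable A1 -> measurable A2 ->
   P ((X i @^-1` A1 `&` S @^-1` A2) `&` E) = P (X i @^-1` A1 `&` S @^-1` A2) * P E.
  move=> mA1 mA2; rewrite [X in X `&` E]setIC -setIA -cap1 IHS//; last exact: mB1.
  by rewrite cap1 PXE// PXS// muleA [P (S @^-1` A2) * _]muleC.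
(* The pair (X i, S) is independent of E; apply this to the event X i + S \in A. *)
pose C : set (R * R) := [set z | A (z.1 + z.2)%R].
have mC : measurable C.
  have m : measurable_fun setT (fun z : R * R => (z.1 + z.2)%R) by exact: measurable_funD.
  exact: (measurable_preim m mA).
have := indep_event_prod mE rect mC.
have -> // : (fun w => (X i w, S w)) @^-1` C = [set w | A (\sum_(k <- i :: s) X k w)%R].
by apply/seteqP; split => w /=; rewrite /C /= big_cons.
Qed.

Lemma indep_sum_variable (I : choiceType) (X : I -> {mfun Omega >-> R}) (s : seq I) (j : I)
    (S : {mfun Omega >-> R}) :
  mutually_independent P (fun i => X i : Omega -> R) -> uniq s -> j \notin s ->
  (forall w, S w = \sum_(i <- s) X i w)%R -> indep2 P S (X j).
Proof.
move=> indX us js SE A B mA mB.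
have sj : {in s, forall i, i \notin [fset j]%fset}.
  by move=> i is_; rewrite inE; apply/eqP => ij; move: js; rewrite -ij is_.
have := indep_sum_event indX us sj mA (fun=> mB).
rewrite (_ : \bigcap_(k in _) _ = X j @^-1` B); last first.
  apply/seteqP; split => w /=; first by apply => /=; rewrite inE.
  by move=> h k /=; rewrite inE => /eqP ->.
have -> // : [set w | A (\sum_(k <- s) X k w)%R] = S @^-1` A.
by apply/seteqP; split => w /=; rewrite SE.
Qed.

End mutual_independence.

(** * Countable sums of measures *)

Lemma counting_esum (R : realType) (T : countType) (S : set T) :
  counting S = \esum_(u in [set: T]) (\1_S u)%:E :> \bar R.
Proof.
have pinj : {in S &, injective (@choice.pickle T)}.
  by move=> x y _ _; exact: (pcan_inj choice.pickleK).
have -> : \esum_(u in [set: T]) (\1_S u)%:E = counting (@choice.pickle T @` S) :> \bar R.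
  rewrite counting_dirac nneseries_esumT//.
  rewrite [LHS](_ : _ = \esum_(u in S) 1); last first.
    by rewrite [RHS]esum_mkcond; apply: eq_esum => u _; rewrite indicE; case: ifP.
  rewrite (_ : \esum_(n in [set: nat]) _ = \esum_(n in @choice.pickle T @` S) 1); last first.
    by rewrite [RHS]esum_mkcond; apply: eq_esum => n _; rewrite diracE; case: ifP.
  rewrite (reindex_esum S _ (@choice.pickle T))//.
  by split.
rewrite /counting; have [finS|infS] := pselect (finite_set S).
  have finpS : finite_set (@choice.pickle T @` S) by exact: finite_image.
  rewrite !asboolT// fset_set_image// card_in_imfset//= => x y.
  by move=> _ _; exact: (pcan_inj choice.pickleK).
rewrite !asboolF// => finpS; apply: infS.
apply: (@sub_finite_set _ _ (@choice.pickle T @^-1` (@choice.pickle T @` S))).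
  by move=> x Sx; exists x.
apply: finite_preimage => // x y _ _; exact: (pcan_inj choice.pickleK).
Qed.

(** Turns sums over individuals into series, for which integration term by
term is available. *)
Lemma esum_nneseries (R : realType) (T : countType) (a : T -> \bar R) :
  (forall u, 0 <= a u) ->
  \esum_(u in [set: T]) a u = \sum_(0 <= n <oo) oapp a 0 (choice.pickle_inv n).
Proof.
move=> a0; rewrite nneseries_esumT; last by move=> n; case: choice.pickle_inv => /=.
rewrite (_ : \esum_(n in [set: nat]) _ =
    \esum_(n in range (@choice.pickle T)) oapp a 0 (choice.pickle_inv n)); last first.
  rewrite [RHS]esum_mkcond; apply: eq_esum => n _; case: ifPn => //.
  rewrite notin_setE => nr; case E: (choice.pickle_inv n) => [x|]//=.
  by exfalso; apply: nr; exists x => //; have := @choice.pickle_invK T n; rewrite E.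
rewrite (reindex_esum setT _ (@choice.pickle T)).
  by apply: eq_esum => u _; rewrite choice.pickleK_inv.
by split => // x y _ _; exact: (pcan_inj choice.pickleK).
Qed.

Lemma integral_esum d (X : measurableType d) (R : realType) (T : countType)
    (mu : {measure set X -> \bar R}) (f : T -> X -> \bar R) :
  (forall u, measurable_fun setT (f u)) -> (forall u x, 0 <= f u x) ->
  \int[mu]_x (\esum_(u in [set: T]) f u x) = \esum_(u in [set: T]) \int[mu]_x f u x.
Proof.
move=> mf f0; rewrite esum_nneseries; last by move=> u; exact: integral_ge0.
under eq_integral do rewrite esum_nneseries//.
rewrite (@integral_nneseries _ _ _ mu setT measurableT
  (fun n x => oapp (fun u => f u x) 0 (choice.pickle_inv n))).
- by apply: eq_eseriesr => n _; case: choice.pickle_inv => //=; rewrite integral0.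
- by move=> n; case: choice.pickle_inv => [u|] //=; exact: measurable_cst.
- by move=> n x _; case: choice.pickle_inv => /=.
Qed.

Section sum_measure.
Context d (X : measurableType d) (R : realType) (T : countType).
Variable m_ : T -> {measure set X -> \bar R}.

Definition esum_measure : {measure set X -> \bar R} :=
  mseries (fun n => oapp m_ (mzero : {measure set X -> \bar R}) (choice.pickle_inv n)) 0.

Lemma esum_measureE A : esum_measure A = \esum_(u in [set: T]) m_ u A.
Proof.
rewrite esum_nneseries//; apply: eq_eseriesr => n _.
by case: choice.pickle_inv.
Qed.

Lemma integral_esum_measure (f : X -> \bar R) : measurable_fun setT f ->
  (forall x, 0 <= f x) ->
  \int[esum_measure]_x f x = \esum_(u in [set: T]) \int[m_ u]_x f x.
Proof.
move=> mf f0; rewrite ge0_integral_measure_series// esum_nneseries; last first.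
  by move=> u; exact: integral_ge0.
apply: eq_eseriesr => n _; case: choice.pickle_inv => [u|]//=.
exact: integral_measure_zero.
Qed.

End sum_measure.

(** * The branching process *)

Lemma measurable_coord (R : realType) (k : nat) :
  measurable_fun setT (fun x : realseq R => x k : R).
Proof.
move=> _ B mB; rewrite setTI; apply: sub_sigma_algebra; exists k, B; split => //.
Qed.

Lemma indep2C d (Omega : measurableType d) (R : realType) (P : probability Omega R)
  d1 d2 (E1 : measurableType d1) (E2 : measurableType d2) (X : Omega -> E1) (Y : Omega -> E2) :
  indep2 P X Y -> indep2 P Y X.
Proof. by move=> XY A B mA mB; rewrite setIC muleC; exact: XY. Qed.

Lemma eq_conv (R : realType) (m1 m2 : {measure set R -> \bar R}) (g : R -> \bar R) t :
  (forall B, measurable B -> m1 B = m2 B) -> conv m1 g t = conv m2 g t.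
Proof.
by move=> m12; apply: eq_measure_integral => B mB _; exact: m12.
Qed.

Lemma law_pos d (Omega : measurableType d) (R : realType) (P : probability Omega R)
  (X : {RV P >-> R}) : {ae P, forall w, (0 < X w)%R} ->
  distribution P X `]-oo, 0%R]%classic = 0.
Proof.
move=> Xpos; rewrite /distribution /pushforward.
apply/negligibleP; first exact: measurable_funPTI.
apply: negligibleS Xpos => w /=; rewrite in_itv/= => Xw0 Xw1.
by rewrite ltNge Xw0 in Xw1.
Qed.

Section branching.
Context d (Omega : measurableType d) (R : realType) (P : probability Omega R).
Variables (xi eta : {RV P >-> R}) (xi_ eta_ : nat -> {RV P >-> R}).
Variable T_ : seq nat -> {RV P >-> realseq R}.
Hypothesis xi_pos : {ae P, forall w, (0 < xi w)%R}.
Hypothesis eta_pos : {ae P, forall w, (0 < eta w)%R}.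
Hypothesis xi_eta_copies : independent_copies P
     (fun (i : nat) w => (xi_ i w, eta_ i w) : (R * R)%type)
     (fun w => (xi w, eta w) : (R * R)%type).
Hypothesis T_copies : independent_copies P
     (fun (u : seq nat) => T_ u : Omega -> realseq R)
     (perturbed_walk (fun i => xi_ i : Omega -> R) (fun i => eta_ i : Omega -> R)).

Let mu : probability R R := distribution P xi.
Let la : probability R R := distribution P eta.
Let H := @heaviside R.
Let T := fun u : seq nat => T_ u : Omega -> realseq R.

Let mu_pos : mu `]-oo, 0%R]%classic = 0. Proof. exact: law_pos. Qed.
Let la_pos : la `]-oo, 0%R]%classic = 0. Proof. exact: law_pos. Qed.

Lemma xi_law i B : measurable B -> distribution P (xi_ i) B = mu B.
Proof.
move=> mB; have [same _] := xi_eta_copies.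
have := same i (B `*` setT) (measurableX mB measurableT).
rewrite /mu /distribution /pushforward.
have -> : (fun w => (xi_ i w, eta_ i w)) @^-1` (B `*` setT) = xi_ i @^-1` B.
  by apply/seteqP; split => w //= [].
have -> // : (fun w => (xi w, eta w)) @^-1` (B `*` setT) = xi @^-1` B.
by apply/seteqP; split => w //= [].
Qed.

Lemma eta_law i B : measurable B -> distribution P (eta_ i) B = la B.
Proof.
move=> mB; have [same _] := xi_eta_copies.
have := same i (setT `*` B) (measurableX measurableT mB).
rewrite /la /distribution /pushforward.
have -> : (fun w => (xi_ i w, eta_ i w)) @^-1` (setT `*` B) = eta_ i @^-1` B.
  by apply/seteqP; split => w //= [].
have -> // : (fun w => (xi w, eta w)) @^-1` (setT `*` B) = eta @^-1` B.
by apply/seteqP; split => w //= [].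
Qed.

(** The k-th point of the perturbed walk is made of eta_ k and of the xi_ i with
i < k. As xi_ k and eta_ k may be dependent, eta_ k takes the place of xi_ k in
order to get an independent family containing all these terms. *)
Definition mixed (k i : nat) : {mfun Omega >-> R} := if i == k then eta_ k else xi_ i.

Lemma mixed_independent k : mutually_independent P (fun i => mixed k i : Omega -> R).
Proof.
have [_ ind] := xi_eta_copies.
pose g (i : nat) (z : R * R) := if i == k then z.2 else z.1.
have mg i : measurable_fun setT (g i).
  by rewrite /g; case: eqP => _; [exact: measurable_snd|exact: measurable_fst].
have := mutually_independent_comp mg ind; congr mutually_independent.
by apply/funext => i; apply/funext => w; rewrite /g /mixed; case: eqP => [->|].
Qed.

Lemma xi_independent : mutually_independent P (fun i => xi_ i : Omega -> R).
Proof.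
have [_ ind] := xi_eta_copies.
exact: (mutually_independent_comp (g := fun (i : nat) (z : R * R) => z.1)
  (fun=> measurable_fst) ind).
Qed.

Lemma measurable_walk k : measurable_fun setT (fun w => \sum_(i < k) xi_ i w)%R.
Proof. by apply: measurable_sum => i; exact: measurable_funPT. Qed.

Definition walk k : {mfun Omega >-> R} := mfun_Sub (mem_set (measurable_walk k)).

Lemma walkE k w : (walk k w = \sum_(i <- iota 0 k) xi_ i w)%R.
Proof. by rewrite /walk /= -(big_mkord xpredT (fun i => xi_ i w)) /index_iota subn0. Qed.

Lemma iota_notin k : k \notin iota 0 k.
Proof. by rewrite mem_iota add0n ltnn andbF. Qed.

Lemma walk_cdf k t : cdfm (distribution P (walk k)) t = iter k (conv mu) H t.
Proof.
have E k' t' : cdfm (distribution P (walk k')) t' = P [set w | (walk k' w <= t')%R].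
  by rewrite /cdfm /distribution /pushforward; congr (P _); apply/seteqP; split => w; rewrite /= in_itv.
elim: k t => [|k IH] t.
  rewrite E /= /H /heaviside indicE mem_setE in_itv/= andbT.
  have -> : [set w | (walk 0 w <= t)%R] = [set w | (0 <= t)%R].
    by apply/seteqP; split => w; rewrite /walk /= big_ord0.
  case: (leP 0%R t) => t0.
    rewrite (_ : [set _ | _] = setT); last by apply/seteqP; split.
    exact: probability_setT.
  rewrite (_ : [set _ | _] = set0) ?measure0//.
  by apply/seteqP; split.
rewrite E.
have -> : [set w | (walk k.+1 w <= t)%R] = [set w | (xi_ k w + walk k w <= t)%R].
  by apply/seteqP; split => w; rewrite /walk /= big_ord_recr/= addrC.
rewrite cdfm_sum; last first.
  apply: indep2C; apply: (indep_sum_variable xi_independent (iota_uniq 0 k) (iota_notin k)).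
  exact: walkE.
rewrite (eq_conv _ _ (xi_law k)) /=; congr (conv mu _ t).
by apply/funext => x; exact: IH.
Qed.

Definition point_cdf k t := conv la (iter k (conv mu) H) t.

Lemma perturbed_walk_cdf k t :
  P [set w | (perturbed_walk (fun i => xi_ i : Omega -> R) (fun i => eta_ i : Omega -> R) w k <= t)%R]
  = point_cdf k t.
Proof.
have -> : [set w | (perturbed_walk (fun i => xi_ i : Omega -> R) (fun i => eta_ i : Omega -> R) w k <= t)%R]
  = [set w | (eta_ k w + walk k w <= t)%R].
  by apply/seteqP; split => w; rewrite /perturbed_walk /walk /= addrC.
rewrite cdfm_sum; last first.
  apply: indep2C.
  have -> : eta_ k = mixed k k by rewrite /mixed eqxx.
  apply: (indep_sum_variable (mixed_independent k) (iota_uniq 0 k) (iota_notin k)) => w.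
  rewrite walkE; apply: eq_big_seq => i ik; rewrite /mixed; case: eqP => // ki.
  by move: (iota_notin k); rewrite -{1}ki ik.
rewrite (eq_conv _ _ (eta_law k)); congr (conv la _ t).
by apply/funext => x; exact: walk_cdf.
Qed.

Lemma measurable_point u k : measurable_fun setT (fun w => T_ u w k : R).
Proof.
apply: (measurableT_comp (@measurable_coord R k)); exact: measurable_funPT.
Qed.

Definition point u k : {mfun Omega >-> R} := mfun_Sub (mem_set (measurable_point u k)).

Lemma point_cdfE u k : cdfm (distribution P (point u k)) = point_cdf k.
Proof.
apply/funext => t; rewrite -perturbed_walk_cdf; have [same _] := T_copies.
have mB : measurable ((fun x : realseq R => x k : R) @^-1` `]-oo, t]%classic).
  by apply: measurable_preim; [exact: measurable_coord|exact: measurable_itv].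
have := same u _ mB.
rewrite /cdfm /distribution /pushforward.
by rewrite (_ : (fun u0 : seq nat => T_ u0 : Omega -> realseq R) u @^-1` _ =
  point u k @^-1` `]-oo, t]%classic).
Qed.

Lemma point_pos u k : distribution P (point u k) `]-oo, 0%R]%classic = 0.
Proof.
have := congr1 (fun f => f 0%R) (point_cdfE u k); rewrite /cdfm => ->.
have HH := @heaviside_nnmeas R.
apply: (conv_eq0 la_pos); first exact: nnmeas_convn.
move=> x; apply: (convn_eq0 mu_pos) => //; exact: heaviside_lt0.
Qed.

Lemma measurable_birth j (u : j.-tuple nat) : measurable_fun setT (birth_time T u).
Proof.
by apply: measurable_sum => i; exact: (measurable_point (take i u) (tnth u i)).
Qed.

Definition birth j (u : j.-tuple nat) : {mfun Omega >-> R} :=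
  mfun_Sub (mem_set (measurable_birth u)).

Lemma birth_rcons j (u : j.-tuple nat) k w :
  (birth_time T [tuple of rcons u k] w = birth_time T u w + T_ u w k)%R.
Proof.
rewrite /birth_time big_ord_recr /=; congr (_ + _)%R.
  apply: eq_bigr => i _; congr (T _ w _).
    by rewrite -cats1 takel_cat// size_tuple ltnW.
  rewrite !(tnth_nth k) /= nth_rcons size_tuple.
  by rewrite ltn_ord.
congr (T _ w _).
  by rewrite -cats1 takel_cat ?size_tuple// take_oversize// size_tuple.
by rewrite (tnth_nth k) /= nth_rcons size_tuple ltnn eqxx.
Qed.

(** The birth time of u depends on the processes attached to the strict
prefixes of u, which are individuals different from u. *)
Lemma birth_indep j (u : j.-tuple nat) k : indep2 P (birth u) (point u k).
Proof.
pose g (v : seq nat) (x : realseq R) : R := x (nth k u (size v)).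
have mg v : measurable_fun setT (g v) by exact: measurable_coord.
have [_ ind] := T_copies.
pose X (v : seq nat) : {mfun Omega >-> R} := point v (nth k u (size v)).
have indX : mutually_independent P (fun v => X v : Omega -> R).
  exact: (mutually_independent_comp mg ind).
(* The strict prefixes of u are told apart by their lengths. *)
pose s := [seq take i u | i <- iota 0 j].
have size_take i : (i <= j)%N -> size (take i u) = i.
  by move=> ij; rewrite size_takel// size_tuple.
have us : uniq s.
  rewrite map_inj_in_uniq ?iota_uniq// => i i'; rewrite !mem_iota !add0n => /= ij i'j.
  by move=> /(congr1 size); rewrite !size_take// ltnW.
have us' : (u : seq nat) \notin s.
  apply/mapP => -[i]; rewrite mem_iota add0n /= => ij /(congr1 size).
  by rewrite size_take ?size_tuple ?(ltnW ij)// => ji; move: ij; rewrite ji ltnn.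
have -> : point u k = X u by rewrite /X nth_default// size_tuple.
apply: (indep_sum_variable indX us us') => w.
have jE : iota 0 j = index_iota 0 j by rewrite /index_iota subn0.
rewrite /s big_map jE big_mkord.
apply: eq_bigr => i _; rewrite /X /= size_take ?(ltnW (ltn_ord i))//.
by rewrite (tnth_nth k).
Qed.

Lemma birth_rcons_cdf j (u : j.-tuple nat) k t :
  P [set w | (birth_time T [tuple of rcons u k] w <= t)%R] =
  conv (distribution P (birth u)) (point_cdf k) t.
Proof.
rewrite -(point_cdfE u) -cdfm_sum; last exact: birth_indep.
by congr (P _); apply/seteqP; split => w /=; rewrite birth_rcons.
Qed.

(** All points of the perturbed walks are almost surely positive. *)
Lemma birth_lt0 j (u : j.-tuple nat) : P [set w | (birth_time T u w < 0)%R] = 0.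
Proof.
have mE : measurable [set w | (birth_time T u w < 0)%R].
  have := measurable_preim (measurable_birth u) (measurable_itv `]-oo, 0%R[).
  by congr measurable; apply/seteqP; split => w; rewrite /= in_itv.
apply/negligibleP => //.
pose F n := point (take n u) (nth 0%N u n) @^-1` `]-oo, 0%R]%classic.
have NF n : P.-negligible (F n).
  apply/negligibleP; last exact: point_pos.
  by apply: measurable_preim; [exact: measurable_funPT|exact: measurable_itv].
apply: negligibleS (negligible_bigcup NF) => w /= bw.
apply: contrapT => nF; move: bw; rewrite ltNge => /negP; apply.
apply: sumr_ge0 => i _; rewrite leNgt; apply/negP => Ti; apply: nF.
exists i => //; rewrite /F /= in_itv/=.
by rewrite (tnth_nth 0%N) in Ti; exact: ltW.
Qed.

Definition intensity j : {measure set R -> \bar R} :=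
  esum_measure (fun u : j.-tuple nat => distribution P (birth u)).

(** The number of births up to t is a sum of indicators over the individuals,
whose expectation is taken term by term. For negative t both sides vanish since
no birth time is negative, almost surely. *)
Lemma V_intensity j t : V_ P T j t = intensity j `]-oo, t]%classic.
Proof.
rewrite esum_measureE /V_; case: ltP => t0.
  apply/esym/esum1 => u _; apply/eqP; rewrite eq_le measure_ge0 andbT -(birth_lt0 u).
  suff : P (birth u @^-1` `]-oo, t]%classic) <= P [set w | (birth_time T u w < 0)%R] by [].
  apply: le_measure; rewrite ?inE.
  - by apply: measurable_preim; [exact: measurable_funPT|exact: measurable_itv].
  - have := measurable_preim (measurable_birth u) (measurable_itv `]-oo, 0%R[).
    by congr measurable; apply/seteqP; split => w; rewrite /= in_itv.
  - by move=> w; rewrite /= in_itv/= => bt; exact: le_lt_trans bt t0.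
rewrite /N_; under eq_integral do rewrite counting_esum.
have mE (u : j.-tuple nat) : measurable [set w | (birth_time T u w <= t)%R].
  have := measurable_preim (measurable_birth u) (measurable_itv `]-oo, t]).
  by congr measurable; apply/seteqP; split => w; rewrite /= in_itv.
have E (u : j.-tuple nat) : (fun w => (\1_[set u : j.-tuple nat | (birth_time T u w <= t)%R] u)%:E) =
    (fun w => (\1_[set w | (birth_time T u w <= t)%R] w)%:E) :> (Omega -> \bar R).
  by apply/funext => w; rewrite !indicE !mem_setE.
rewrite (integral_esum P (fun u : j.-tuple nat => _)) => [|u|u w]; last by rewrite lee_fin.
  apply: eq_esum => u _; rewrite E integral_indic// setIT.
  by congr (P _); apply/seteqP; split => w; rewrite /= in_itv.
by rewrite E; apply/measurable_EFinP; exact: measurable_indic.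
Qed.

Lemma intensity_lt0 j : intensity j `]-oo, 0%R[%classic = 0.
Proof.
rewrite esum_measureE; apply: esum1 => u _; rewrite -(birth_lt0 u).
by congr (P _); apply/seteqP; split => w; rewrite /= in_itv.
Qed.

Lemma esum_rcons j (a : j.+1.-tuple nat -> \bar R) : (forall u, 0 <= a u) ->
  \esum_(u in [set: j.+1.-tuple nat]) a u =
  \esum_(u in [set: j.-tuple nat]) \esum_(k in [set: nat]) a [tuple of rcons u k].
Proof.
move=> a0; rewrite esum_esum//.
rewrite (reindex_esum ([set: j.-tuple nat] `*`` (fun=> [set: nat])) _
  (fun z => [tuple of rcons z.1 z.2]))//.
split => //.
- move=> [u k] [u' k'] _ _ /= /(congr1 val) /= /rcons_inj[uu' ->].
  by congr (_, _); apply: val_inj.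
- move=> v _; exists ([tuple of belast (thead v) (behead v)], last (thead v) (behead v)) => //.
  by apply: val_inj => /=; rewrite -lastI; case: v => -[].
Qed.

Definition mean_offspring t := conv la (potential mu H) t.

Lemma mean_offspringE t : mean_offspring t = \sum_(0 <= k <oo) point_cdf k t.
Proof. by rewrite /mean_offspring /potential conv_series// => k; apply: nnmeas_convn; exact: heaviside_nnmeas. Qed.

(** The birth time of the k-th child of u is the sum of the independent variables
birth u and point u k; it remains to sum over k and u. *)
Lemma V_succ j t : V_ P T j.+1 t = conv (intensity j) mean_offspring t.
Proof.
have np k : nnmeas (point_cdf k).
  by apply: nnmeas_conv; apply: nnmeas_convn; exact: heaviside_nnmeas.
rewrite V_intensity esum_measureE esum_rcons//.
have [mV V0] : nnmeas (fun y => mean_offspring (t - y)%R).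
  by apply: nnmeas_subl; apply: nnmeas_conv; apply: nnmeas_potential; exact: heaviside_nnmeas.
rewrite /conv integral_esum_measure//; apply: eq_esum => u _.
transitivity (conv (distribution P (birth u)) (fun x => \sum_(0 <= k <oo) point_cdf k x) t); last first.
  by apply: eq_integral => y _; rewrite mean_offspringE.
rewrite conv_series// nneseries_esumT; last first.
  by move=> k; have [_] := nnmeas_conv (distribution P (birth u)) (np k).
apply: eq_esum => k _; rewrite -birth_rcons_cdf.
by rewrite /distribution /pushforward; congr (P _); apply/seteqP; split => w; rewrite /= in_itv.
Qed.

End branching.

Local Close Scope ereal_scope.

(** * The two limits *)

Section distribution_function.
Context {R : realType}.
Variable nu : {measure set R -> \bar R}.
Variable V : R -> R.
Hypothesis nuV : forall t, (nu `]-oo, t]%classic = (V t)%:E)%E.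

(** Continuity of nu from above. *)
Lemma cdf_right_continuous : right_continuous V.
Proof.
move=> a; apply/cvgrPdist_lt => e e0.
have cvgV : (V (a + n.+1%:R^-1))%:E @[n --> \oo] --> (V a)%:E.
  pose D n := `]-oo, (a + n.+1%:R^-1)]%classic : set R.
  have -> : (fun n => (V (a + n.+1%:R^-1))%:E) = nu \o D by apply/funext => n /=; rewrite -nuV.
  rewrite -nuV (itvNycEbigcap false); apply: nonincreasing_cvg_mu => [|n||x y xy].
  - by rewrite nuV ltry.
  - exact: measurable_itv.
  - by apply: bigcap_measurable => // n _; exact: measurable_itv.
  - apply/subsetPset; apply: subset_itvl.
    by rewrite bnd_simp lerD2l lef_pV2 ?posrE// ler_nat.
have [N HN] : exists N, V (a + N.+1%:R^-1) < V a + e.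
  have near1 : \forall n \near \oo, ((V (a + n.+1%:R^-1))%:E < (V a + e)%:E)%E.
    apply: (cvgV [set x : \bar R | (x < (V a + e)%:E)%E]).
    apply: open_nbhs_nbhs; split; first exact: open_ereal_lt_ereal.
    by rewrite /= lte_fin ltrDl.
  by have [N] := filter_ex near1; rewrite lte_fin; exists N.
near=> x.
have ax : a < x by near: x; exact: nbhs_right_gt.
have xN : x <= a + N.+1%:R^-1.
  by near: x; apply: nbhs_right_le; rewrite ltrDl invr_gt0.
have h1 : V a <= V x by apply: (cdf_homo nuV); exact: ltW.
have h2 : V x <= V (a + N.+1%:R^-1) by exact: (cdf_homo nuV).
by rewrite distrC ger0_norm ?subr_ge0//; lra.
Unshelve. all: by end_near. Qed.

Lemma cdf_cumulative : exists F : cumulative R R, V = F :> (R -> R).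
Proof.
pose cV := isCumulative.Build R _ R V (cdf_homo nuV) cdf_right_continuous.
pose F : cumulative R R := HB.pack V cV.
by exists F.
Qed.

End distribution_function.

Lemma asymp_ratio_cvg (R : realType) (p : nat) (g : R -> R) (c : R) : 
  asymp p g c -> (g t / t ^+ p) @[t --> +oo] --> c.
Proof.
move=> gc; apply/cvgrPdist_le => e e0.
have [T HT] := gc e e0; near=> t.
have tT : T <= t by near: t; apply: nbhs_pinfty_ge; exact: num_real.
have t0 : 0 < t ^+ p by apply: exprn_gt0; near: t; exact: nbhs_pinfty_gt.
have -> : c - g t / t ^+ p = - ((g t - c * t ^+ p) / t ^+ p).
  by rewrite mulrBl mulfK ?lt0r_neq0//; ring.
by rewrite normrN normrM normfV (gtr0_norm t0) ler_pdivrMr// HT.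
Unshelve. all: by end_near. Qed.

Lemma asymp_quotient_cvg (R : realType) (p : nat) (g G : R -> R) (c c' : R) :
  c' != 0 -> asymp p g c -> asymp p G c' -> (g t / G t) @[t --> +oo] --> c / c'.
Proof.
move=> c'0 gc Gc'.
apply: cvg_trans _ (cvgM (asymp_ratio_cvg gc) (cvgV c'0 (asymp_ratio_cvg Gc'))).
apply: near_eq_cvg; near=> t.
have t0 : 0 < t ^+ p by apply: exprn_gt0; near: t; exact: nbhs_pinfty_gt.
by rewrite /= invfM invrK mulrACA mulVf ?mulr1// lt0r_neq0.
Unshelve. all: by end_near. Qed.

Lemma asymp_gt0 (R : realType) (p : nat) (G : R -> R) (c : R) : 
  0 < c -> asymp p G c -> \forall t \near +oo, 0 < G t.
Proof.
move=> c0 Gc; have [T HT] := Gc (c / 2) (divr_gt0 c0 (ltr0Sn R 1)).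
near=> t; have tT : T <= t by near: t; apply: nbhs_pinfty_ge; exact: num_real.
have t0 : 0 < t ^+ p by apply: exprn_gt0; near: t; exact: nbhs_pinfty_gt.
have := HT _ tT; rewrite ler_norml => /andP[+ _].
have : 0 < c * t ^+ p by exact: mulr_gt0.
lra.
Unshelve. all: by end_near. Qed.

(** The null event X <= 0 is dropped to pass to the half-line. *)
Lemma mean_law d (Omega : measurableType d) (R : realType) (P : probability Omega R)
    (X : {RV P >-> R}) : {ae P, forall w, 0 < X w} ->
  (\int[distribution P X]_(y in `]0%R, +oo[) y%:E = 'E_P[X])%E.
Proof.
move=> X0; rewrite integral_mkcond.
have mR : measurable (`]0%R, +oo[%classic : set R) by exact: measurable_itv.
have mphi : measurable_fun setT ((EFin : R -> \bar R) \_ `]0%R, +oo[%classic).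
  by apply/(measurable_restrictT _ mR)/measurable_EFinP; exact: measurable_id.
rewrite (ge0_integral_distribution X mphi); last first.
  move=> y; rewrite patchE; case: ifPn => // /set_mem /=; rewrite in_itv/= andbT => y0.
  by rewrite lee_fin ltW.
rewrite expectation_def; apply: ae_eq_integral => //.
- by apply: measurableT_comp => //; exact: measurable_funPT.
- by apply/measurable_EFinP; exact: measurable_funPT.
- apply: filterS X0 => w w0 _; rewrite /= patchE mem_set//=.
  by rewrite in_itv/= w0.
Qed.

Local Open Scope ereal_scope.

Theorem theorem2p3 (R : realType) (d : measure_display)
  (Omega : measurableType d) (P : probability Omega R)
  (xi eta : {RV P >-> R}) (xi_ eta_ : nat -> {RV P >-> R})
  (T_ : seq nat -> {RV P >-> realseq R})
  (m : R) (f : R -> R) (j : nat)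
  (xi_pos : {ae P, forall w, (0 < xi w)%R})
  (eta_pos : {ae P, forall w, (0 < eta w)%R})
  (xi_eta_copies : independent_copies P
     (fun (i : nat) w => (xi_ i w, eta_ i w) : (R * R)%type)
     (fun w => (xi w, eta w) : (R * R)%type))
  (T_copies : independent_copies P
     (fun (u : seq nat) => T_ u : Omega -> realseq R)
     (perturbed_walk (fun i => xi_ i : Omega -> R) (fun i => eta_ i : Omega -> R)))
  (f_ge0 : forall x : R, (0 <= x)%R -> (0 <= f x)%R)
  (f_dRi : directly_Riemann_integrable f)
  (xi_nonlattice : nonlattice (distribution P xi))
  (xi_mean : 'E_P[xi] = m%:E)
  (j_ge1 : (1 <= j)%N) :
  let V := V_ P (fun u : seq nat => T_ u : Omega -> realseq R) in
  ((\int[stieltjes (V j)]_(y in `[0%R, t]) (f (t - y)%R)%:E) / V j.-1 t)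
    @[t --> +oo%R] -->
    (m^-1)%:E * \int[lebesgue_measure]_(y in `[0%R, +oo[) (f y)%:E
  /\
  ((\int[stieltjes (V j)]_(y in `[0%R, t]) (f (t - y)%R)%:E)
      / (t ^+ j.-1)%:E)
    @[t --> +oo%R] -->
    (((j.-1)`!%:R * m ^+ j)^-1)%:E
      * \int[lebesgue_measure]_(y in `[0%R, +oo[) (f y)%:E.
Proof.
move=> V; case: j j_ge1 => // k _ /=.
have mu_pos := law_pos xi_pos; have la_pos := law_pos eta_pos.
have mu_mean := mean_law xi_pos; rewrite xi_mean in mu_mean.
have m0 := mean_gt0 mu_pos mu_mean.
pose nu i : {measure set R -> \bar R} := intensity T_ i.
have nuV i t : V i t = nu i `]-oo, t]%classic.
  exact: (V_intensity xi_pos eta_pos xi_eta_copies T_copies).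
have nu0 t : nu 0%N `]-oo, t]%classic = heaviside t.
  rewrite -nuV /heaviside indicE mem_setE in_itv/= andbT.
  by case: (leP 0%R t) => t0; [rewrite /V V_0|rewrite /V /V_ t0].
have nu_lt0 i : nu i `]-oo, 0%R[%classic = 0.
  exact: (intensity_lt0 xi_pos eta_pos xi_eta_copies T_copies).
have nuS i t : (nu i.+1 `]-oo, t]%classic =
    conv (nu i) (conv (distribution P eta) (potential (distribution P xi) (@heaviside R))) t)%E.
  by rewrite -nuV; exact: (V_succ xi_pos eta_pos xi_eta_copies T_copies).
pose G := generation nu.
have GE i t : nu i `]-oo, t]%classic = (G i t)%:E.
  exact: (generationE mu_pos la_pos nu0 nu_lt0 nuS).
have Gasymp i : asymp i (G i) (rate m i).
  exact: (generation_asymp mu_pos la_pos xi_nonlattice mu_mean nu0 nu_lt0 nuS).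
have [F GF] := cdf_cumulative (GE k.+1).
have VF t : V k.+1 t = (F t)%:E by rewrite nuV GE GF.
rewrite (stieltjesE VF).
have rm0 : (0 <= rate m k / m)%R by rewrite divr_ge0 ?(rate_ge0 mu_pos mu_mean)// ltW.
have FB h : (0 < h)%R -> asymp k (fun t => F t - F (t - h))%R (h * (rate m k / m))%R.
  rewrite -GF mulrA => h0.
  exact: (generation_blackwell mu_pos la_pos xi_nonlattice mu_mean nu0 nu_lt0 nuS).
have Fb h : (0 < h)%R -> exists C T, forall t s, (T <= t)%R -> (s <= t)%R ->
    (F s - F (s - h) <= C * t ^+ k)%R.
  rewrite -GF => h0.
  exact: (generation_incr_bound mu_pos la_pos xi_nonlattice mu_mean nu0 nu_lt0 nuS).
have [J JE [J0 [g [T gE] gJ]]] := key_renewal rm0 FB Fb f_ge0 f_dRi.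
rewrite JE -!EFinM.
have rate0 : (0 < rate m k)%R by rewrite invr_gt0 mulr_gt0 ?exprn_gt0// ltr0n fact_gt0.
split.
  have -> : (m^-1 * J = rate m k / m * J / rate m k)%R by field; rewrite !lt0r_neq0.
  apply: cvg_trans (_ : ((g t / G k t)%R)%:E @[t --> +oo%R] --> _); last first.
    apply: cvg_EFin; first by apply: nearW.
    by apply: (asymp_quotient_cvg _ gJ (Gasymp k)); rewrite lt0r_neq0.
  apply: near_eq_cvg; near=> t.
  have Gt : (0 < G k t)%R by near: t; exact: asymp_gt0 (Gasymp k).
  rewrite gE; last by near: t; apply: nbhs_pinfty_ge; exact: num_real.
  by rewrite nuV GE inver gt_eqF.
have -> : ((k`!%:R * m ^+ k.+1)^-1 * J = rate m k / m * J)%R.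
  by rewrite /rate exprSr mulrA invfM.
apply: cvg_trans (_ : ((g t / t ^+ k)%R)%:E @[t --> +oo%R] --> _); last first.
  apply: cvg_EFin; first by apply: nearW.
  exact: asymp_ratio_cvg.
apply: near_eq_cvg; near=> t.
have t0 : (0 < t ^+ k)%R by apply: exprn_gt0; near: t; exact: nbhs_pinfty_gt.
rewrite gE; last by near: t; apply: nbhs_pinfty_ge; exact: num_real.
by rewrite inver gt_eqF.
Unshelve. all: by end_near. Qed.
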